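(* Let $n\ge2$, let $M\ge0$ be real, and let $\varphi_0,\varphi_1\in C_0^\infty(\mathbb R^n)$. The solution $u=u(x,t)$ of the Cauchy problem $$u_{tt}-e^{-2t}\Delta u+M^2u=0,\qquad u(x,0)=\varphi_0(x),\quad u_t(x,0)=\varphi_1(x),$$ can be represented, with $\phi(t):=1-e^{-t}$, as $$u(x,t)=e^{\frac t2}v_{\varphi_0}(x,\phi(t))+2\int_0^1v_{\varphi_0}(x,\phi(t)s)K_0(\phi(t)s,t)\phi(t)\,ds+2\int_0^1v_{\varphi_1}(x,\phi(t)s)K_1(\phi(t)s,t)\phi(t)\,ds,\qquad x\in\mathbb R^n,\ t>0 .$$ Here, for $\varphi\in C_0^\infty(\mathbb R^n)$: if $n=2m+1$, $m\in\mathbb N$, $$v_\varphi(x,\phi(t)s):=\left(\frac{\partial}{\partial r}\Big(\frac1r\frac{\partial}{\partial r}\Big)^{\frac{n-3}2}\frac{r^{n-2}}{\omega_{n-1}c_0^{(n)}}\int_{S^{n-1}}\varphi(x+ry)\,dS_y\right)_{r=\phi(t)s},\qquad c_0^{(n)}=1\cdot3\cdots(n-2),$$ and if $n=2m$, $m\in\mathbb N$, $$v_\varphi(x,\phi(t)s):=\left(\frac{\partial}{\partial r}\Big(\frac1r\frac{\partial}{\partial r}\Big)^{\frac{n-2}2}\frac{2r^{n-1}}{\omega_{n}c_0^{(n)}}\int_{B_1^n(0)}\frac{\varphi(x+ry)}{\sqrt{1-|y|^2}}\,dV_y\right)_{r=\phi(t)s},\qquad c_0^{(n)}=1\cdot3\cdots(n-1).$$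 The function $v_\varphi(x,\phi(t)s)$ coincides with the value $v(x,\phi(t)s)$ of the solution $v(x,t)$ of the Cauchy problem $v_{tt}-\Delta v=0$, $v(x,0)=\varphi(x)$, $v_t(x,0)=0$.
   Context: $F(a,b;c;\zeta)$ is the Gauss hypergeometric function, $\Delta$ the Laplacian in $\mathbb R^n$; $\omega_{k}$ is the area of the unit sphere $S^{k}\subset\mathbb R^{k+1}$; $B_1^n(0)$ is the closed unit ball of $\mathbb R^n$. For $0\le z\le1-e^{-t}$ put $\zeta:=\dfrac{(1-e^{-t})^2-z^2}{(1+e^{-t})^2-z^2}$. The kernels are $$K_0(z,t)=\frac{(4e^{-t})^{iM}\big((e^{-t}+1)^2-z^2\big)^{-iM}}{[(1-e^{-t})^2-z^2]\sqrt{(e^{-t}+1)^2-z^2}}\Big[\big(e^{-t}-1-iM(e^{-2t}-1-z^2)\big)F\big(\tfrac12+iM,\tfrac12+iM;1;\zeta\big)+\big(1-e^{-2t}+z^2\big)\big(\tfrac12-iM\big)F\big(-\tfrac12+iM,\tfrac12+iM;1;\zeta\big)\Big]$$ (understood by continuity at $z=1-e^{-t}$), and $$K_1(z,t)=(4e^{-t})^{iM}\big((1+e^{-t})^2-z^2\big)^{-\frac12-iM}F\big(\tfrac12+iM,\tfrac12+iM;1;\zeta\big).$$ *)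

(* Defs.v *)
From mathcomp Require Import all_boot all_order all_algebra.
From mathcomp Require Import all_classical all_reals all_analysis.
From mathcomp.real_closed Require Import complex.

Set Implicit Arguments.
Unset Strict Implicit.
Unset Printing Implicit Defensive.

Import Order.TTheory GRing.Theory Num.Theory.
Import numFieldNormedType.Exports.

Local Open Scope classical_set_scope.
Local Open Scope ring_scope.
Local Open Scope complex_scope.

Section Regularity.
Context {R : realType}.

(* [Ck axes k f]: all iterated derivatives of f of order at most k along the
   directions in [axes] exist everywhere and are continuous. *)
Fixpoint Ck (V : normedModType R) (axes : set V) (k : nat) (f : V -> R) : Prop :=
  continuous f /\
  if k is j.+1 then
    forall v, axes v -> (forall x, derivable f x v) /\ Ck axes j ('D_v f)
  else True.

Definition basis_vec (n : nat) (i : 'I_n) : 'rV[R]_n := delta_mx 0 i.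

Definition test_function (n : nat) (f : 'rV[R]_n -> R) : Prop :=
  (forall k, Ck (range (@basis_vec n)) k f) /\
  compact (closure [set x | f x != 0]).

Definition space_dir (n : nat) (i : 'I_n) : 'rV[R]_n * R := (basis_vec i, 0).
Definition time_dir (n : nat) : 'rV[R]_n * R := (0, 1).
Definition spacetime_axes (n : nat) : set ('rV[R]_n * R) :=
  range (@space_dir n) `|` [set time_dir n].

Definition laplacian_x (n : nat) (U : 'rV[R]_n * R -> R) (p : 'rV[R]_n * R) : R :=
  \sum_(i < n) 'D_(space_dir i) ('D_(space_dir i) U) p.

(* u is a classical solution on R^n x [0, +oo[ of
     u_tt - c2(t) Delta u + m2 u = 0,  u(., 0) = f0,  u_t(., 0) = f1.
   Being C^2 up to the boundary t = 0 is expressed by the existence of a C^2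
   function U on R^n x R that coincides with u for t >= 0; the values of u at
   negative times play no role. *)
Definition cauchy_solution (n : nat) (c2 : R -> R) (m2 : R)
    (f0 f1 : 'rV[R]_n -> R) (u : 'rV[R]_n -> R -> R) : Prop :=
  exists U : 'rV[R]_n * R -> R,
    [/\ Ck (@spacetime_axes n) 2 U,
        forall x t, 0 <= t -> u x t = U (x, t),
        forall x t, 0 <= t ->
          'D_(time_dir n) ('D_(time_dir n) U) (x, t)
          - c2 t * laplacian_x U (x, t) + m2 * U (x, t) = 0,
        forall x, U (x, 0) = f0 x &
        forall x, 'D_(time_dir n) U (x, 0) = f1 x].

Definition klein_gordon_solution (n : nat) (M : R) :=
  @cauchy_solution n (fun t => expR (- (2 * t))) (M ^+ 2).

Definition wave_solution (n : nat) (f : 'rV[R]_n -> R) :=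
  cauchy_solution (fun=> 1) 0 f (fun=> 0).

End Regularity.

Section SphericalMeans.
Context {R : realType}.
Local Notation mu := (@lebesgue_measure R).

(* Surface integral over S^k in R^(k+1), in geographic coordinates: a point of
   S^(j+1) is (cos theta, sin theta * w) with 0 <= theta <= pi and w in S^j, and
   dS = sin^j theta dtheta dS_w; S^0 = {1, -1} carries the counting measure. *)
Fixpoint sphere_int (k : nat) : ('rV[R]_k.+1 -> R) -> R :=
  match k with
  | 0 => fun f => f (const_mx 1) + f (const_mx (-1))
  | j.+1 => fun f =>
      \int[mu]_(theta in `[0, pi])
        (sin theta ^+ j *
         sphere_int (fun w : 'rV[R]_j.+1 =>
           f (row_mx (cos theta)%:M (sin theta *: w) : 'rV[R]_(1 + j.+1))))
  end.

Definition sphere_area (k : nat) : R := @sphere_int k (fun=> 1).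

(* Surface integral over S^(n-1) in R^n; only meaningful for n > 0. *)
Definition usphere_int (n : nat) : ('rV[R]_n -> R) -> R :=
  if n is k.+1 then @sphere_int k else fun=> 0.

(* Lebesgue integral over R^n, as an iterated integral over the coordinates. *)
Fixpoint volume_int (n : nat) : ('rV[R]_n -> R) -> R :=
  match n with
  | 0 => fun f => f 0
  | j.+1 => fun f =>
      \int[mu]_(a in setT)
        volume_int (fun y : 'rV[R]_j => f (row_mx a%:M y : 'rV[R]_(1 + j)))
  end.

(* Square of the Euclidean norm; the library's norm on 'rV is the sup norm. *)
Definition sqnorm (n : nat) (y : 'rV[R]_n) : R := \sum_(i < n) y 0 i ^+ 2.

Definition unit_ball (n : nat) : set 'rV[R]_n := [set y | sqnorm y <= 1].

(* [c0 n] is 1 * 3 * ... * (n - 2) for n odd, 1 * 3 * ... * (n - 1) for n even. *)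
Definition c0 (n : nat) : R := \prod_(i < n./2) (2 * i + 1)%:R.

Definition odd_mean (n : nat) (f : 'rV[R]_n -> R) (x : 'rV[R]_n) (r : R) : R :=
  r ^+ (n - 2) / (sphere_area n.-1 * c0 n) *
  usphere_int (fun y => f (x + r *: y)).

Definition even_mean (n : nat) (f : 'rV[R]_n -> R) (x : 'rV[R]_n) (r : R) : R :=
  2 * r ^+ (n - 1) / (sphere_area n * c0 n) *
  volume_int ((fun y => f (x + r *: y) / Num.sqrt (1 - sqnorm y)) \_ (@unit_ball n)).

(* d/dr ((1/r) d/dr)^j g. The means above are odd smooth functions of r in R,
   divisible by r^(2j+1), and the convention 0^-1 = 0 gives the right value,
   0, to ((1/r) d/dr)^j g at r = 0. *)
Definition radial_op (j : nat) (g : R -> R) : R -> R :=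
  derive1 (iter j (fun h r => r^-1 * derive1 h r) g).

Definition v_ (n : nat) (f : 'rV[R]_n -> R) (x : 'rV[R]_n) : R -> R :=
  if odd n then radial_op (n - 3)./2 (odd_mean f x)
  else radial_op (n - 2)./2 (even_mean f x).

End SphericalMeans.

Section Kernels.
Context {R : realType}.
Local Notation mu := (@lebesgue_measure R).

Definition pochhammer (a : R[i]) (k : nat) : R[i] := \prod_(j < k) (a + j%:R).

(* Gauss hypergeometric function, for `|z| < 1. *)
Definition hyp2F1 (a b c z : R[i]) : R[i] :=
  limn (series (fun k : nat =>
    pochhammer a k * pochhammer b k / (pochhammer c k * k`!%:R) * z ^+ k : R[i]^o)).

(* Principal power x^w of a positive real x. *)
Definition cpow (x : R) (w : R[i]) : R[i] :=
  let arg := complex.Im w * ln x in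
  (x `^ complex.Re w)%:C * (cos arg +i* sin arg).

Definition cint (D : set R) (f : R -> R[i]) : R[i] :=
  (\int[mu]_(s in D) complex.Re (f s)) +i* (\int[mu]_(s in D) complex.Im (f s)).

Definition phi (t : R) : R := 1 - expR (- t).

Definition zeta (z t : R) : R :=
  ((1 - expR (- t)) ^+ 2 - z ^+ 2) / ((1 + expR (- t)) ^+ 2 - z ^+ 2).

Definition K0_formula (M z t : R) : R[i] :=
  let q := expR (- t) in
  let iM : R[i] := 0 +i* M in
  let F a b := hyp2F1 a b 1 (zeta z t)%:C in
  cpow (4 * q) iM * cpow ((q + 1) ^+ 2 - z ^+ 2) (- iM)
  / (((1 - q) ^+ 2 - z ^+ 2) * Num.sqrt ((q + 1) ^+ 2 - z ^+ 2))%:C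
  * (((q - 1)%:C - iM * (q ^+ 2 - 1 - z ^+ 2)%:C) * F (2^-1 + iM) (2^-1 + iM)
     + (1 - q ^+ 2 + z ^+ 2)%:C * (2^-1 - iM) * F (- 2^-1 + iM) (2^-1 + iM)).

(* At z = 1 - e^(-t) the formula reads 0/0 and K0 is defined by continuity. *)
Definition K0 (M z t : R) : R[i] :=
  if z == phi t then lim ((K0_formula M z' t : R[i]^o) @[z' --> (phi t)^'-])
  else K0_formula M z t.

Definition K1 (M z t : R) : R[i] :=
  let q := expR (- t) in
  let iM : R[i] := 0 +i* M in
  cpow (4 * q) iM * cpow ((1 + q) ^+ 2 - z ^+ 2) (- 2^-1 - iM)
  * hyp2F1 (2^-1 + iM) (2^-1 + iM) 1 (zeta z t)%:C.

End Kernels.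

(* Main.v *)
Require Import Defs.
From mathcomp Require Import all_boot all_order all_algebra.
From mathcomp Require Import all_classical all_reals all_analysis.
From mathcomp.real_closed Require Import complex.
From mathcomp Require measurable_realfun.
From mathcomp Require Import ring lra zify.
Import Order.TTheory GRing.Theory Num.Theory.
Import numFieldNormedType.Exports.
Local Open Scope classical_set_scope.
Local Open Scope ring_scope.
Local Open Scope complex_scope.
(* Write K = e^(t/2) f(eta) / 2 with eta = (phi(t)^2 - z^2) / (4 e^(-t)); then K1 is of this
   form, and the hypergeometric equation for F becomes
   eta (1 + eta) f'' + (1 + 2 eta) f' + (1/4 + M^2) f = 0.
   For a smooth g(x, r) set w[g](x, t) = 2 int_0^1 g(x, phi(t) s) K(phi(t) s, t) phi(t) ds and
   P = d_tt - e^(-2t) Delta + M^2.  If g_rr = Delta g + h and g_r(x, 0) = 0, then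
   P w[g] = e^(-2t) w[h], because the two integrands differ by the s-derivative of a flux
   that vanishes at s = 0 and at s = 1.  Hence P w[v] = 0 for a solution v of the wave
   equation with v_r(x, 0) = 0; moreover P d_t w[v] = - 2 e^(-2t) Delta w[v], which is cancelled
   by P w[r v_r] = 2 e^(-2t) Delta w[v].  So w[v1] + d_t w[v0] + w[r v0_r] solves the
   Klein-Gordon problem, and an integration by parts in s turns the last two terms into the
   terms with K0 (a contiguity relation of F identifies the kernel).
   The functions v_phi come from spherical means, which solve the Euler-Poisson-Darboux
   equation, the even dimensions by descent.  Uniqueness is an energy estimate in backward
   light cones.  The real part of the complex kernels gives the solution; their imaginary
   part gives a solution with zero data. *)

Set Implicit Arguments.
Unset Strict Implicit.
Unset Printing Implicit Defensive.

(** * Directional derivatives and integrals over segments *)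

(** Origin of [r v_r]: the equation is invariant under t -> t + a, x -> e^(-a) x, so d_t - x.grad
    maps solutions to solutions. If v is a wave solution, so is x.grad v + r v_r, and its transform
    is a solution; adding it to (d_t - x.grad) w[v] leaves d_t w[v] + w[r v_r], with value v(x, 0)
    and time derivative 0 at t = 0. By Pfaff's transformation, f(eta) = (1 + eta)^(-a) F(a, a; 1;
    eta / (1 + eta)) with a = 1/2 + iM equals F(a, 1 - a; 1; - eta), a Legendre function of 1 + 2
    eta. It is analytic near eta = 0, which is why the kernels stay regular at z = phi(t), although
    the formula of K0 divides by zero there. The constant 1/4 + M^2 of its equation is a (1 - a).
    Three singularities shape the rest. The division by r in the radial operator is replaced by
    Euler operators c + r d/dr. The density 1 / sqrt(1 - |y|^2) becomes the surface measure of a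
    sphere in one dimension more. The moving boundary of the light cone in the energy estimate
    becomes a C^1 weight on a fixed cube. *)

Section Derivatives.
Context {R : realType}.

Lemma dadd (V : normedModType R) (f g : V -> R) x v df dg :
  is_derive x v f df -> is_derive x v g dg ->
  is_derive x v (fun y => f y + g y) (df + dg).
Proof. exact: is_deriveD. Qed.

Lemma dopp (V : normedModType R) (f : V -> R) x v df :
  is_derive x v f df -> is_derive x v (fun y => - f y) (- df).
Proof. exact: is_deriveN. Qed.

Lemma dsub (V : normedModType R) (f g : V -> R) x v df dg :
  is_derive x v f df -> is_derive x v g dg ->
  is_derive x v (fun y => f y - g y) (df - dg).
Proof. exact: is_deriveB. Qed.

Lemma dmul (V : normedModType R) (f g : V -> R) x v df dg :
  is_derive x v f df -> is_derive x v g dg ->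
  is_derive x v (fun y => f y * g y) (df * g x + f x * dg).
Proof.
move=> Df Dg.
have H : is_derive x v (f * g) (f x *: dg + g x *: df) by exact: is_deriveM.
have -> : df * g x + f x * dg = f x *: dg + g x *: df by rewrite addrC [df * _]mulrC.
exact: H.
Qed.

Lemma dcst (V : normedModType R) (c : R) (x v : V) : is_derive x v (fun=> c) (0 : R).
Proof. exact: (is_derive_cst (V:=V) (W:=R)). Qed.

Lemma dcmul (V : normedModType R) (c : R) (f : V -> R) x v df :
  is_derive x v f df -> is_derive x v (fun y => c * f y) (c * df).
Proof.
by move=> D; have := dmul (dcst c x v) D; rewrite mul0r add0r; apply.
Qed.

Lemma dsum (V : normedModType R) n (f : 'I_n -> V -> R) x v (df : 'I_n -> R) :
  (forall i, is_derive x v (f i) (df i)) ->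
  is_derive x v (fun y => \sum_(i < n) f i y) (\sum_(i < n) df i).
Proof.
elim: n f df => [|n IHn] f df H.
  under eq_fun do rewrite big_ord0.
  by rewrite big_ord0; exact: dcst.
under eq_fun do rewrite big_ord_recr /=.
rewrite big_ord_recr /=.
by apply: dadd => //; exact: IHn.
Qed.

Lemma derive_at (V : normedModType R) (f : V -> R) x v d :
  is_derive x v f d -> 'D_v f x = d.
Proof. by move=> [_]. Qed.

Lemma derivable_at (V : normedModType R) (f : V -> R) x v d :
  is_derive x v f d -> derivable f x v.
Proof. by move=> []. Qed.

Lemma scaleR1 (t : R) : t *: (1 : R) = t.
Proof. by rewrite /GRing.scale /= mulr1. Qed.

(** The two sides being equal as functions of t, both existence and value of a derivative pass
    between f and its restriction to a line. All differentiation in several variables below is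
    reduced to lines in this way. *)
Lemma dline_quotient (V : normedModType R) (f : V -> R) (x v : V) (h : R) :
  (fun t : R => t^-1 *: (((fun t : R => f (x + t *: v)) \o shift h) (t *: (1 : R)) - f (x + h *: v)))
  = (fun t : R => t^-1 *: ((f \o shift (x + h *: v)) (t *: v) - f (x + h *: v))).
Proof. by apply/funext => t /=; rewrite scaleR1 scalerDl addrCA. Qed.

Lemma dline (V : normedModType R) (f : V -> R) (x v : V) (h d : R) :
  is_derive (x + h *: v) v f d -> is_derive h 1 (fun t : R => f (x + t *: v)) d.
Proof.
by move=> [E vE]; apply: DeriveDef; rewrite ?/derivable ?/derive dline_quotient.
Qed.

Lemma dlineP (V : normedModType R) (f : V -> R) (x v : V) (d : R) :
  is_derive (0 : R) (1 : R) (fun t : R => f (x + t *: v)) d -> is_derive x v f d.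
Proof.
have E0 : x = x + 0 *: v by rewrite scale0r addr0.
by rewrite {2}E0 => -[E vE]; apply: DeriveDef;
  rewrite ?/derivable ?/derive -dline_quotient.
Qed.

Lemma dcomp1 (V : normedModType R) (h : R -> R) (f : V -> R) x v dh df :
  is_derive (f x) 1 h dh -> is_derive x v f df ->
  is_derive x v (fun y => h (f y)) (dh * df).
Proof.
move=> Dh Df; apply: dlineP.
have D2 : is_derive (0 : R) 1 (fun t : R => f (x + t *: v)) df.
  by apply: dline; rewrite scale0r addr0.
have D1 : is_derive (f (x + 0 *: v)) 1 h dh by rewrite scale0r addr0.
exact: is_derive1_comp D1 D2.
Qed.

Lemma is_derive_continuous (f : R -> R) (x d : R) : is_derive x (1 : R) f d -> {for x, continuous f}.
Proof. by move=> [E _]; apply/differentiable_continuous/derivable1_diffP. Qed.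

Lemma mean_value (f df : R -> R) (h : R) :
  (forall t : R, is_derive t (1 : R) f (df t)) ->
  exists2 c, `|c| <= `|h| & f h - f 0 = df c * h.
Proof.
move=> D.
have cf : continuous f by move=> t; apply: is_derive_continuous (D t).
have [h0|h0] := leP 0 h.
  have [c] := @MVT_segment _ f df 0 h h0 (fun x _ => D x) (continuous_subspaceT cf).
  rewrite in_itv /= => /andP[c0 ch] E; exists c; last by rewrite E subr0.
  by rewrite !ger0_norm.
have [c] := @MVT_segment _ f df h 0 (ltW h0) (fun x _ => D x) (continuous_subspaceT cf).
rewrite in_itv /= => /andP[c0 ch] E; exists c.
  by rewrite !ler0_norm ?lerN2 // ltW.
by rewrite -opprB E sub0r mulrN opprK.
Qed.

End Derivatives.

Section Continuity.
Context {R : realType} {T : topologicalType}.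

Lemma ctC (W : topologicalType) (c : W) : continuous (fun _ : T => c).
Proof. by move=> x; exact: cvg_cst. Qed.

Lemma ctI : continuous (fun x : T => x).
Proof. by move=> x; exact: cvg_id. Qed.

Lemma ctcomp (W Z : topologicalType) (g : W -> Z) (f : T -> W) :
  continuous g -> continuous f -> continuous (fun x => g (f x)).
Proof. by move=> cg cf x; apply: continuous_comp; [exact: cf|exact: cg]. Qed.

Lemma ctpair (W Z : topologicalType) (f : T -> W) (g : T -> Z) :
  continuous f -> continuous g -> continuous (fun x => (f x, g x)).
Proof. by move=> cf cg x; apply: cvg_pair; [exact: cf|exact: cg]. Qed.

Lemma ctfst (W Z : topologicalType) (f : T -> W * Z) :
  continuous f -> continuous (fun x => (f x).1).
Proof. by move=> cf x; apply: (@cvg_comp _ _ _ f fst); [exact: cf|exact: cvg_fst]. Qed.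

Lemma ctsnd (W Z : topologicalType) (f : T -> W * Z) :
  continuous f -> continuous (fun x => (f x).2).
Proof. by move=> cf x; apply: (@cvg_comp _ _ _ f snd); [exact: cf|exact: cvg_snd]. Qed.

Lemma ctD (V : normedModType R) (f g : T -> V) :
  continuous f -> continuous g -> continuous (fun x => f x + g x).
Proof. by move=> cf cg x; apply: cvgD; [exact: cf|exact: cg]. Qed.

Lemma ctN (V : normedModType R) (f : T -> V) :
  continuous f -> continuous (fun x => - f x).
Proof. by move=> cf x; apply: cvgN; exact: cf. Qed.

Lemma ctZ (V : normedModType R) (k : T -> R) (f : T -> V) :
  continuous k -> continuous f -> continuous (fun x => k x *: f x).
Proof. by move=> ck cf x; apply: cvgZ; [exact: ck|exact: cf]. Qed.

Lemma ctM (f g : T -> R) :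
  continuous f -> continuous g -> continuous (fun x => f x * g x).
Proof. by move=> cf cg x; apply: cvgM; [exact: cf|exact: cg]. Qed.

Lemma ctX (f : T -> R) n : continuous f -> continuous (fun x => f x ^+ n).
Proof.
move=> cf; elim: n => [|n IHn]; first exact: ctC.
by under eq_fun do rewrite exprS; exact: ctM.
Qed.

Lemma ctsum (I : Type) (r : seq I) (f : I -> T -> R) :
  (forall i, continuous (f i)) -> continuous (fun x => \sum_(i <- r) f i x).
Proof.
move=> cf; elim: r => [|i r IHr].
  by under eq_fun do rewrite big_nil; exact: ctC.
by under eq_fun do rewrite big_cons; apply: ctD.
Qed.

End Continuity.

(** * Integrals over a segment, with and without a parameter *)

Section Integrals.
Context {R : realType}.
Local Notation mu := (@lebesgue_measure R).

Lemma cont_integrable (f : R -> R) (a b : R) : continuous f ->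
  mu.-integrable `[a, b] (EFin \o f).
Proof.
move=> cf; apply: continuous_compact_integrable; first exact: segment_compact.
exact: continuous_subspaceT.
Qed.

Lemma intD (f g : R -> R) (a b : R) : continuous f -> continuous g ->
  \int[mu]_(s in `[a, b]) (f s + g s) =
  \int[mu]_(s in `[a, b]) f s + \int[mu]_(s in `[a, b]) g s.
Proof. by move=> cf cg; rewrite RintegralD //; exact: cont_integrable. Qed.

Lemma intB (f g : R -> R) (a b : R) : continuous f -> continuous g ->
  \int[mu]_(s in `[a, b]) (f s - g s) =
  \int[mu]_(s in `[a, b]) f s - \int[mu]_(s in `[a, b]) g s.
Proof. by move=> cf cg; rewrite RintegralB //; exact: cont_integrable. Qed.

Lemma intZ (c : R) (f : R -> R) (a b : R) : continuous f ->
  \int[mu]_(s in `[a, b]) (c * f s) = c * \int[mu]_(s in `[a, b]) f s.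
Proof. by move=> cf; rewrite RintegralZl //; exact: cont_integrable. Qed.

Lemma int_le (f g : R -> R) (a b : R) : continuous f -> continuous g ->
  (forall s, a <= s <= b -> f s <= g s) ->
  \int[mu]_(s in `[a, b]) f s <= \int[mu]_(s in `[a, b]) g s.
Proof.
move=> cf cg fg; by apply: le_Rintegral => //; exact: cont_integrable.
Qed.

Lemma int_eq (f g : R -> R) (a b : R) : (forall s, a <= s <= b -> f s = g s) ->
  \int[mu]_(s in `[a, b]) f s = \int[mu]_(s in `[a, b]) g s.
Proof.
by move=> fg; apply: eq_Rintegral => s; rewrite inE /= in_itv /=; exact: fg.
Qed.

Lemma int_cst (c a b : R) : a <= b -> \int[mu]_(s in `[a, b]) c = c * (b - a).
Proof.
move=> ab; rewrite Rintegral_cst //= lebesgue_measure_itv /= lte_fin.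
case: (ltP a b) => [_|ba]; first by rewrite -EFinB.
by have -> : b = a by [apply: le_anti; rewrite ab ba]; rewrite subrr mulr0.
Qed.

Lemma int_norm_le (f : R -> R) (a b e : R) : a <= b -> continuous f ->
  (forall s, a <= s <= b -> `|f s| <= e) ->
  `|\int[mu]_(s in `[a, b]) f s| <= e * (b - a).
Proof.
move=> ab cf fe; rewrite -int_cst //.
apply: le_trans (le_normr_Rintegral _ _) _ => //; first exact: cont_integrable.
apply: int_le => //.
- by move=> s; apply: cvg_norm; exact: cf.
- by move=> s; exact: cvg_cst.
Qed.

Lemma FTC_itv (F f : R -> R) (a b : R) : a <= b -> continuous f ->
  (forall s : R, a <= s <= b -> is_derive s (1 : R) F (f s)) ->
  \int[mu]_(s in `[a, b]) f s = F b - F a.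
Proof.
move=> ab cf D; have cF s : a <= s <= b -> {for s, continuous F}.
  by move=> /D Ds; exact: is_derive_continuous Ds.
move: (ab); rewrite le_eqVlt => /predU1P[->|ab'].
  by rewrite set_itv1 Rintegral_set1 subrr.
rewrite /Rintegral (@continuous_FTC2 _ f F) //.
- exact: continuous_subspaceT.
- split.
  + by move=> x; rewrite in_itv /= => /andP[ax xb]; have [] := D x; rewrite ?(ltW ax) ?ltW.
  + by apply: cvg_at_right_filter; apply: cF; rewrite lexx.
  + by apply: cvg_at_left_filter; apply: cF; rewrite lexx andbT.
- move=> x; rewrite in_itv /= => /andP[ax xb].
  by rewrite derive1E; apply: derive_at (D x _); rewrite !ltW.
Qed.

Lemma FTC (F f : R -> R) (a b : R) : a <= b -> continuous f ->
  (forall s : R, is_derive s (1 : R) F (f s)) ->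
  \int[mu]_(s in `[a, b]) f s = F b - F a.
Proof. by move=> ab cf D; exact: FTC_itv. Qed.

(** If f c > 0, then f exceeds f c / 2 near c. That neighbourhood, clipped to [a, b], is a
    nondegenerate interval even when c is an end point, so the integral over it is already
    positive. *)
Lemma int_eq0 (f : R -> R) (a b : R) : a < b -> continuous f ->
  (forall s, a <= s <= b -> 0 <= f s) -> \int[mu]_(s in `[a, b]) f s = 0 ->
  forall s, a <= s <= b -> f s = 0.
Proof.
move=> ab cf f0 I0 c cab; apply/eqP; rewrite eq_le f0 // andbT leNgt; apply/negP => fc.
have : \forall x \near c, f c / 2 < f x.
  by apply: (cvgr_gt _ (cf c)); rewrite ltr_pdivrMr // ltr_pMr // ltr1n.
move=> /nbhs_ballP[e /= e0 He].
pose a' := Num.max a (c - e / 2); pose b' := Num.min b (c + e / 2).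
have e20 : 0 < e / 2 by rewrite divr_gt0.
have ab' : a' < b'.
  by move: cab => /andP[? ?]; rewrite /a' /b' lt_min !gt_max; apply/andP; split; apply/andP; split => //; lra.
have a'b' s : a' <= s <= b' -> a <= s <= b /\ f c / 2 <= f s.
  rewrite /a' /b' ge_max le_min => /andP[/andP[h1 h2] /andP[h3 h4]].
  split; first by rewrite h1 h3.
  apply/ltW/He; rewrite /ball /= ltr_norml; apply/andP; split; lra.
have H : \int[mu]_(s in `[a', b']) f s <= \int[mu]_(s in `[a, b]) f s.
  rewrite /Rintegral; apply: fine_le.
  - by apply: integrable_fin_num => //; exact: cont_integrable.
  - by apply: integrable_fin_num => //; exact: cont_integrable.
  apply: ge0_subset_integral => //.
  - by apply: measurable_int; exact: cont_integrable.
  - by move=> s /=; rewrite !in_itv /= => /a'b'[].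
move: H; rewrite I0 leNgt => /negP; apply.
apply: (@lt_le_trans _ _ (f c / 2 * (b' - a'))).
  by rewrite mulr_gt0 ?divr_gt0 ?subr_gt0.
rewrite -int_cst ?(ltW ab') //; apply: int_le => //; first by move=> s; exact: cvg_cst.
by move=> s /a'b'[].
Qed.

(** Compactness of [a, b] makes the continuity at the points (p, s) uniform in s. This is the source
    of every limit under an integral sign below. *)
Lemma tube (V : normedModType R) (F : V * R -> R) (a b : R) (p : V) (e : R) :
  continuous F -> 0 < e ->
  \forall q \near p, forall s, a <= s <= b -> `|F (q, s) - F (p, s)| < e.
Proof.
move=> cF e0.
have H := (compact_near_coveringP `[a, b]).1 (@segment_compact R a b) V (nbhs p)
  (fun q s => `|F (q, s) - F (p, s)| < e) _.
have : \forall q \near p, `[a, b] `<=` (fun s => `|F (q, s) - F (p, s)| < e).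
  apply: H => s _.
  have e2 : 0 < e / 2 by rewrite divr_gt0.
  have /cvgrPdist_lt/(_ _ e2) := cF (p, s).
  case=> -[A B] /= [nA nB] AB; exists (B, A) => //= -[s' q] /= [Bs' Aq].
  have h1 := AB (q, s') (conj Aq Bs').
  have h2 := AB (p, s') (conj (nbhs_singleton nA) Bs').
  rewrite /= in h1 h2.
  rewrite (_ : F (q, s') - F (p, s') = (F (p, s) - F (p, s')) - (F (p, s) - F (q, s'))); last by ring.
  by rewrite (splitr e); apply: le_lt_trans (ler_normB _ _) _; exact: ltrD.
by apply: filterS => q Hq s sab; apply: Hq; rewrite /= in_itv.
Unshelve. all: by end_near. Qed.

Lemma cont_pair (V W : normedModType R) (F : V * W -> R) (p : V) :
  continuous F -> continuous (fun s => F (p, s)).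
Proof.
move=> cF s; apply: (@continuous_comp _ _ _ (fun s => (p, s)) F); last exact: cF.
by apply: cvg_pair; [exact: cvg_cst|exact: cvg_id].
Qed.

Lemma int_cont (V : normedModType R) (F : V * R -> R) (a b : R) : a <= b ->
  continuous F -> continuous (fun p => \int[mu]_(s in `[a, b]) F (p, s)).
Proof.
move=> ab cF p; apply/cvgrPdist_le => e e0.
have ba1 : 0 < b - a + 1 by lra.
have := @tube _ F a b p (e / (b - a + 1)) cF (divr_gt0 e0 ba1).
apply: filterS => q Hq /=.
rewrite -intB; try exact: cont_pair.
apply: le_trans (int_norm_le (e := e / (b - a + 1)) ab _ _) _.
- by move=> s; apply: cvgB; exact: (@cont_pair _ _ F _ cF s).
- by move=> s /Hq/ltW; rewrite distrC.
by rewrite mulrAC ler_pdivrMr // ler_pM2l //; lra.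
Qed.

Lemma is_derive_cvg (V : normedModType R) (f : V -> R) (p v : V) (d : R) :
  h^-1 * (f (p + h *: v) - f p) @[h --> 0^'] --> d -> is_derive p v f d.
Proof.
move=> H.
have E : (fun h : R => h^-1 *: ((f \o shift p) (h *: v) - f p)) =
         (fun h : R => h^-1 * (f (p + h *: v) - f p)).
  by apply/funext => h /=; rewrite [h *: v + p]addrC.
apply: DeriveDef; rewrite ?/derivable ?/derive E; first by apply/cvg_ex; exists d.
exact: cvg_lim.
Qed.

(** By the mean value theorem the difference quotient in direction v is dF at an intermediate point
    p + c v with |c| <= |h|; [tube] bounds its distance to dF (p, s) uniformly in s. *)
Lemma int_derive (V : normedModType R) (F dF : V * R -> R) (v : V) (a b : R) : a <= b ->
  continuous F -> continuous dF ->
  (forall p s, is_derive (p, s) (v, 0) F (dF (p, s))) ->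
  forall p, is_derive p v (fun p => \int[mu]_(s in `[a, b]) F (p, s))
                          (\int[mu]_(s in `[a, b]) dF (p, s)).
Proof.
move=> ab cF cdF D p; apply: is_derive_cvg; apply/cvgrPdist_le => e e0.
have ba1 : 0 < b - a + 1 by lra.
(* Only points of the line p + t v occur, so [tube] is applied at t = 0 with a scalar parameter. *)
pose G := fun ts : R * R => dF (p + ts.1 *: v, ts.2).
have cG : continuous G.
  apply: ctcomp => //; apply: ctpair; last by apply: ctsnd; exact: ctI.
  by apply: ctD; [exact: ctC|apply: ctZ; [apply: ctfst; exact: ctI|exact: ctC]].
have := @tube _ G a b 0 (e / (b - a + 1)) cG (divr_gt0 e0 ba1).
move=> /nbhs_ballP[d /= d0 Hd].
near=> h.
have h0 : h != 0 by near: h; exact: nbhs_dnbhs_neq.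
have hd : `|h| < d.
  near: h; apply: nbhs_dnbhs; apply/nbhs_ballP; exists d => //= x.
  by rewrite /ball /= sub0r normrN.
rewrite -intB; try exact: cont_pair.
have cF1 : continuous (fun s => F (p + h *: v, s) - F (p, s)).
  by move=> s; apply: cvgB; exact: (@cont_pair _ _ F _ cF s).
rewrite -intZ // -intB; last first.
- by move=> s; apply: cvgM; [exact: cvg_cst|exact: cF1].
- exact: cont_pair.
apply: le_trans (int_norm_le (e := e / (b - a + 1)) ab _ _) _.
- move=> s; apply: cvgB; first exact: (@cont_pair _ _ dF _ cdF s).
  by apply: cvgM; [exact: cvg_cst|exact: cF1].
- move=> s sab.
  have [] := @mean_value R (fun t => F (p + t *: v, s)) (fun t => dF (p + t *: v, s)) h.
    move=> t.
    have E x : (p + x *: v, s) = (p, s) + x *: ((v, 0) : V * R).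
      by congr pair; rewrite /= scaler0 addr0.
    under eq_fun do rewrite E.
    by apply: dline; rewrite -E.
  move=> c ch; rewrite scale0r addr0 => ->.
  rewrite mulrCA mulVf // mulr1 distrC; apply/ltW.
  have := Hd c _ s sab; rewrite /G /= scale0r addr0; apply.
  by rewrite /ball /= sub0r normrN (le_lt_trans ch).
by rewrite mulrAC ler_pdivrMr // ler_pM2l //; lra.
Unshelve. all: by end_near. Qed.

End Integrals.

(** * Regularity classes *)

Section CkTheory.
Context {R : realType}.
Local Notation mu := (@lebesgue_measure R).

Section Closure.
Context {V : normedModType R} (A : set V).

Lemma Ck_continuous k (f : V -> R) : Ck A k f -> continuous f.
Proof. by case: k => [|k] []. Qed.

Lemma Ck_is_derive k (f : V -> R) v x : Ck A k.+1 f -> A v ->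
  is_derive x v f ('D_v f x).
Proof. by move=> [_ H] /H[D _]; exact/derivableP. Qed.

Lemma Ck_derive k (f : V -> R) v : Ck A k.+1 f -> A v -> Ck A k ('D_v f).
Proof. by move=> [_ H] /H[_]. Qed.

Lemma CkS k (f : V -> R) : continuous f ->
  (forall v, A v -> exists2 df, (forall x, is_derive x v f (df x)) & Ck A k df) ->
  Ck A k.+1 f.
Proof.
move=> cf H; split=> // v /H[df D Cdf]; split; first by move=> x; have [] := D x.
by have -> : 'D_v f = df by apply/funext => x; exact: derive_at.
Qed.

Lemma Ck_pred k (f : V -> R) : Ck A k.+1 f -> Ck A k f.
Proof.
elim: k f => [|k IHk] f Cf; first by split=> //; exact: Ck_continuous Cf.
apply: CkS => [|v Av]; first exact: Ck_continuous Cf.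
exists ('D_v f); first by move=> x; exact: Ck_is_derive Cf Av.
by apply: IHk; exact: Ck_derive Cf Av.
Qed.

Lemma Ck_cst k (c : R) : Ck A k (fun=> c).
Proof.
elim: k c => [|k IHk] c; first by split=> //; exact: ctC.
apply: CkS => [|v Av]; first exact: ctC.
by exists (fun=> 0) => // x; exact: dcst.
Qed.

Lemma CkD k (f g : V -> R) : Ck A k f -> Ck A k g -> Ck A k (fun x => f x + g x).
Proof.
elim: k f g => [|k IHk] f g Cf Cg.
  by split=> //; apply: ctD; [exact: Ck_continuous Cf|exact: Ck_continuous Cg].
apply: CkS => [|v Av].
  by apply: ctD; [exact: Ck_continuous Cf|exact: Ck_continuous Cg].
exists (fun x => 'D_v f x + 'D_v g x).
  by move=> x; apply: dadd; [exact: Ck_is_derive Cf Av|exact: Ck_is_derive Cg Av].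
by apply: IHk; [exact: Ck_derive Cf Av|exact: Ck_derive Cg Av].
Qed.

Lemma CkM k (f g : V -> R) : Ck A k f -> Ck A k g -> Ck A k (fun x => f x * g x).
Proof.
elim: k f g => [|k IHk] f g Cf Cg.
  by split=> //; apply: ctM; [exact: Ck_continuous Cf|exact: Ck_continuous Cg].
apply: CkS => [|v Av].
  by apply: ctM; [exact: Ck_continuous Cf|exact: Ck_continuous Cg].
exists (fun x => 'D_v f x * g x + f x * 'D_v g x).
  by move=> x; apply: dmul; [exact: Ck_is_derive Cf Av|exact: Ck_is_derive Cg Av].
apply: CkD; apply: IHk; by [exact: Ck_derive Cf Av|exact: Ck_derive Cg Av|exact: Ck_pred].
Qed.

Lemma CkZ k (c : R) (f : V -> R) : Ck A k f -> Ck A k (fun x => c * f x).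
Proof. by apply: CkM; exact: Ck_cst. Qed.

Lemma CkN k (f : V -> R) : Ck A k f -> Ck A k (fun x => - f x).
Proof.
have -> : (fun x => - f x) = (fun x => -1 * f x) by apply/funext => x; rewrite mulN1r.
exact: CkZ.
Qed.

Lemma CkB k (f g : V -> R) : Ck A k f -> Ck A k g -> Ck A k (fun x => f x - g x).
Proof. by move=> Cf Cg; apply: CkD => //; exact: CkN. Qed.

Lemma CkX k n (f : V -> R) : Ck A k f -> Ck A k (fun x => f x ^+ n).
Proof.
move=> Cf; elim: n => [|n IHn]; first exact: Ck_cst.
by under eq_fun do rewrite exprS; exact: CkM.
Qed.

Lemma Ck_sum k (I : Type) (r : seq I) (f : I -> V -> R) :
  (forall i, Ck A k (f i)) -> Ck A k (fun x => \sum_(i <- r) f i x).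
Proof.
move=> Cf; elim: r => [|i r IHr].
  by under eq_fun do rewrite big_nil; exact: Ck_cst.
by under eq_fun do rewrite big_cons; apply: CkD.
Qed.

(** With c = 0 this covers functions that are constant along all the axes: mere continuity in the
    remaining directions is then enough. *)
Lemma Ck_linear k (f : V -> R) (c : V -> R) : continuous f ->
  (forall v, A v -> forall x (h : R), f (x + h *: v) = f x + h * c v) -> Ck A k f.
Proof.
move=> cf H; case: k => [|k]; first by split.
apply: CkS => // v Av; exists (fun=> c v); last exact: Ck_cst.
move=> x; apply: dlineP; under eq_fun do rewrite H //.
have D : is_derive (0 : R) (1 : R) (fun h : R => f x + h * c v) (0 + (1 * c v + 0 * 0)).
  exact: (dadd (dcst _ _ _) (dmul (is_derive_id _ _) (dcst _ _ _))).
by move: D; rewrite mul0r addr0 mul1r add0r.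
Qed.

End Closure.

(** Regularity is asked on I only, with derivatives given by witnesses: the kernel profiles come
    from power series that are controlled only for arguments in [profile_dom]. *)
Fixpoint Cr (I : set R) (k : nat) (h : R -> R) : Prop :=
  (forall x, I x -> {for x, continuous h}) /\
  if k is j.+1 then
    exists2 h', (forall x : R, I x -> is_derive x (1 : R) h (h' x)) & Cr I j h'
  else True.

Lemma Cr_continuous I k h : Cr I k h -> forall x, I x -> {for x, continuous h}.
Proof. by case: k => [|k] []. Qed.

Lemma CrD I k f g : Cr I k f -> Cr I k g -> Cr I k (fun x => f x + g x).
Proof.
elim: k f g => [|k IHk] f g Cf Cg.
  by split=> // x Ix; apply: cvgD; [exact: Cr_continuous Cf _ Ix|exact: Cr_continuous Cg _ Ix].
split; first by move=> x Ix; apply: cvgD; [exact: Cr_continuous Cf _ Ix|exact: Cr_continuous Cg _ Ix].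
case: Cf => _ [f' Df Cf']; case: Cg => _ [g' Dg Cg'].
exists (fun x => f' x + g' x); last exact: IHk.
by move=> x Ix; apply: dadd; [exact: Df|exact: Dg].
Qed.

Lemma Ck_compr {V : normedModType R} (A : set V) (I : set R) k (h : R -> R) (f : V -> R) :
  (forall x, I (f x)) -> Cr I k h -> Ck A k f -> Ck A k (fun x => h (f x)).
Proof.
move=> If; elim: k h => [|k IHk] h Ch Cf.
  split=> // x; apply: continuous_comp; first exact: Ck_continuous Cf x.
  exact: Cr_continuous Ch _ (If x).
have [ch [h' Dh Ch']] := Ch.
apply: CkS.
  move=> x; apply: continuous_comp; first exact: Ck_continuous Cf x.
  exact: Cr_continuous Ch _ (If x).
move=> v Av; exists (fun x => h' (f x) * 'D_v f x).
  by move=> x; apply: dcomp1; [exact: Dh|exact: Ck_is_derive Cf Av].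
by apply: CkM; [apply: IHk => //; exact: Ck_pred|exact: Ck_derive Cf Av].
Qed.

Lemma Cr_expR I k : Cr I k expR.
Proof.
elim: k => [|k IHk]; split=> //; try by move=> x _; exact: continuous_expR.
by exists expR => // x _; exact: is_derive_expR.
Qed.

Lemma Ck_affine {V W : normedModType R} (A : set V) (B : set W) k (F : V -> R) (L : W -> V) :
  continuous L ->
  (forall b, B b -> exists2 v, A v & forall z (h : R), L (z + h *: b) = L z + h *: v) ->
  Ck A k F -> Ck B k (fun z => F (L z)).
Proof.
move=> cL HL; elim: k F => [|k IHk] F CF.
  by split=> //; apply: ctcomp cL; exact: Ck_continuous CF.
apply: CkS; first by apply: ctcomp cL; exact: Ck_continuous CF.
move=> b /HL[v Av Lv]; exists (fun z => 'D_v F (L z)).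
  move=> z; apply: dlineP; under eq_fun do rewrite Lv.
  by apply: dline; rewrite scale0r addr0; exact: Ck_is_derive CF Av.
by apply: (IHk ('D_v F)); exact: Ck_derive CF Av.
Qed.

(** Differentiation under an integral sign moves the parameter in V alone; with these axes the
    integration variable in W enters only through continuity. *)
Definition paxes {V : normedModType R} (W : normedModType R) (A : set V) : set (V * W) :=
  (fun v => (v, 0)) @` A.
Arguments paxes {V} W A.

Lemma Ck_int {V : normedModType R} (A : set V) k (F : V * R -> R) (a b : R) : a <= b ->
  Ck (paxes R A) k F -> Ck A k (fun p => \int[mu]_(s in `[a, b]) F (p, s)).
Proof.
move=> ab; elim: k F => [|k IHk] F CF.
  by split=> //; apply: int_cont => //; exact: Ck_continuous CF.
apply: CkS; first by apply: int_cont => //; exact: Ck_continuous CF.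
move=> v Av; have Bv : paxes R A (v, 0) by exists v.
exists (fun p => \int[mu]_(s in `[a, b]) 'D_(v, 0) F (p, s)).
  move=> p; apply: (@int_derive _ _ F ('D_(v, 0) F)) => //.
  - exact: Ck_continuous CF.
  - exact: Ck_continuous (Ck_derive CF Bv).
  - by move=> q s; exact: Ck_is_derive CF Bv.
by apply: (IHk ('D_(v, 0) F)); exact: Ck_derive CF Bv.
Qed.

(** Made for V (x, phi(t) s): a space axis moves x along a line and fixes the radius, the time axis
    fixes x and moves the radius, which gives a product with the derivative of [rho]. *)
Lemma Ck_reparam {X W : normedModType R} (A : set (X * R)) (B : set W) k
    (F : X * R -> R) (L : W -> X) (rho : W -> R) :
  continuous L -> Ck B k rho ->
  (forall b, B b ->
     (exists2 v, A (v, 0) &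
        forall z (h : R), L (z + h *: b) = L z + h *: v /\ rho (z + h *: b) = rho z)
     \/ (A (0, 1) /\ forall z (h : R), L (z + h *: b) = L z)) ->
  Ck A k F -> Ck B k (fun z => F (L z, rho z)).
Proof.
move=> cL; elim: k F => [|k IHk] F Crho HL CF.
  split=> //; apply: ctcomp; first exact: Ck_continuous CF.
  by apply: ctpair => //; exact: Ck_continuous Crho.
apply: CkS.
  apply: ctcomp; first exact: Ck_continuous CF.
  by apply: ctpair => //; exact: Ck_continuous Crho.
move=> b Bb; have [[v Av Lv]|[A1 Lb]] := HL b Bb.
  exists (fun z => 'D_(v, 0) F (L z, rho z)).
    move=> z; apply: dlineP.
    have E (h : R) : (L (z + h *: b), rho (z + h *: b)) = (L z, rho z) + h *: (v, 0).
      by have [-> ->] := Lv z h; congr pair; rewrite /= scaler0 addr0.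
    under eq_fun do rewrite E.
    by apply: dline; rewrite scale0r addr0; exact: Ck_is_derive CF Av.
  by apply: (IHk ('D_(v, 0) F)) => //; [exact: Ck_pred|exact: Ck_derive CF Av].
exists (fun z => 'D_(0, 1) F (L z, rho z) * 'D_b rho z).
  move=> z; apply: dlineP; under eq_fun do rewrite Lb.
  have D1 : is_derive (rho (z + 0 *: b)) (1 : R) (fun r => F (L z, r)) ('D_(0, 1) F (L z, rho z)).
    rewrite scale0r addr0.
    have E (r : R) : (L z, r) = (L z, 0) + r *: ((0, 1) : X * R).
      by congr pair; rewrite /= ?scaler0 ?addr0 // add0r scaleR1.
    under eq_fun do rewrite E.
    by apply: dline; rewrite -E; exact: Ck_is_derive CF A1.
  apply: (dcomp1 D1); apply: dline; rewrite scale0r addr0.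
  exact: Ck_is_derive Crho Bb.
by apply: CkM; [apply: (IHk ('D_(0, 1) F)) => //; [exact: Ck_pred|exact: Ck_derive CF A1]|exact: Ck_derive Crho Bb].
Qed.

End CkTheory.
Arguments paxes {R V} W A.

(** * Chain rule in several variables and symmetry of second derivatives *)

Section Chain.
Context {R : realType}.
Local Notation mu := (@lebesgue_measure R).

Lemma cvg_sumV (T : Type) (H : set_system T) (V : normedModType R) (I : Type) (r : seq I)
    (f : I -> T -> V) (l : I -> V) : Filter H ->
  (forall i, f i x @[x --> H] --> l i) ->
  \sum_(i <- r) f i x @[x --> H] --> \sum_(i <- r) l i.
Proof.
move=> FH cf; elim: r => [|i r IHr].
  by under eq_fun do rewrite big_nil; rewrite big_nil; exact: cvg_cst.
by under eq_fun do rewrite big_cons; rewrite big_cons; apply: cvgD.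
Qed.

Lemma cvg_is_derive (V : normedModType R) (f : V -> R) (p v : V) (d : R) :
  is_derive p v f d -> h^-1 * (f (p + h *: v) - f p) @[h --> 0^'] --> d.
Proof.
have E : (fun h : R => h^-1 *: ((f \o shift p) (h *: v) - f p)) =
         (fun h : R => h^-1 * (f (p + h *: v) - f p)).
  by apply/funext => h /=; rewrite [h *: v + p]addrC.
by move=> [Df <-]; rewrite /derive; move: Df; rewrite /derivable E.
Qed.

(* Otherwise unification unfolds directional derivatives into limits. *)
Local Opaque derive.

Lemma ctsumV (T : topologicalType) (V : normedModType R) (I : Type) (r : seq I) (f : I -> T -> V) :
  (forall i, continuous (f i)) -> continuous (fun x => \sum_(i <- r) f i x).
Proof.
move=> cf; elim: r => [|i r IHr].
  by under eq_fun do rewrite big_nil; exact: ctC.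
by under eq_fun do rewrite big_cons; apply: ctD.
Qed.

Lemma ct_rV (T : topologicalType) N (G : T -> 'rV[R]_N) :
  (forall i, continuous (fun x => G x 0 i)) -> continuous G.
Proof.
move=> cG.
have -> : G = (fun x => \sum_(j < N) G x 0 j *: delta_mx 0 j).
  by apply/funext => x; rewrite -row_sum_delta.
by apply: ctsumV => i; apply: ctZ => //; exact: ctC.
Qed.

Lemma ct_coord (T : topologicalType) N (G : T -> 'rV[R]_N) i :
  continuous G -> continuous (fun x => G x 0 i).
Proof.
move=> cG; apply: (@ctcomp _ _ _ (fun y : 'rV[R]_N => y 0 i)) => //.
exact: coord_continuous.
Qed.

(** The coordinates are changed from those of x to those of y one at a time; [z m] has its first m
    coordinates from y. Each change is a mean value theorem on a line, and the sum telescopes. *)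
Lemma mean_value_rV N (F : 'rV[R]_N -> R) (DF : 'I_N -> 'rV[R]_N -> R) (x y : 'rV[R]_N) :
  (forall i z, is_derive z (basis_vec i) F (DF i z)) ->
  exists xi : 'I_N -> 'rV[R]_N,
    (forall i j, `|xi i 0 j - x 0 j| <= `|y 0 j - x 0 j|) /\
    F y - F x = \sum_(i < N) (y 0 i - x 0 i) * DF i (xi i).
Proof.
move=> D.
pose z m : 'rV[R]_N := \row_j (if (j < m)%N then y 0 j else x 0 j).
have H (i : 'I_N) : exists c : R, `|c| <= `|y 0 i - x 0 i| /\
    F (z i.+1) - F (z i) = (y 0 i - x 0 i) * DF i (z i + c *: basis_vec i).
  have [] := @mean_value R (fun t => F (z i + t *: basis_vec i))
    (fun t => DF i (z i + t *: basis_vec i)) (y 0 i - x 0 i).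
    by move=> t; apply: dline; exact: D.
  move=> c ch; rewrite scale0r addr0 mulrC => E; exists c; split=> //.
  rewrite -E; congr (F _ - _); apply/rowP => j; rewrite !mxE /= ltnS ?eqxx /=.
  case: (ltngtP j i) => [ji|ij|/val_inj ->].
  - by rewrite (_ : j == i = false) ?mulr0 ?addr0 //; apply/negbTE; rewrite -val_eqE neq_ltn ji.
  - by rewrite (_ : j == i = false) ?mulr0 ?addr0 //; apply/negbTE; rewrite -val_eqE neq_ltn ij orbT.
  - by rewrite eqxx mulr1 addrC subrK.
have [c Hc] := choice H.
exists (fun i : 'I_N => z i + c i *: basis_vec i); split.
  move=> i j; have [ci _] := Hc i; rewrite !mxE ?eqxx /=.
  case: (ltngtP j i) => [ji|ij|/val_inj ->].
  - by rewrite (_ : j == i = false) ?mulr0 ?addr0 //; apply/negbTE; rewrite -val_eqE neq_ltn ji.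
  - by rewrite (_ : j == i = false) ?mulr0 ?addr0 ?subrr ?normr0 //; apply/negbTE; rewrite -val_eqE neq_ltn ij orbT.
  - by rewrite eqxx mulr1 addrAC subrr add0r.
have -> : F y = F (z N) by congr F; apply/rowP => j; rewrite mxE ltn_ord.
have -> : F x = F (z 0%N) by congr F; apply/rowP => j; rewrite mxE.
rewrite -(telescope_sumr (fun m => F (z m))) // big_mkord.
by apply: eq_bigr => i _; have [_] := Hc i.
Qed.

(** The increment of F is a combination of partial derivatives at points [xi] squeezed between G x
    and G (x + h v); these tend to G x, so continuity of the partial derivatives replaces a total
    differential. *)
Lemma dchain N (F : 'rV[R]_N -> R) (DF : 'I_N -> 'rV[R]_N -> R)
    (V : normedModType R) (G : V -> 'rV[R]_N) (x v : V) (dG : 'I_N -> R) :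
  (forall i z, is_derive z (basis_vec i) F (DF i z)) ->
  (forall i, continuous (DF i)) ->
  (forall i, is_derive x v (fun y => G y 0 i) (dG i)) ->
  is_derive x v (fun y => F (G y)) (\sum_(i < N) dG i * DF i (G x)).
Proof.
move=> D cD DG; apply: is_derive_cvg.
have [xi Hxi] := choice (fun h : R => mean_value_rV (G x) (G (x + h *: v)) D).
have E : (fun h : R => h^-1 * (F (G (x + h *: v)) - F (G x))) =
   (fun h => \sum_(i < N) h^-1 * (G (x + h *: v) 0 i - G x 0 i) * DF i (xi h i)).
  apply/funext => h; have [_ ->] := Hxi h; rewrite mulr_sumr.
  by apply: eq_bigr => i _; rewrite mulrA.
rewrite E.
have DGt i : is_derive (0 : R) (1 : R) (fun t : R => G (x + t *: v) 0 i) (dG i).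
  by apply: (@dline _ _ (fun y => G y 0 i)); rewrite scale0r addr0; exact: DG.
have cGt i : (fun t : R => G (x + t *: v) 0 i) t @[t --> 0^'] --> G x 0 i.
  have H := is_derive_continuous (DGt i).
  have E0 : G x 0 i = G (x + 0 *: v) 0 i by rewrite scale0r addr0.
  by rewrite E0; apply: cvg_within_filter; exact: H.
have cxi i j : xi h i 0 j @[h --> 0^'] --> G x 0 j.
  apply/cvgrPdist_le => e e0.
  have /cvgrPdist_le/(_ _ e0) := cGt j.
  apply: filterS => h; have [Hh _] := Hxi h.
  by move=> Hd; rewrite distrC; apply: le_trans (Hh i j) _; rewrite distrC.
apply: cvg_sumV => i; apply: cvgM.
  exact: (@cvg_is_derive _ (fun y => G y 0 i)).
have cG : (fun h => xi h i) h @[h --> 0^'] --> G x.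
  have -> : (fun h => xi h i) = (fun h => \sum_(j < N) xi h i 0 j *: delta_mx 0 j).
    by apply/funext => h; exact: row_sum_delta.
  rewrite [X in _ --> X]row_sum_delta.
  by apply: cvg_sumV => j; apply: cvgZ => //; exact: cvg_cst.
by apply: (@cvg_comp _ _ _ (fun h => xi h i) (DF i)); [exact: cG|exact: cD].
Qed.

Lemma Ck_compN {V : normedModType R} (A : set V) k N (F : 'rV[R]_N -> R) (G : V -> 'rV[R]_N) :
  Ck (range (@basis_vec R N)) k F -> (forall i, Ck A k (fun x => G x 0 i)) ->
  Ck A k (fun x => F (G x)).
Proof.
elim: k F => [|k IHk] F CF CG.
  split=> //; apply: ctcomp; first exact: Ck_continuous CF.
  by apply: ct_rV => i; exact: Ck_continuous (CG i).
apply: CkS.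
  apply: ctcomp; first exact: Ck_continuous CF.
  by apply: ct_rV => i; exact: Ck_continuous (CG i).
move=> v Av.
have B i : range (@basis_vec R N) (basis_vec i) by exists i.
exists (fun x => \sum_(i < N) 'D_v (fun x => G x 0 i) x * 'D_(basis_vec i) F (G x)).
  move=> x; apply: (dchain (DF := fun i => 'D_(basis_vec i) F)).
  - by move=> i z; exact: Ck_is_derive CF (B i).
  - by move=> i; exact: Ck_continuous (Ck_derive CF (B i)).
  - by move=> i; exact: Ck_is_derive (CG i) Av.
apply: Ck_sum => i; apply: CkM; first exact: Ck_derive (CG i) Av.
apply: (IHk ('D_(basis_vec i) F)); first exact: Ck_derive CF (B i).
by move=> j; exact: Ck_pred.
Qed.

(** Write f (p + a u) - f p as an integral of D_u f and differentiate along v under the integral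
    sign. The result is also the integral of D_u D_v f, so the continuous difference h of the mixed
    derivatives has integral 0 over every [0, a]; hence h 0 = 0. *)
Lemma schwarz {V : normedModType R} (A : set V) (f : V -> R) (u v : V) :
  A u -> A v -> Ck A 2 f -> 'D_u ('D_v f) = 'D_v ('D_u f).
Proof.
move=> Au Av Cf.
have cu := Ck_derive Cf Au; have cv := Ck_derive Cf Av.
apply/funext => x.
pose h (s : R) := 'D_u ('D_v f) (x + s *: u) - 'D_v ('D_u f) (x + s *: u).
have cl : continuous (fun s : R => x + s *: u).
  by apply: ctD; [exact: ctC|apply: ctZ; [exact: ctI|exact: ctC]].
have c1 : continuous (fun s : R => 'D_u ('D_v f) (x + s *: u)).
  exact: ctcomp (Ck_continuous (Ck_derive cv Au)) cl.
have c2 : continuous (fun s : R => 'D_v ('D_u f) (x + s *: u)).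
  exact: ctcomp (Ck_continuous (Ck_derive cu Av)) cl.
have ch : continuous h by exact: ctD c1 (ctN c2).
have I0 (a : R) : 0 <= a -> \int[mu]_(s in `[0, a]) h s = 0.
  move=> a0; rewrite /h intB; [|exact: c1|exact: c2]; apply/eqP; rewrite subr_eq0; apply/eqP.
  have D0 (s : R) : is_derive s (1 : R) (fun s => 'D_v f (x + s *: u)) ('D_u ('D_v f) (x + s *: u)).
    exact: (@dline _ _ ('D_v f) x u s _ (Ck_is_derive _ cv Au)).
  rewrite [LHS](FTC a0 c1 D0).
  have E (p : V) : f (p + a *: u) - f p = \int[mu]_(s in `[0, a]) 'D_u f (p + s *: u).
    have D2 (s : R) : is_derive s (1 : R) (fun s => f (p + s *: u)) ('D_u f (p + s *: u)).
      exact: (@dline _ _ f p u s _ (Ck_is_derive _ Cf Au)).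
    rewrite (FTC a0 _ D2) ?scale0r ?addr0 //.
    apply: ctcomp (Ck_continuous cu) _.
    by apply: ctD; [exact: ctC|apply: ctZ; [exact: ctI|exact: ctC]].
  have Ds : continuous (fun q : V * R => q.1 + q.2 *: u).
    by apply: ctD; [apply: ctfst|apply: ctZ; [apply: ctsnd|exact: ctC]]; exact: ctI.
  have D1 : is_derive x v (fun p => \int[mu]_(s in `[0, a]) 'D_u f (p + s *: u))
      (\int[mu]_(s in `[0, a]) 'D_v ('D_u f) (x + s *: u)).
    refine (@int_derive _ _ (fun q : V * R => 'D_u f (q.1 + q.2 *: u))
      (fun q : V * R => 'D_v ('D_u f) (q.1 + q.2 *: u)) _ 0 a a0 _ _ _ x).
    - exact: ctcomp (Ck_continuous cu) Ds.
    - exact: ctcomp (Ck_continuous (Ck_derive cu Av)) Ds.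
    - move=> p s; apply: dlineP => /=.
      under eq_fun do rewrite scaler0 addr0 addrAC.
      by apply: (@dline _ _ ('D_u f)); rewrite scale0r addr0; exact: Ck_is_derive cu Av.
  rewrite -(derive_at D1); apply/esym/derive_at.
  under eq_fun do rewrite -E.
  rewrite scale0r addr0; apply: dsub; last exact: Ck_is_derive Cf Av.
  apply: dlineP; under eq_fun do rewrite addrAC.
  by apply: dline; rewrite scale0r addr0; exact: Ck_is_derive Cf Av.
suff : h 0 = 0 by rewrite /h scale0r addr0 => /eqP; rewrite subr_eq0 => /eqP.
clearbody h.
apply/eqP; rewrite -normr_le0; apply/ler_addgt0Pr => e e0; rewrite add0r.
have /cvgrPdist_le/(_ _ e0) /nbhs_ballP[d /= d0 Hd] := ch 0.
have d20 : 0 < d / 2 by rewrite divr_gt0.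
rewrite -(ler_pM2r d20) -[X in `|h 0| * X](ger0_norm (ltW d20)) -normrM.
have -> : h 0 * (d / 2) = \int[mu]_(s in `[0, d / 2]) (h 0 - h s).
  have d2 := ltW d20.
  rewrite (@intB _ (fun=> h 0) h); [|exact: ctC|exact: ch].
  by rewrite (I0 _ d2) (int_cst _ d2) !subr0.
rewrite -[X in e * X]subr0; apply: int_norm_le; first exact: ltW.
  exact: (@ctD _ _ R (fun=> h 0) _ (@ctC _ _ (h 0)) (ctN ch)).
move=> s /andP[s0 sd]; apply: Hd; rewrite /ball /= sub0r normrN ger0_norm //.
by apply: le_lt_trans sd _; lra.
Qed.

End Chain.

(** * Iterated integrals over cubes *)

Section Box.
Context {R : realType}.
Local Notation mu := (@lebesgue_measure R).

(** The cast keeps this convertible to the [row_mx] inside [sphere_int] and [volume_int]. *)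
Definition consv n (a : R) (y : 'rV[R]_n) : 'rV[R]_n.+1 := (row_mx a%:M y : 'rV_(1 + n)).

Lemma consv0 n a (y : 'rV[R]_n) : consv a y 0 ord0 = a.
Proof.
have E := row_mxEl (a%:M : 'rV_1) y 0 ord0; rewrite [RHS]mxE eqxx in E.
rewrite -[RHS]E /consv; apply: (f_equal (fun k : 'I_(1 + n) => row_mx a%:M y 0 k)).
exact: val_inj.
Qed.

Lemma consvS n a (y : 'rV[R]_n) i : consv a y 0 (lift ord0 i) = y 0 i.
Proof.
rewrite -(row_mxEr (a%:M : 'rV_1) y 0 i) /consv.
apply: (f_equal (fun k : 'I_(1 + n) => row_mx a%:M y 0 k)).
exact: val_inj.
Qed.

Lemma consv_add n a b (y z : 'rV[R]_n) (h : R) :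
  consv (a + h * b) (y + h *: z) = consv a y + h *: consv b z.
Proof.
apply/rowP => j; case: (unliftP ord0 j) => [i ->|->].
  by rewrite consvS [RHS]mxE consvS [X in _ = _ + X]mxE consvS !mxE.
by rewrite consv0 [RHS]mxE consv0 [X in _ = _ + X]mxE consv0.
Qed.

Lemma basis_vec0 n : basis_vec (ord0 : 'I_n.+1) = consv 1 0 :> 'rV[R]_n.+1.
Proof.
apply/rowP => j; case: (unliftP ord0 j) => [i ->|->].
  by rewrite consvS !mxE.
by rewrite consv0 !mxE.
Qed.

Lemma basis_vecS n (i : 'I_n) : basis_vec (lift ord0 i) = consv 0 (basis_vec i) :> 'rV[R]_n.+1.
Proof.
apply/rowP => j; case: (unliftP ord0 j) => [l ->|->].
  by rewrite consvS !mxE (inj_eq lift_inj).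
by rewrite consv0 !mxE.
Qed.

Lemma ct_consv (T : topologicalType) n (f : T -> R) (g : T -> 'rV[R]_n) :
  continuous f -> continuous g -> continuous (fun x => consv (f x) (g x)).
Proof.
move=> cf cg; apply: ct_rV => j; case: (unliftP ord0 j) => [i ->|->].
  by under eq_fun do rewrite consvS; exact: ct_coord.
by under eq_fun do rewrite consv0.
Qed.

Lemma is_derive_consv0 n (f : 'rV[R]_n.+1 -> R) a y d :
  is_derive (consv a y) (basis_vec ord0) f d ->
  is_derive a (1 : R) (fun a => f (consv a y)) d.
Proof.
move=> D; apply: dlineP.
have E (t : R) : consv (a + t *: (1 : R)) y = consv a y + t *: basis_vec ord0.
  by rewrite basis_vec0 -consv_add scaler0 addr0.
under eq_fun do rewrite E.
by apply: dline; rewrite scale0r addr0.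
Qed.

Lemma is_derive_consvS n (f : 'rV[R]_n.+1 -> R) a y i d :
  is_derive (consv a y) (basis_vec (lift ord0 i)) f d ->
  is_derive y (basis_vec i) (fun y => f (consv a y)) d.
Proof.
move=> D; apply: dlineP.
have E (t : R) : consv a (y + t *: basis_vec i) = consv a y + t *: basis_vec (lift ord0 i).
  by rewrite basis_vecS -consv_add mulr0 addr0.
under eq_fun do rewrite E.
by apply: dline; rewrite scale0r addr0.
Qed.

(** On a fixed cube the limits of integration do not depend on time, and integration by parts is
    one-dimensional. *)
Fixpoint box_int (L : R) n : ('rV[R]_n -> R) -> R :=
  match n with
  | 0 => fun f => f 0
  | j.+1 => fun f =>
      \int[mu]_(a in `[- L, L]) box_int L (fun y : 'rV[R]_j => f (consv a y))
  end.

Section BoxTheory.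
Variables (L : R) (L0 : 0 < L).
Let L0' : - L <= L. Proof. by rewrite ge0_cp // ltW. Qed.

(** V must be arbitrary in the induction: each integration variable becomes one more parameter of
    the inner integral. The same device serves for derivatives and for spheres. *)
Lemma box_cont n (V : normedModType R) (F : V * 'rV[R]_n -> R) :
  continuous F -> continuous (fun p => box_int L (fun y => F (p, y))).
Proof.
elim: n V F => [|n IHn] V F cF /=.
  by apply: ctcomp cF _; apply: ctpair; [exact: ctI|exact: ctC].
apply: (@int_cont _ _ (fun pa : V * R => box_int L (fun y => F (pa.1, consv pa.2 y)))) => //.
apply: (IHn (V * R)%type (fun q : V * R * 'rV_n => F (q.1.1, consv q.1.2 q.2))).
apply: ctcomp cF _; apply: ctpair; first by apply: ctfst; apply: ctfst; exact: ctI.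
by apply: ct_consv; [apply: ctsnd; apply: ctfst|apply: ctsnd]; exact: ctI.
Qed.

Lemma box_slice_cont n (f : 'rV[R]_n.+1 -> R) :
  continuous f -> continuous (fun a : R => box_int L (fun y => f (consv a y))).
Proof.
move=> cf; apply: (@box_cont _ _ (fun q : R * 'rV[R]_n => f (consv q.1 q.2))).
by apply: ctcomp cf _; apply: ct_consv; [apply: ctfst|apply: ctsnd]; exact: ctI.
Qed.

Lemma ct_slice n (f : 'rV[R]_n.+1 -> R) a :
  continuous f -> continuous (fun y => f (consv a y)).
Proof.
by move=> cf; apply: ctcomp cf _; apply: ct_consv; [exact: ctC|exact: ctI].
Qed.

Lemma box_derive n (V : normedModType R) (F dF : V * 'rV[R]_n -> R) (v : V) :
  continuous F -> continuous dF ->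
  (forall p y, is_derive (p, y) (v, 0) F (dF (p, y))) ->
  forall p, is_derive p v (fun p => box_int L (fun y => F (p, y)))
                          (box_int L (fun y => dF (p, y))).
Proof.
elim: n V F dF v => [|n IHn] V F dF v cF cdF D p /=.
  apply: dlineP.
  have E (t : R) : (p + t *: v, 0) = (p, 0) + t *: ((v, 0) : V * 'rV[R]_0).
    by congr pair; rewrite /= scaler0 addr0.
  under eq_fun do rewrite E.
  by apply: dline; rewrite scale0r addr0; exact: D.
have cc (G : V * 'rV[R]_n.+1 -> R) : continuous G ->
    continuous (fun q : V * R * 'rV_n => G (q.1.1, consv q.1.2 q.2)).
  move=> cG; apply: ctcomp cG _; apply: ctpair; first by apply: ctfst; apply: ctfst; exact: ctI.
  by apply: ct_consv; [apply: ctsnd; apply: ctfst|apply: ctsnd]; exact: ctI.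
apply: (@int_derive _ _ (fun pa : V * R => box_int L (fun y => F (pa.1, consv pa.2 y)))
  (fun pa : V * R => box_int L (fun y => dF (pa.1, consv pa.2 y)))) => //.
- exact: (@box_cont _ _ (fun q : V * R * 'rV_n => F (q.1.1, consv q.1.2 q.2)) (cc _ cF)).
- exact: (@box_cont _ _ (fun q : V * R * 'rV_n => dF (q.1.1, consv q.1.2 q.2)) (cc _ cdF)).
move=> q s.
apply: (IHn (V * R)%type (fun q : V * R * 'rV_n => F (q.1.1, consv q.1.2 q.2))
   (fun q : V * R * 'rV_n => dF (q.1.1, consv q.1.2 q.2)) (v, 0) (cc _ cF) (cc _ cdF)).
move=> [q1 q2] y /=; apply: dlineP => /=.
have E (t : R) : (q1 + t *: v, consv (q2 + t *: 0) (y + t *: 0))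
    = (q1, consv q2 y) + t *: ((v, 0) : V * 'rV[R]_n.+1).
  by rewrite !scaler0 !addr0; congr pair; rewrite /= scaler0 addr0.
under eq_fun do rewrite E.
by apply: dline; rewrite scale0r addr0; exact: D.
Qed.

Lemma box_eq n (f g : 'rV[R]_n -> R) : f =1 g -> box_int L f = box_int L g.
Proof. by move=> /funext ->. Qed.

Lemma boxD n (f g : 'rV[R]_n -> R) : continuous f -> continuous g ->
  box_int L (fun y => f y + g y) = box_int L f + box_int L g.
Proof.
elim: n f g => [//|n IHn] f g cf cg /=.
rewrite -intD; try exact: box_slice_cont.
by apply: int_eq => a _; rewrite IHn //; exact: ct_slice.
Qed.

Lemma boxZ n c (f : 'rV[R]_n -> R) : continuous f ->
  box_int L (fun y => c * f y) = c * box_int L f.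
Proof.
elim: n f => [//|n IHn] f cf /=.
rewrite -intZ; last exact: box_slice_cont.
by apply: int_eq => a _; rewrite IHn //; exact: ct_slice.
Qed.

Lemma box_sum n m (f : 'I_m -> 'rV[R]_n -> R) : (forall i, continuous (f i)) ->
  box_int L (fun y => \sum_(i < m) f i y) = \sum_(i < m) box_int L (f i).
Proof.
elim: m f => [|m IHm] f cf.
  under box_eq do rewrite big_ord0.
  rewrite big_ord0 -[RHS](mul0r (box_int L (fun _ : 'rV[R]_n => 0))) -boxZ; last exact: ctC.
  by apply: box_eq => y; rewrite mul0r.
under box_eq do rewrite big_ord_recr /=.
rewrite big_ord_recr /= -IHm // -boxD //.
by apply: ctsum => i; exact: cf.
Qed.

Lemma box_le n (f g : 'rV[R]_n -> R) : continuous f -> continuous g ->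
  (forall y, f y <= g y) -> box_int L f <= box_int L g.
Proof.
elim: n f g => [|n IHn] f g cf cg fg /=; first exact: fg.
apply: int_le; try exact: box_slice_cont.
move=> a _; apply: IHn => [||y]; [exact: ct_slice|exact: ct_slice|exact: fg].
Qed.

Lemma box_ge0 n (f : 'rV[R]_n -> R) : (forall y, 0 <= f y) -> 0 <= box_int L f.
Proof.
elim: n f => [|n IHn] f f0 /=; first exact: f0.
by apply: Rintegral_ge0 => a _; apply: IHn.
Qed.

Lemma box_eq0 n (f : 'rV[R]_n -> R) : continuous f -> (forall y, 0 <= f y) ->
  box_int L f = 0 -> forall y : 'rV[R]_n, (forall i, `|y 0 i| <= L) -> f y = 0.
Proof.
elim: n f => [|n IHn] f cf f0 /= I0 y yL.
  by rewrite -I0; congr f; apply/rowP => -[].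
have E : y = consv (y 0 ord0) (\row_i y 0 (lift ord0 i)).
  apply/rowP => j; case: (unliftP ord0 j) => [i ->|->]; last by rewrite consv0.
  by rewrite consvS mxE.
rewrite E; apply: (IHn (fun z => f (consv (y 0 ord0) z))) => //.
- exact: ct_slice.
- have LL : - L < L by rewrite gt0_cp.
  apply: (int_eq0 LL (box_slice_cont cf) _ I0); last by rewrite -ler_norml.
  by move=> a _; exact: box_ge0.
- by move=> i; rewrite mxE.
Qed.

(** For the outermost coordinate the inner integral is itself differentiated in that coordinate and
    the fundamental theorem applied to it; other coordinates go to the induction. Thus the order of
    integration is never exchanged. *)
Lemma box_divergence n (g dg : 'rV[R]_n -> R) i : continuous g -> continuous dg ->
  (forall y, is_derive y (basis_vec i) g (dg y)) ->
  (forall y : 'rV[R]_n, `|y 0 i| = L -> g y = 0) -> box_int L dg = 0.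
Proof.
elim: n g dg i => [|n IHn] g dg i cg cdg D g0 /=; first by case: i D g0.
have int0 (h : R -> R) : h =1 (fun=> 0) -> \int[mu]_(a in `[- L, L]) h a = 0.
  by move=> /funext ->; rewrite int_cst // mul0r.
have box0 m (h : 'rV[R]_m -> R) : h =1 (fun=> 0) -> box_int L h = 0.
  move=> h0; rewrite -[RHS](mul0r (box_int L (fun _ : 'rV[R]_m => 0))) -boxZ; last exact: ctC.
  by apply: box_eq => y; rewrite mul0r.
case: (unliftP ord0 i) D g0 => [l ->|->] D g0.
  apply: int0 => a; apply: (IHn (fun y => g (consv a y)) _ l); try exact: ct_slice.
    by move=> y; exact: is_derive_consvS.
  by move=> y yl; apply: g0; rewrite consvS.
have cs (G : 'rV[R]_n.+1 -> R) : continuous G ->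
    continuous (fun q : R * 'rV_n => G (consv q.1 q.2)).
  by move=> cG; apply: ctcomp cG _; apply: ct_consv; [apply: ctfst|apply: ctsnd]; exact: ctI.
have D1 (a : R) : is_derive a (1 : R) (fun a => box_int L (fun y => g (consv a y)))
    (box_int L (fun y => dg (consv a y))).
  apply: (@box_derive _ _ (fun q : R * 'rV_n => g (consv q.1 q.2))
    (fun q : R * 'rV_n => dg (consv q.1 q.2)) 1 (cs _ cg) (cs _ cdg)) => b y.
  apply: dlineP => /=; under eq_fun do rewrite scaler0 addr0.
  apply: (@dline _ _ (fun c : R => g (consv c y))); rewrite scale0r addr0.
  exact: is_derive_consv0.
rewrite (FTC L0' (box_slice_cont cdg) D1) !box0 ?subrr // => y; apply: g0.
  by rewrite consv0 normrN gtr0_norm.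
by rewrite consv0 gtr0_norm.
Qed.

End BoxTheory.

End Box.

(** * Energy estimate in light cones *)

Section Uniqueness.
Context {R : realType}.

Definition ppart (s : R) : R := (s + `|s|) / 2.

Lemma ppart_ge0 s : 0 <= ppart s.
Proof. by rewrite /ppart; have := ler_norm (- s); rewrite normrN; lra. Qed.

Lemma ppart_id s : 0 <= s -> ppart s = s.
Proof. by move=> s0; rewrite /ppart ger0_norm //; lra. Qed.

Lemma ppart_le0 s : s <= 0 -> ppart s = 0.
Proof. by move=> s0; rewrite /ppart ler0_norm //; lra. Qed.

Lemma ct_ppart (T : topologicalType) (f : T -> R) : continuous f ->
  continuous (fun x => ppart (f x)).
Proof.
move=> cf; apply: ctM; last exact: ctC.
by apply: ctD => // x; apply: cvg_norm; exact: cf.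
Qed.

(** Whatever the signs of s and s + h, the remainder of first order lies between 0 and h^2; squaring
    removes the corner of the positive part. *)
Lemma is_derive_ppart2 (s : R) : is_derive s (1 : R) (fun s => ppart s * ppart s) (2 * ppart s).
Proof.
apply: is_derive_cvg; apply/cvgrPdist_le => e e0.
near=> h.
have h0 : h != 0 by near: h; exact: nbhs_dnbhs_neq.
have hd : `|h| <= e.
  near: h; apply: nbhs_dnbhs; apply/nbhs_ballP; exists e => //= x.
  by rewrite /ball /= sub0r normrN => /ltW.
rewrite scaleR1.
set X := ppart (s + h) * ppart (s + h) - ppart s * ppart s.
have X1 : 0 <= X - 2 * ppart s * h <= h * h.
  rewrite /X; case: (lerP 0 s) => s0; case: (lerP 0 (s + h)) => sh0.
  - by rewrite !ppart_id //; nra.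
  - by rewrite (ppart_id s0) (ppart_le0 (ltW sh0)); nra.
  - by rewrite (ppart_id sh0) (ppart_le0 (ltW s0)); nra.
  - by rewrite (ppart_le0 (ltW sh0)) (ppart_le0 (ltW s0)); nra.
have -> : 2 * ppart s - h^-1 * X = - (h^-1 * (X - 2 * ppart s * h)) by field.
rewrite normrN normrM normfV ler_pdivrMl ?normr_gt0 //.
rewrite ger0_norm; last by case/andP: X1.
apply: (@le_trans _ _ (`|h| * `|h|)); last by rewrite ler_wpM2l.
by rewrite -normrM ger0_norm; [case/andP: X1|nra].
Unshelve. all: by end_near. Qed.

(** Here q is the weight, tau = a - t, P = |grad u|^2, Y = x - x0, Q = grad u . Y, D = |Y|^2, Del
    the Laplacian of u and X = grad u . grad u_t. The loss of weight in time dominates the flux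
    because the speed sqrt c is at most 1, the slope of the cone ([H1]). The term (1 - m2) u u_t is
    absorbed by Young's inequality ([H2]), and c' <= 0 has the favourable sign ([H4]). *)
Lemma energy_ineq (q tau ut u P Q D Del X c c' m2 : R) :
  0 <= q -> 0 < tau -> 0 <= c -> c <= 1 -> c' <= 0 -> 0 <= P ->
  0 <= tau ^+ 2 * P - 2 * tau * ut * Q + ut ^+ 2 * D ->
  (0 < q -> D <= tau ^+ 2) ->
  2 * q * (- 2 * tau) * (ut * ut + c * P + u * u) +
    q * q * (2 * ut * (c * Del - m2 * u) + c' * P + c * (2 * X) + 2 * u * ut)
  <= 2 * c * (2 * q * (- 2) * (ut * Q) + q * q * (X + ut * Del)) +
     `|1 - m2| * (q * q * (ut * ut + c * P + u * u)).
Proof.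
move=> q0 t0 c0 c1 c'0 P0 HQ HD.
have H1 : 0 <= q * (tau * (ut * ut + c * P + u * u) - 2 * c * ut * Q).
  have [q_gt0|] := ltP 0 q; last first.
    by move=> qle; have -> : q = 0; [apply: le_anti; rewrite qle q0|rewrite mul0r].
  (* After multiplication by tau the bracket is exactly the sum of the terms in [K1] to [K4]. *)
  rewrite mulr_ge0 // -(pmulr_rge0 _ t0).
  have HDt := HD q_gt0.
  have K1 : 0 <= c * (tau ^+ 2 * P - 2 * tau * ut * Q + ut ^+ 2 * D) by rewrite mulr_ge0.
  have K2 : 0 <= c * (ut ^+ 2 * (tau ^+ 2 - D)).
    by do 2! apply: mulr_ge0 => //; [exact: sqr_ge0|rewrite subr_ge0].
  have K3 : 0 <= (1 - c) * (ut ^+ 2 * tau ^+ 2).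
    by apply: mulr_ge0; [rewrite subr_ge0|apply: mulr_ge0; exact: sqr_ge0].
  have K4 : 0 <= tau ^+ 2 * u ^+ 2 by apply: mulr_ge0; exact: sqr_ge0.
  lra.
have H2 : 2 * (1 - m2) * (u * ut) <= `|1 - m2| * (ut * ut + u * u).
  have h1 : - `|1 - m2| <= 1 - m2 <= `|1 - m2| by rewrite -ler_norml.
  case/andP: h1 => h1 h2; have [h|h] := leP 0 (u * ut).
    have : (1 - m2) * (u * ut) <= `|1 - m2| * (u * ut) by rewrite ler_wpM2r.
    have : 0 <= `|1 - m2| * ((u - ut) * (u - ut)) by rewrite mulr_ge0 // -expr2 sqr_ge0.
    by lra.
  have : (1 - m2) * (u * ut) <= - `|1 - m2| * (u * ut) by rewrite ler_wnM2r // ltW.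
  have : 0 <= `|1 - m2| * ((u + ut) * (u + ut)) by rewrite mulr_ge0 // -expr2 sqr_ge0.
  by lra.
have H3 : 0 <= q * q * (`|1 - m2| * (ut * ut + u * u) - 2 * (1 - m2) * (u * ut)).
  by rewrite mulr_ge0 ?subr_ge0 // -expr2 sqr_ge0.
have H4 : 0 <= q * q * (`|1 - m2| * (c * P) - c' * P).
  apply: mulr_ge0; first by rewrite -expr2 sqr_ge0.
  rewrite subr_ge0; by apply: (@le_trans _ _ 0); [rewrite mulr_le0_ge0|rewrite !mulr_ge0].
by lra.
Qed.

Lemma sum_flux n (c q ut : R) (A B X Y : 'I_n -> R) :
  \sum_(i < n) 2 * c * (2 * q * (- 2 * Y i) * (ut * B i) + q * q * (X i * B i + ut * A i)) =
  2 * c * (2 * q * (- 2) * (ut * \sum_(i < n) B i * Y i)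
           + q * q * (\sum_(i < n) B i * X i + ut * \sum_(i < n) A i)).
Proof.
rewrite !mulr_sumr -big_split /= mulr_sumr -big_split /= mulr_sumr.
by apply: eq_bigr => i _; ring.
Qed.

Lemma eq_le (x y : R) : x = y -> x <= y.
Proof. by move=> ->. Qed.

Section Spacetime.
Context {n : nat}.
Implicit Types (G : 'rV[R]_n * R -> R).

(** [box_derive] takes the parameter t before the integration point y, whereas functions on
    spacetime take (y, t). *)
Lemma is_derive_swap_time G (t : R) (y : 'rV[R]_n) d : is_derive (y, t) (time_dir n) G d ->
  is_derive (t, y) ((1 : R), (0 : 'rV[R]_n)) (fun p => G (p.2, p.1)) d.
Proof.
move=> D; apply: dlineP => /=.
have E (s : R) : (y + s *: (0 : 'rV[R]_n), t + s *: (1 : R)) = (y, t) + s *: time_dir n by [].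
under eq_fun do rewrite E.
by apply: dline; rewrite scale0r addr0.
Qed.

Lemma is_derive_space G (t : R) (y : 'rV[R]_n) i d : is_derive (y, t) (space_dir i) G d ->
  is_derive y (basis_vec i) (fun y => G (y, t)) d.
Proof.
move=> D; apply: dlineP => /=.
have E (s : R) : (y + s *: basis_vec i, t) = (y, t) + s *: space_dir i.
  by congr pair; rewrite /= scaler0 addr0.
under eq_fun do rewrite E.
by apply: dline; rewrite scale0r addr0.
Qed.

Lemma is_derive_time G (t : R) (y : 'rV[R]_n) d : is_derive (y, t) (time_dir n) G d ->
  is_derive t (1 : R) (fun t => G (y, t)) d.
Proof.
move=> D; apply: dlineP => /=.
have E (s : R) : (y, t + s *: (1 : R)) = (y, t) + s *: time_dir n.
  by congr pair; rewrite /= scaler0 addr0.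
under eq_fun do rewrite E.
by apply: dline; rewrite scale0r addr0.
Qed.

Lemma space_axis i : spacetime_axes (R := R) (n := n) (space_dir i).
Proof. by left; exists i. Qed.

Lemma time_axis : spacetime_axes (R := R) (n := n) (time_dir n).
Proof. by right. Qed.

Variables (c2 c2' : R -> R) (m2 : R) (U : 'rV[R]_n * R -> R).
Hypothesis CU : Ck (@spacetime_axes R n) 2 U.
Hypothesis Dc2 : forall t : R, is_derive t (1 : R) c2 (c2' t).
Hypothesis cc2' : continuous c2'.
Hypothesis c2'_le0 : forall t, 0 <= t -> c2' t <= 0.
Hypothesis c2_01 : forall t, 0 <= t -> 0 <= c2 t <= 1.
Hypothesis PDE : forall x t, 0 <= t ->
  'D_(time_dir n) ('D_(time_dir n) U) (x, t) - c2 t * laplacian_x U (x, t) + m2 * U (x, t) = 0.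
Hypothesis U0 : forall x, U (x, 0) = 0.
Hypothesis U1 : forall x, 'D_(time_dir n) U (x, 0) = 0.

Let ut := 'D_(time_dir n) U.
Let ui (i : 'I_n) := 'D_(space_dir i) U.

Let Cut : Ck (@spacetime_axes R n) 1 ut.
Proof. exact: Ck_derive CU time_axis. Qed.

Let Cui i : Ck (@spacetime_axes R n) 1 (ui i).
Proof. exact: Ck_derive CU (space_axis i). Qed.

Let cc2 : continuous c2.
Proof. by move=> t; apply: is_derive_continuous (Dc2 t). Qed.

Lemma ct_swap (G : 'rV[R]_n * R -> R) : continuous G -> continuous (fun p : R * 'rV[R]_n => G (p.2, p.1)).
Proof. by move=> cG; apply: ctcomp cG _; apply: ctpair; [apply: ctsnd|apply: ctfst]; exact: ctI. Qed.

Lemma space_dirE y (t s : R) i :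
  (y, t) + s *: (space_dir i : 'rV[R]_n * R) = (y + s *: basis_vec i, t).
Proof. by congr pair; rewrite /= scaler0 addr0. Qed.

Lemma basis_vecE (i j : 'I_n) : (basis_vec i : 'rV[R]_n) 0 j = (j == i)%:R.
Proof. by rewrite mxE eqxx. Qed.

Local Opaque time_dir space_dir basis_vec.

Section Cone.
Variables (x0 : 'rV[R]_n) (a : R).

(* The energy density is weighted by the square of the positive part of S, a C^1 function
   supported in the backward light cone of (x0, a), so no boundary term appears in the cube. *)
Let S (p : R * 'rV[R]_n) : R :=
  (a - p.1) * (a - p.1) - \sum_(i < n) (p.2 0 i - x0 0 i) * (p.2 0 i - x0 0 i).

Let ctS : continuous S.
Proof.
apply: ctD.
  by apply: ctM; apply: ctD; (try exact: ctC); apply: ctN; apply: ctfst; exact: ctI.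
apply: ctN; apply: ctsum => i.
by apply: ctM; apply: ctD; (try exact: ctC); apply: ct_coord; apply: ctsnd; exact: ctI.
Qed.

Let q p := ppart (S p).

Let ctq : continuous q. Proof. exact: ct_ppart ctS. Qed.

Let e (p : R * 'rV[R]_n) : R :=
  ut (p.2, p.1) * ut (p.2, p.1)
  + c2 p.1 * (\sum_(i < n) ui i (p.2, p.1) * ui i (p.2, p.1))
  + U (p.2, p.1) * U (p.2, p.1).

Let F p := q p * q p * e p.

Let de (p : R * 'rV[R]_n) : R :=
  2 * ut (p.2, p.1) * 'D_(time_dir n) ut (p.2, p.1)
  + c2' p.1 * (\sum_(i < n) ui i (p.2, p.1) * ui i (p.2, p.1))
  + c2 p.1 * (2 * \sum_(i < n) ui i (p.2, p.1) * 'D_(time_dir n) (ui i) (p.2, p.1))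
  + 2 * U (p.2, p.1) * ut (p.2, p.1).

Let dF (p : R * 'rV[R]_n) : R :=
  2 * q p * (- 2 * (a - p.1)) * e p + q p * q p * de p.

Let cU := ct_swap (Ck_continuous CU).
Let cut := ct_swap (Ck_continuous Cut).
Let cutt := ct_swap (Ck_continuous (Ck_derive Cut time_axis)).
Let cui i := ct_swap (Ck_continuous (Cui i)).
Let cuit i := ct_swap (Ck_continuous (Ck_derive (Cui i) time_axis)).
Let cuti i := ct_swap (Ck_continuous (Ck_derive Cut (space_axis i))).
Let cuii i := ct_swap (Ck_continuous (Ck_derive (Cui i) (space_axis i))).
Let ct1 (f : R -> R) : continuous f -> continuous (fun p : R * 'rV[R]_n => f p.1).
Proof. by move=> cf; apply: ctcomp cf _; apply: ctfst; exact: ctI. Qed.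

Let cte : continuous e.
Proof.
apply: ctD; last exact: ctM cU cU.
apply: ctD; first exact: ctM cut cut.
apply: ctM; first exact: ct1.
by apply: ctsum => i; exact: ctM (@cui i) (@cui i).
Qed.

Let ctF : continuous F. Proof. exact: ctM (ctM ctq ctq) cte. Qed.

Let ctde : continuous de.
Proof.
apply: ctD; last exact: ctM (ctM (@ctC _ R 2) cU) cut.
apply: ctD.
  apply: ctD; first exact: ctM (ctM (@ctC _ R 2) cut) cutt.
  apply: ctM; first exact: ct1.
  by apply: ctsum => i; exact: ctM (@cui i) (@cui i).
apply: ctM; first exact: ct1.
apply: ctM; first exact: ctC.
by apply: ctsum => i; exact: ctM (@cui i) (@cuit i).
Qed.

Let ctdF : continuous dF.
Proof.
apply: ctD; last exact: ctM (ctM ctq ctq) ctde.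
apply: ctM cte; apply: ctM; first exact: ctM (@ctC _ R 2) ctq.
apply: ctM; first exact: ctC.
by apply: ctD; [exact: ctC|apply: ctN; apply: ctfst; exact: ctI].
Qed.

Let D_F t y : is_derive (t, y) ((1 : R), (0 : 'rV[R]_n)) F (dF (t, y)).
Proof.
have T1 : is_derive (t, y) ((1 : R), (0 : 'rV[R]_n)) (fun p => p.1) 1.
  apply: dlineP => /=; under eq_fun do rewrite scaleR1.
  have H := dadd (dcst t (0 : R) (1 : R)) (is_derive_id (0 : R) (1 : R)).
  by rewrite add0r in H.
have T2 : is_derive (t, y) ((1 : R), (0 : 'rV[R]_n)) (fun p => a - p.1) (0 - 1).
  exact: (dsub (dcst _ _ _) T1).
have T3 i : is_derive (t, y) ((1 : R), (0 : 'rV[R]_n)) (fun p => p.2 0 i - x0 0 i) 0.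
  by apply: dlineP => /=; under eq_fun do rewrite scaler0 addr0; exact: dcst.
have DS := dsub (dmul T2 T2) (dsum (fun i => dmul (T3 i) (T3 i))).
have Dq := dcomp1 (is_derive_ppart2 _) DS.
have Dut := is_derive_swap_time (Ck_is_derive (y, t) Cut time_axis).
have DU : is_derive (t, y) ((1 : R), (0 : 'rV[R]_n)) (fun p => U (p.2, p.1)) (ut (y, t)).
  exact: is_derive_swap_time (Ck_is_derive (y, t) CU time_axis).
have Dui i := is_derive_swap_time (Ck_is_derive (y, t) (Cui i) time_axis).
have Dc : is_derive (t, y) ((1 : R), (0 : 'rV[R]_n)) (fun p => c2 p.1) (c2' t * 1).
  by apply: dcomp1 T1; exact: Dc2.
have De := dadd (dadd (dmul Dut Dut) (dmul Dc (dsum (fun i => dmul (Dui i) (Dui i))))) (dmul DU DU).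
have DF := dmul Dq De.
apply: (is_derive_eq DF) => /=.
rewrite /dF /de /q /S /=.
rewrite [X in 2 * _ * (_ - X)]big1; last by move=> i _; rewrite mul0r mulr0 addr0.
rewrite -/(S (t, y)) -/(e (t, y)) /=.
have -> : \sum_(i < n) ('D_(time_dir n) (ui i) (y, t) * ui i (y, t) + ui i (y, t) * 'D_(time_dir n) (ui i) (y, t))
  = 2 * \sum_(i < n) ui i (y, t) * 'D_(time_dir n) (ui i) (y, t).
  by rewrite mulr_sumr; apply: eq_bigr => i _; ring.
rewrite /e /=; ring.
Qed.

(** The i-th component of the energy flux 2 c u_t grad u, cut off by the same weight as the
    energy. *)
Let g i (p : R * 'rV[R]_n) : R :=
  2 * c2 p.1 * (q p * q p * (ut (p.2, p.1) * ui i (p.2, p.1))).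

Let dg i (p : R * 'rV[R]_n) : R :=
  2 * c2 p.1 * (2 * q p * (- 2 * (p.2 0 i - x0 0 i)) * (ut (p.2, p.1) * ui i (p.2, p.1))
   + q p * q p * ('D_(space_dir i) ut (p.2, p.1) * ui i (p.2, p.1)
                  + ut (p.2, p.1) * 'D_(space_dir i) (ui i) (p.2, p.1))).

Let ctg i : continuous (g i).
Proof.
apply: ctM; first exact: ctM (@ctC _ R 2) (ct1 cc2).
exact: ctM (ctM ctq ctq) (ctM cut (@cui i)).
Qed.

Let ctdg i : continuous (dg i).
Proof.
apply: ctM; first exact: ctM (@ctC _ R 2) (ct1 cc2).
apply: ctD.
  apply: ctM; last exact: ctM cut (@cui i).
  apply: ctM; first exact: ctM (@ctC _ R 2) ctq.
  apply: ctM; first exact: ctC.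
  by apply: ctD; [apply: ct_coord; apply: ctsnd; exact: ctI|exact: ctC].
apply: ctM; first exact: ctM ctq ctq.
by apply: ctD; [exact: ctM (@cuti i) (@cui i)|exact: ctM cut (@cuii i)].
Qed.

Let D_g i t y : is_derive y (basis_vec i) (fun y => g i (t, y)) (dg i (t, y)).
Proof.
have T3 (j : 'I_n) : is_derive y (basis_vec i) (fun y : 'rV[R]_n => y 0 j - x0 0 j) (j == i)%:R.
  apply: dlineP.
  have E (h : R) : (y + h *: basis_vec i) 0 j - x0 0 j = (y 0 j - x0 0 j) + (j == i)%:R * h.
    by rewrite mxE [X in _ + X - _]mxE basis_vecE addrAC mulrC.
  under eq_fun do rewrite E.
  have H := dadd (dcst (y 0 j - x0 0 j) (0 : R) (1 : R)) (dcmul (j == i)%:R (is_derive_id (0 : R) (1 : R))).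
  by rewrite add0r mulr1 in H.
have DS := dsub (dcst ((a - t) * (a - t)) y (basis_vec i)) (dsum (fun j => dmul (T3 j) (T3 j))).
have Dq : is_derive y (basis_vec i) (fun y => q (t, y) * q (t, y))
    (2 * q (t, y) * (- 2 * (y 0 i - x0 0 i))).
  apply: (is_derive_eq (dcomp1 (is_derive_ppart2 _) DS)).
  congr (_ * _); rewrite (bigD1 i) //= eqxx big1 => [|j /negbTE -> /=]; last by rewrite mulr0n; ring.
  rewrite mulr1n; ring.
have Dut := is_derive_space (Ck_is_derive (y, t) Cut (space_axis i)).
have Dui := is_derive_space (Ck_is_derive (y, t) (Cui i) (space_axis i)).
exact: (dcmul (2 * c2 t) (dmul Dq (dmul Dut Dui))).
Qed.

(** Every face of the cube is at distance at least a from x0, outside the cone at all times in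
    [0, a]. *)
Let L := a + \sum_(i < n) `|x0 0 i|.

Let q_boundary t (y : 'rV[R]_n) i : 0 <= t -> t <= a -> `|y 0 i| = L -> q (t, y) = 0.
Proof.
move=> t0 ta yL; apply: ppart_le0; rewrite /S /=.
rewrite (bigD1 i) //=.
have : 0 <= \sum_(j < n | j != i) (y 0 j - x0 0 j) * (y 0 j - x0 0 j).
  by apply: sumr_ge0 => j _; rewrite -expr2 sqr_ge0.
have H : a <= `|y 0 i - x0 0 i|.
  apply: le_trans (lerB_dist _ _); rewrite yL /L (bigD1 i) //=.
  have : 0 <= \sum_(j < n | j != i) `|x0 0 j| by apply: sumr_ge0 => j _; exact: normr_ge0.
  lra.
have : (a - t) * (a - t) <= `|y 0 i - x0 0 i| * `|y 0 i - x0 0 i| by apply: ler_pM; lra.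
rewrite -normrM ger0_norm; last by rewrite -expr2 sqr_ge0.
lra.
Qed.

(** The weighted energy satisfies E' <= C E and E(0) = 0, so it vanishes at time T; then its
    continuous nonnegative integrand vanishes at x0, where the weight is positive. *)
Lemma cone_uniqueness T : 0 <= T -> T < a -> U (x0, T) = 0.
Proof.
move=> T0 Ta; have a0 : 0 < a by lra.
have L0 : 0 < L.
  by rewrite /L ltr_pwDl //; apply: sumr_ge0 => j _; exact: normr_ge0.
pose En t := box_int L (fun y => F (t, y)).
pose C := `|1 - m2|.
have DE t : is_derive t (1 : R) En (box_int L (fun y => dF (t, y))).
  exact: (box_derive L0 ctF ctdF D_F).
have e_ge0 t y : 0 <= t -> 0 <= e (t, y).
  move=> t0; rewrite /e /=; have /andP[c0 _] := c2_01 t0.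
  rewrite -!expr2 !addr_ge0 ?sqr_ge0 // mulr_ge0 // sumr_ge0 // => i _.
  by rewrite -expr2 sqr_ge0.
have F_ge0 t y : 0 <= t -> 0 <= F (t, y).
  by move=> t0; rewrite /F mulr_ge0 ?e_ge0 // -expr2 sqr_ge0.
have En_ge0 t : 0 <= t -> 0 <= En t by move=> t0; apply: box_ge0 => y; exact: F_ge0.
have dF_le t y : 0 <= t -> t < a ->
    dF (t, y) <= \sum_(i < n) dg i (t, y) + C * F (t, y).
  move=> t0 ta; have /andP[c0 c1] := c2_01 t0.
  have utt : 'D_(time_dir n) ut (y, t) = c2 t * laplacian_x U (y, t) - m2 * U (y, t).
    by have := PDE y t0; rewrite -/ut; lra.
  (* The flux produces D_i u_t and the energy D_t u_i; the two match only after this exchange. *)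
  have Sw i : 'D_(space_dir i) ut (y, t) = 'D_(time_dir n) (ui i) (y, t).
    exact: (congr1 (fun f => f (y, t)) (schwarz (space_axis i) time_axis CU)).
  have Esum : \sum_(i < n) dg i (t, y) =
     2 * c2 t * (2 * q (t, y) * (- 2) * (ut (y, t) * \sum_(i < n) ui i (y, t) * (y 0 i - x0 0 i))
       + q (t, y) * q (t, y) * (\sum_(i < n) ui i (y, t) * 'D_(time_dir n) (ui i) (y, t)
           + ut (y, t) * laplacian_x U (y, t))).
    rewrite -[laplacian_x U (y, t)]/(\sum_(i < n) 'D_(space_dir i) (ui i) (y, t)) -sum_flux.
    apply: eq_bigr => i _.
    exact: (congr1 (fun z => 2 * c2 t * (2 * q (t, y) * (- 2 * (y 0 i - x0 0 i)) * (ut (y, t) * ui i (y, t))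
      + q (t, y) * q (t, y) * (z * ui i (y, t) + ut (y, t) * 'D_(space_dir i) (ui i) (y, t)))) (Sw i)).
  have Hin := @energy_ineq (q (t, y)) (a - t) (ut (y, t)) (U (y, t))
    (\sum_(i < n) ui i (y, t) * ui i (y, t)) (\sum_(i < n) ui i (y, t) * (y 0 i - x0 0 i))
    (\sum_(i < n) (y 0 i - x0 0 i) * (y 0 i - x0 0 i)) (laplacian_x U (y, t))
    (\sum_(i < n) ui i (y, t) * 'D_(time_dir n) (ui i) (y, t)) (c2 t) (c2' t) m2.
  rewrite Esum /C; apply: le_trans (Hin _ _ _ _ _ _ _ _).
  - apply: eq_le.
    exact: (congr1 (fun z => 2 * q (t, y) * (- 2 * (a - t)) * e (t, y) + q (t, y) * q (t, y) *
      (2 * ut (y, t) * z + c2' t * (\sum_(i < n) ui i (y, t) * ui i (y, t))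
       + c2 t * (2 * \sum_(i < n) ui i (y, t) * 'D_(time_dir n) (ui i) (y, t))
       + 2 * U (y, t) * ut (y, t))) utt).
  - exact: ppart_ge0.
  - by rewrite subr_gt0.
  - exact: c0.
  - exact: c1.
  - exact: c2'_le0.
  - by apply: sumr_ge0 => i _; rewrite -expr2 sqr_ge0.
  - rewrite (_ : _ + _ = \sum_(i < n) ((a - t) * ui i (y, t) - ut (y, t) * (y 0 i - x0 0 i)) ^+ 2).
      by apply: sumr_ge0 => i _; exact: sqr_ge0.
    rewrite !mulr_sumr -sumrB -big_split /=; apply: eq_bigr => i _; ring.
  (* Outside the cone S is negative and its positive part is 0. *)
  - rewrite ltNge => /negP qpos; rewrite leNgt; apply/negP => h; apply: qpos.
    by rewrite /q ppart_le0 // /S /= -expr2; lra.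
have dEn_le t : 0 <= t -> t < a -> box_int L (fun y => dF (t, y)) <= C * En t.
  move=> t0 ta.
  have cgs : continuous (fun y => \sum_(i < n) dg i (t, y)).
    by apply: ctsum => i; exact: cont_pair (@ctdg i).
  have cFt : continuous (fun y => F (t, y)) by exact: cont_pair ctF.
  have cCF : continuous (fun y => C * F (t, y)) by exact: ctM (@ctC _ R C) cFt.
  apply: (@le_trans _ _ (box_int L (fun y => \sum_(i < n) dg i (t, y) + C * F (t, y)))).
    apply: (box_le L0); [exact: cont_pair ctdF|exact: ctD cgs cCF|by move=> y; exact: dF_le].
  rewrite (boxD L0 cgs cCF) (boxZ L0 _ cFt) (box_sum L0); last by move=> i; exact: cont_pair (@ctdg i).
  rewrite big1 ?add0r // => i _.
  apply: (@box_divergence _ _ L0 _ (fun y => g i (t, y)) (fun y => dg i (t, y)) i).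
  - exact: cont_pair (@ctg i).
  - exact: cont_pair (@ctdg i).
  - exact: (@D_g i t).
  - by move=> y yL; rewrite /g (q_boundary t0 (ltW ta) yL) !mul0r mulr0.
(* Since U is 0 on the whole slice t = 0, its space derivatives vanish there too. *)
have En0 : En 0 = 0.
  rewrite /En -[RHS](mul0r (box_int L (fun _ : 'rV[R]_n => 0))) -(boxZ L0); last exact: ctC.
  apply: box_eq => y; rewrite mul0r /F /e /= U0 /ut U1.
  rewrite big1 ?mulr0 ?addr0 ?mulr0 // => i _.
  suff -> : ui i (y, 0) = 0 by rewrite mulr0.
  apply: derive_at; apply: dlineP => /=.
  by under eq_fun do rewrite space_dirE U0; exact: dcst.
have EnT : En T = 0.
  (* Gronwall: the exponential factor makes h' <= 0 on [0, T]. *)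
  pose h t := expR (- C * t) * En t.
  have Dh t : is_derive t (1 : R) h (expR (- C * t) * (- C * 1) * En t + expR (- C * t) * box_int L (fun y => dF (t, y))).
    exact: (dmul (dcomp1 (is_derive_expR _) (dcmul (- C) (is_derive_id t (1 : R)))) (DE t)).
  have ch : continuous h by move=> t; apply: is_derive_continuous (Dh t).
  have [c] := MVT_segment T0 (fun t _ => Dh t) (continuous_subspaceT ch).
  rewrite in_itv /= => /andP[c0 cT]; rewrite {2}/h En0 mulr0 !subr0 => hT.
  have : h T <= 0.
    rewrite hT; apply: mulr_le0_ge0 => //.
    have := dEn_le c c0 (le_lt_trans cT Ta); have := expR_gt0 (- C * c); nra.
  rewrite /h pmulr_rle0 ?expR_gt0 // => h1.
  by apply: le_anti; rewrite h1 En_ge0.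
have := box_eq0 L0 (cont_pair ctF) (fun y => F_ge0 T y T0) EnT (y := x0).
rewrite /F /q /S /= big1; last by move=> i _; rewrite subrr mulr0.
rewrite subr0 ppart_id; last by rewrite -expr2 sqr_ge0.
move=> /(_ _)/eqP; rewrite !mulf_eq0 subr_eq0 !(gt_eqF Ta) /= => H.
have {H} : e (T, x0) == 0.
  apply: H => i; rewrite /L (bigD1 i) //=.
  have : 0 <= \sum_(j < n | j != i) `|x0 0 j| by apply: sumr_ge0 => j _; exact: normr_ge0.
  lra.
rewrite /e /= => /eqP H.
have /andP[c0 _] := c2_01 T0.
have P0 : 0 <= c2 T * (\sum_(i < n) ui i (x0, T) * ui i (x0, T)).
  by rewrite mulr_ge0 // sumr_ge0 // => i _; rewrite -expr2 sqr_ge0.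
have : U (x0, T) ^+ 2 <= 0.
  by have := sqr_ge0 (ut (x0, T)); rewrite !expr2; lra.
by rewrite le_eqVlt ltNge sqr_ge0 orbF sqrf_eq0 => /eqP.
Qed.

End Cone.

Theorem hyperbolic_uniqueness x t : 0 <= t -> U (x, t) = 0.
Proof. by move=> t0; apply: (@cone_uniqueness x (t + 1)) => //; rewrite ltrDl. Qed.

End Spacetime.
End Uniqueness.

(** * Spherical integrals *)

Section Sphere.
Context {R : realType}.
Local Notation mu := (@lebesgue_measure R).

Lemma sphere_intS j (f : 'rV[R]_j.+2 -> R) :
  sphere_int f = \int[mu]_(theta in `[0, pi])
    (sin theta ^+ j * sphere_int (fun w : 'rV[R]_j.+1 => f (consv (cos theta) (sin theta *: w)))).
Proof. by []. Qed.

Let pi0 : 0 <= pi :> R. Proof. exact: pi_ge0. Qed.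

Lemma ct_cos (T : topologicalType) (f : T -> R) : continuous f -> continuous (fun x => cos (f x)).
Proof. by move=> cf; apply: ctcomp cf; exact: continuous_cos. Qed.

Lemma ct_sin (T : topologicalType) (f : T -> R) : continuous f -> continuous (fun x => sin (f x)).
Proof. by move=> cf; apply: ctcomp cf; exact: continuous_sin. Qed.

Lemma ct_polar (T : topologicalType) n (f : T -> R) (g : T -> 'rV[R]_n) :
  continuous f -> continuous g ->
  continuous (fun x => consv (cos (f x)) (sin (f x) *: g x)).
Proof. by move=> cf cg; apply: ct_consv; [exact: ct_cos|apply: ctZ => //; exact: ct_sin]. Qed.

Let slice (V : normedModType R) j (F : V * 'rV[R]_j.+2 -> R) (q : V * R * 'rV[R]_j.+1) :=
  F (q.1.1, consv (cos q.1.2) (sin q.1.2 *: q.2)).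

Let ct_sliceF (V : normedModType R) j (F : V * 'rV[R]_j.+2 -> R) :
  continuous F -> continuous (slice F).
Proof.
move=> cF; apply: ctcomp cF _; apply: ctpair; first by apply: ctfst; apply: ctfst; exact: ctI.
by apply: ct_polar; [apply: ctsnd; apply: ctfst|apply: ctsnd]; exact: ctI.
Qed.

Lemma sphere_cont k (V : normedModType R) (F : V * 'rV[R]_k.+1 -> R) :
  continuous F -> continuous (fun p => sphere_int (fun y => F (p, y))).
Proof.
elim: k V F => [|k IHk] V F cF.
  by apply: ctD; apply: ctcomp cF _; apply: ctpair; (try exact: ctI); exact: ctC.
apply: (@int_cont _ _ (fun pt : V * R => sin pt.2 ^+ k *
  sphere_int (fun w => slice F (pt, w)))) => //.
apply: ctM; first by apply: ctX; apply: ct_sin; apply: ctsnd; exact: ctI.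
by apply: (IHk (V * R)%type (slice F)); exact: ct_sliceF.
Qed.

Lemma sphere_slice_cont k (f : 'rV[R]_k.+2 -> R) : continuous f ->
  continuous (fun t : R => sphere_int (fun w : 'rV[R]_k.+1 => f (consv (cos t) (sin t *: w)))).
Proof.
move=> cf.
apply: (@sphere_cont _ _ (fun q : R * 'rV[R]_k.+1 => f (consv (cos q.1) (sin q.1 *: q.2)))).
by apply: ctcomp cf _; apply: ct_polar; [apply: ctfst|apply: ctsnd]; exact: ctI.
Qed.

Lemma sphere_integrand_cont k (f : 'rV[R]_k.+2 -> R) : continuous f ->
  continuous (fun t : R => sin t ^+ k * sphere_int (fun w : 'rV[R]_k.+1 => f (consv (cos t) (sin t *: w)))).
Proof.
by move=> cf; apply: ctM; [apply: ctX; apply: ct_sin; exact: ctI|exact: sphere_slice_cont].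
Qed.

Lemma sphere_derive k (V : normedModType R) (F dF : V * 'rV[R]_k.+1 -> R) (v : V) :
  continuous F -> continuous dF ->
  (forall p y, is_derive (p, y) (v, 0) F (dF (p, y))) ->
  forall p, is_derive p v (fun p => sphere_int (fun y => F (p, y)))
                          (sphere_int (fun y => dF (p, y))).
Proof.
elim: k V F dF v => [|k IHk] V F dF v cF cdF D p.
  have H y : is_derive p v (fun p => F (p, y)) (dF (p, y)).
    apply: dlineP.
    have E (t : R) : (p + t *: v, y) = (p, y) + t *: ((v, 0) : V * 'rV[R]_1).
      by congr pair; rewrite /= scaler0 addr0.
    under eq_fun do rewrite E.
    by apply: dline; rewrite scale0r addr0; exact: D.
  exact: (dadd (H _) (H _)).
apply: (@int_derive _ _
  (fun pt : V * R => sin pt.2 ^+ k * sphere_int (fun w => slice F (pt, w)))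
  (fun pt : V * R => sin pt.2 ^+ k * sphere_int (fun w => slice dF (pt, w)))) => //.
- apply: ctM; first by apply: ctX; apply: ct_sin; apply: ctsnd; exact: ctI.
  by apply: (@sphere_cont _ _ (slice F)); exact: ct_sliceF.
- apply: ctM; first by apply: ctX; apply: ct_sin; apply: ctsnd; exact: ctI.
  by apply: (@sphere_cont _ _ (slice dF)); exact: ct_sliceF.
move=> q s.
have D1 : is_derive (q, s) (v, 0) (fun pt : V * R => sin pt.2 ^+ k) 0.
  by apply: dlineP => /=; under eq_fun do rewrite scaler0 addr0; exact: dcst.
have D2 : is_derive (q, s) (v, 0) (fun pt : V * R => sphere_int (fun w => slice F (pt, w)))
    (sphere_int (fun w => slice dF ((q, s), w))).
  apply: (IHk (V * R)%type (slice F) (slice dF) (v, 0) (ct_sliceF cF) (ct_sliceF cdF)).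
  move=> [q1 q2] y; apply: dlineP; rewrite /slice /=.
  have E (t : R) : (q1 + t *: v, consv (cos (q2 + t *: 0)) (sin (q2 + t *: 0) *: (y + t *: 0)))
      = (q1, consv (cos q2) (sin q2 *: y)) + t *: ((v, 0) : V * 'rV[R]_k.+2).
    by rewrite !scaler0 !addr0; congr pair; rewrite /= scaler0 addr0.
  under eq_fun do rewrite E.
  by apply: dline; rewrite scale0r addr0; exact: D.
by have := dmul D1 D2; rewrite mul0r add0r.
Qed.

Lemma Ck_sphere k l (V : normedModType R) (A : set V) (F : V * 'rV[R]_k.+1 -> R) :
  Ck (paxes 'rV[R]_k.+1 A) l F -> Ck A l (fun p => sphere_int (fun y => F (p, y))).
Proof.
elim: l F => [|l IHl] F CF.
  by split=> //; apply: sphere_cont; exact: Ck_continuous CF.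
apply: CkS; first by apply: sphere_cont; exact: Ck_continuous CF.
move=> v Av; have Bv : paxes 'rV[R]_k.+1 A (v, 0) by exists v.
exists (fun p => sphere_int (fun y => 'D_(v, 0) F (p, y))).
  move=> p; apply: (@sphere_derive _ _ F ('D_(v, 0) F)).
  - exact: Ck_continuous CF.
  - exact: Ck_continuous (Ck_derive CF Bv).
  - by move=> q s; exact: Ck_is_derive CF Bv.
by apply: (IHl ('D_(v, 0) F)); exact: Ck_derive CF Bv.
Qed.

Lemma sphereD k (f g : 'rV[R]_k.+1 -> R) : continuous f -> continuous g ->
  sphere_int (fun y => f y + g y) = sphere_int f + sphere_int g.
Proof.
elim: k f g => [|k IHk] f g cf cg; first by rewrite /sphere_int addrACA.
rewrite !sphere_intS -intD; try exact: sphere_integrand_cont.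
apply: int_eq => t _; rewrite IHk ?mulrDr //.
  by apply: ctcomp cf _; apply: ct_polar; [exact: ctC|exact: ctI].
by apply: ctcomp cg _; apply: ct_polar; [exact: ctC|exact: ctI].
Qed.

Lemma sphereZ k c (f : 'rV[R]_k.+1 -> R) : continuous f ->
  sphere_int (fun y => c * f y) = c * sphere_int f.
Proof.
elim: k f => [|k IHk] f cf; first by rewrite /sphere_int mulrDr.
rewrite !sphere_intS -intZ; try exact: sphere_integrand_cont.
apply: int_eq => t _; rewrite IHk ?(mulrCA _ c) //.
by apply: ctcomp cf _; apply: ct_polar; [exact: ctC|exact: ctI].
Qed.

Lemma sphere_eq k (f g : 'rV[R]_k.+1 -> R) : f =1 g -> sphere_int f = sphere_int g.
Proof. by move=> /funext ->. Qed.

Lemma sphere_sum k m (f : 'I_m -> 'rV[R]_k.+1 -> R) : (forall i, continuous (f i)) ->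
  sphere_int (fun y => \sum_(i < m) f i y) = \sum_(i < m) sphere_int (f i).
Proof.
elim: m f => [|m IHm] f cf.
  under sphere_eq do rewrite big_ord0.
  rewrite big_ord0 -[RHS](mul0r (sphere_int (fun _ : 'rV[R]_k.+1 => 0))) -sphereZ; last exact: ctC.
  by apply: sphere_eq => y; rewrite mul0r.
under sphere_eq do rewrite big_ord_recr /=.
rewrite big_ord_recr /= -IHm // -sphereD //.
by apply: ctsum => i; exact: cf.
Qed.

(** If the integral were 0, its integrand would vanish at pi / 2, where the sine is 1, against the
    positivity in one dimension less. *)
Lemma sphere_area_gt0 k : 0 < sphere_area k :> R.
Proof.
rewrite /sphere_area; elim: k => [|k IHk]; first by rewrite /sphere_int addr_gt0.
rewrite sphere_intS lt_neqAle; apply/andP; split; last first.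
  apply: Rintegral_ge0 => t /=; rewrite in_itv /= => /andP[t0 tp].
  by apply: mulr_ge0; [apply: exprn_ge0; apply: sin_ge0_pi; rewrite t0|exact: ltW].
apply/eqP => /esym I0.
have pi2 : 0 <= (pi : R) / 2 <= pi by have := pi_gt0 R; lra.
have cf : continuous (fun t : R => sin t ^+ k * sphere_int (fun _ : 'rV[R]_k.+1 => 1 : R)).
  by apply: ctM; [apply: ctX; apply: ct_sin; exact: ctI|exact: ctC].
have f0 t : 0 <= t <= pi -> 0 <= sin t ^+ k * sphere_int (fun _ : 'rV[R]_k.+1 => 1 : R).
  move=> /andP[t0 tp].
  by apply: mulr_ge0; [apply: exprn_ge0; apply: sin_ge0_pi; rewrite t0|exact: ltW].
have := int_eq0 (pi_gt0 R) cf f0 I0 pi2.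
by rewrite sin_pihalf expr1n mul1r => H; move: IHk; rewrite H ltxx.
Qed.

Lemma is_derive_polar n (F : 'rV[R]_n.+1 -> R) (DF : 'I_n.+1 -> 'rV[R]_n.+1 -> R) (w : 'rV[R]_n) t :
  (forall i z, is_derive z (basis_vec i) F (DF i z)) -> (forall i, continuous (DF i)) ->
  is_derive t (1 : R) (fun t => F (consv (cos t) (sin t *: w)))
   (- sin t * DF ord0 (consv (cos t) (sin t *: w))
    + cos t * \sum_(l < n) w 0 l * DF (lift ord0 l) (consv (cos t) (sin t *: w))).
Proof.
move=> D cD.
pose dG (i : 'I_n.+1) := if unlift ord0 i is Some l then cos t * w 0 l else - sin t.
have H := @dchain _ _ F DF R (fun t => consv (cos t) (sin t *: w)) t 1 dG D cD _.
apply: (is_derive_eq (H _)).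
  move=> i; rewrite /dG; case: (unliftP ord0 i) => [l ->|->].
    under eq_fun do rewrite consvS mxE.
    have := dmul (is_derive_sin t) (dcst (w 0 l) t (1 : R)).
    by rewrite mulr0 addr0.
  under eq_fun do rewrite consv0; exact: is_derive_cos.
rewrite big_ord_recl /dG unlift_none mulr_sumr; congr (_ + _).
by apply: eq_bigr => l _; rewrite liftK mulrA.
Qed.

Lemma is_derive_scaled n (F : 'rV[R]_n.+1 -> R) (d : 'rV[R]_n.+1 -> R) l (c s : R) (w : 'rV[R]_n) :
  (forall z, is_derive z (basis_vec (lift ord0 l)) F (d z)) ->
  is_derive w (basis_vec l) (fun w => F (consv c (s *: w))) (s * d (consv c (s *: w))).
Proof.
move=> D; apply: dlineP.
have E (h : R) : consv c (s *: (w + h *: basis_vec l))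
    = consv c (s *: w) + (s * h) *: basis_vec (lift ord0 l).
  by rewrite basis_vecS -consv_add mulr0 addr0 scalerDr scalerA.
under eq_fun do rewrite E.
have D1 : is_derive (s * 0) (1 : R)
    (fun u : R => F (consv c (s *: w) + u *: basis_vec (lift ord0 l))) (d (consv c (s *: w))).
  by apply: dline; rewrite mulr0 scale0r addr0; exact: D.
have := dcomp1 D1 (dcmul s (is_derive_id (0 : R) (1 : R))).
by rewrite mulr1 mulrC.
Qed.

End Sphere.

(** * Integration by parts on the sphere *)

Section Tangential.
Context {R : realType}.

Lemma dpow (V : normedModType R) (f : V -> R) (x v : V) (df : R) n :
  is_derive x v f df -> is_derive x v (fun y => f y ^+ n) (n%:R * f x ^+ n.-1 * df).
Proof.
move=> D; elim: n => [|n IHn].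
  by rewrite !mul0r; under eq_fun do rewrite expr0; exact: dcst.
under eq_fun do rewrite exprS.
apply: (is_derive_eq (dmul D IHn)).
case: n {IHn} => [|n]; first by rewrite /= !expr0; ring.
by rewrite /= -!natr1 exprS; ring.
Qed.

Lemma sqnorm_consv n a (y : 'rV[R]_n) : sqnorm (consv a y) = a ^+ 2 + sqnorm y.
Proof.
rewrite /sqnorm big_ord_recl consv0; congr (_ + _).
by apply: eq_bigr => i _; rewrite consvS.
Qed.

Lemma polar_derive n (p : 'rV[R]_n.+1 -> R) (F : 'rV[R]_n.+2 -> R)
    (DF : 'I_n.+2 -> 'rV[R]_n.+2 -> R) :
  continuous p -> continuous F ->
  (forall i z, is_derive z (basis_vec i) F (DF i z)) -> (forall i, continuous (DF i)) ->
  forall t : R, is_derive t (1 : R)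
    (fun t => sphere_int (fun w => p w * F (consv (cos t) (sin t *: w))))
    (sphere_int (fun w => p w * (- sin t * DF ord0 (consv (cos t) (sin t *: w))
       + cos t * \sum_(l < n.+1) w 0 l * DF (lift ord0 l) (consv (cos t) (sin t *: w))))).
Proof.
move=> cp cF D cD.
have cP : continuous (fun q : R * 'rV[R]_n.+1 => consv (cos q.1) (sin q.1 *: q.2)).
  by apply: ct_polar; [apply: ctfst|apply: ctsnd]; exact: ctI.
have cs1 : continuous (fun q : R * 'rV[R]_n.+1 => sin q.1).
  by apply: ct_sin; apply: ctfst; exact: ctI.
have cc1 : continuous (fun q : R * 'rV[R]_n.+1 => cos q.1).
  by apply: ct_cos; apply: ctfst; exact: ctI.
have cp2 : continuous (fun q : R * 'rV[R]_n.+1 => p q.2).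
  by apply: ctcomp cp _; apply: ctsnd; exact: ctI.
apply: (@sphere_derive _ _ _ (fun q : R * 'rV[R]_n.+1 => p q.2 * F (consv (cos q.1) (sin q.1 *: q.2)))
  (fun q : R * 'rV[R]_n.+1 => p q.2 * (- sin q.1 * DF ord0 (consv (cos q.1) (sin q.1 *: q.2))
   + cos q.1 * \sum_(l < n.+1) q.2 0 l * DF (lift ord0 l) (consv (cos q.1) (sin q.1 *: q.2))))).
- by apply: ctM => //; exact: ctcomp cF cP.
- apply: ctM => //; apply: ctD.
    by apply: ctM; [exact: ctN|exact: ctcomp (cD _) cP].
  apply: ctM => //; apply: ctsum => l; apply: ctM; last exact: ctcomp (cD _) cP.
  by apply: ct_coord; apply: ctsnd; exact: ctI.
move=> t w; apply: dlineP => /=; under eq_fun do rewrite scaler0 addr0.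
apply: dcmul; apply: (@dline _ _ (fun t : R => F (consv (cos t) (sin t *: w)))).
by rewrite scale0r addr0; exact: is_derive_polar.
Qed.

(** The divergence theorem on S^k for F times the tangential part e_j - y_j y of a coordinate
    vector, a field whose divergence is - k y_j. In geographic coordinates it follows by induction
    on k, as the integrand in the polar angle turns out to be an exact derivative. *)
Lemma tangential k (F : 'rV[R]_k.+1 -> R) (DF : 'I_k.+1 -> 'rV[R]_k.+1 -> R) j :
  continuous F -> (forall i z, is_derive z (basis_vec i) F (DF i z)) ->
  (forall i, continuous (DF i)) ->
  sphere_int (fun y => DF j y - y 0 j * (\sum_(l < k.+1) y 0 l * DF l y)
                       - k%:R * (y 0 j * F y)) = 0.
Proof.
elim: k F DF j => [|m IHm] F DF j cF D cD.
  by rewrite /sphere_int (ord1 j) !big_ord1 !mxE; ring.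
rewrite sphere_intS.
pose P t (w : 'rV[R]_m.+1) := consv (cos t) (sin t *: w).
have cP t : continuous (P t) by apply: ct_polar; [exact: ctC|exact: ctI].
pose Sg (t : R) (w : 'rV[R]_m.+1) := \sum_(l < m.+1) w 0 l * DF (lift ord0 l) (P t w).
have cw (l : 'I_m.+1) : continuous (fun w : 'rV[R]_m.+1 => w 0 l) by apply: ct_coord; exact: ctI.
have cSg t : continuous (Sg t).
  by apply: ctsum => l; exact: ctM (cw l) (ctcomp (cD _) (cP t)).
pose B (t : R) (w : 'rV[R]_m.+1) := - sin t * DF ord0 (P t w) + cos t * Sg t w.
have cB t : continuous (B t).
  by apply: ctD; [exact: ctM (@ctC _ R _) (ctcomp (cD _) (cP t))|exact: ctM (@ctC _ R _) (cSg t)].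
have SgE t w : \sum_(l < m.+2) P t w 0 l * DF l (P t w) = cos t * DF ord0 (P t w) + sin t * Sg t w.
  rewrite big_ord_recl /P consv0; congr (_ + _); rewrite /Sg mulr_sumr.
  by apply: eq_bigr => l _; rewrite consvS mxE mulrA.
have cs2 t : cos t ^+ 2 = 1 - sin t ^+ 2 :> R by rewrite -(cos2Dsin2 t); ring.
have cFP t : continuous (fun w => F (P t w)) by exact: ctcomp cF (cP t).
case: (unliftP ord0 j) => [j' ->|->]; last first.
  (* Along the polar axis the integrand is the derivative of - sin^(m+1) G, where G is the integral
     of F over the parallel at angle t; the sine vanishes at both poles. *)
  pose G t := sphere_int (fun w => 1 * F (P t w)).
  pose G' t := sphere_int (fun w => 1 * B t w).
  have DG (t : R) : is_derive t (1 : R) G (G' t) := polar_derive (@ctC _ R 1) cF D cD t.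
  have DK t := dmul (dpow m.+1 (is_derive_sin t)) (DG t).
  have E t : sin t ^+ m * sphere_int (fun w => DF ord0 (P t w)
      - P t w 0 ord0 * (\sum_(l < m.+2) P t w 0 l * DF l (P t w))
      - m.+1%:R * (P t w 0 ord0 * F (P t w)))
    = - (m.+1%:R * sin t ^+ m * cos t * G t + sin t ^+ m.+1 * G' t).
    rewrite (@sphere_eq _ _ _ (fun w => - sin t * (1 * B t w) + - (m.+1%:R * cos t) * (1 * F (P t w)))); last first.
      move=> w; rewrite SgE {1 3}/P consv0 /B.
      have H := cs2 t; move: (DF ord0 (P t w)) (Sg t w) (F (P t w)) => d s f.
      rewrite (_ : d - cos t * (cos t * d + sin t * s) = d - cos t ^+ 2 * d - cos t * sin t * s); last by ring.
      by rewrite H; ring.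
    have c1 : continuous (fun w => 1 * B t w) by exact: ctM (@ctC _ R 1) (cB t).
    have c2 : continuous (fun w => 1 * F (P t w)) by exact: ctM (@ctC _ R 1) (cFP t).
    rewrite sphereD; [|exact: ctM (@ctC _ R _) c1|exact: ctM (@ctC _ R _) c2].
    by rewrite (sphereZ _ c1) (sphereZ _ c2) -/(G t) -/(G' t) exprS; ring.
  have cint := sphere_integrand_cont (f := fun y => DF ord0 y - y 0 ord0 * (\sum_(l < m.+2) y 0 l * DF l y) - m.+1%:R * (y 0 ord0 * F y)).
  have DK' (t : R) : is_derive t (1 : R) (fun t => - (sin t ^+ m.+1 * G t))
     (sin t ^+ m * sphere_int (fun w => DF ord0 (P t w)
      - P t w 0 ord0 * (\sum_(l < m.+2) P t w 0 l * DF l (P t w))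
      - m.+1%:R * (P t w 0 ord0 * F (P t w)))).
    by rewrite E; apply: dopp; exact: DK.
  rewrite (FTC (pi_ge0 R) _ DK').
    by rewrite sinpi sin0 expr0n /= !mul0r oppr0 subrr.
  apply: cint; apply: ctD; last first.
    by apply: ctN; apply: ctM; [exact: ctC|apply: ctM => //; apply: ct_coord; exact: ctI].
  apply: ctD => //; apply: ctN; apply: ctM; first by apply: ct_coord; exact: ctI.
  by apply: ctsum => l; apply: ctM => //; apply: ct_coord; exact: ctI.
(* Along the other axes the induction hypothesis on the parallel turns A into a multiple of g
   ([HA]), and the integrand becomes the derivative of sin^m cos g. *)
pose g t := sphere_int (fun w : 'rV[R]_m.+1 => w 0 j' * F (P t w)).
pose g' t := sphere_int (fun w : 'rV[R]_m.+1 => w 0 j' * B t w).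
pose A t := sphere_int (fun w => DF (lift ord0 j') (P t w) - w 0 j' * Sg t w).
have Dg (t : R) : is_derive t (1 : R) g (g' t) := polar_derive (cw j') cF D cD t.
have cA t : continuous (fun w => DF (lift ord0 j') (P t w) - w 0 j' * Sg t w).
  by apply: ctD; [exact: ctcomp (cD _) (cP t)|apply: ctN; exact: ctM (cw j') (cSg t)].
have cwF t : continuous (fun w : 'rV[R]_m.+1 => w 0 j' * F (P t w)) by exact: ctM (cw j') (cFP t).
have cwB t : continuous (fun w : 'rV[R]_m.+1 => w 0 j' * B t w) by exact: ctM (cw j') (cB t).
have HA t : sin t ^+ m * A t = m%:R * sin t ^+ m.-1 * g t.
  have [m0|m0] := posnP m.
    (* For m = 0 the induction hypothesis would give only [sin t * A t = 0]; that A t itself is 0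
       comes from w^2 = 1 on S^0. *)
    subst m.
    by rewrite expr0 mul1r !mul0r /A /sphere_int /Sg !big_ord1 (ord1 j') !mxE; ring.
  have := IHm (fun w => F (P t w)) (fun l w => sin t * DF (lift ord0 l) (P t w)) j' (cFP t) _ _.
  rewrite (@sphere_eq _ _ _ (fun w : 'rV[R]_m.+1 => sin t * (DF (lift ord0 j') (P t w) - w 0 j' * Sg t w) + - m%:R * (w 0 j' * F (P t w)))); last first.
    move=> w; rewrite (_ : \sum_(l < m.+1) w 0 l * (sin t * DF (lift ord0 l) (P t w)) = sin t * Sg t w); last first.
      by rewrite /Sg mulr_sumr; apply: eq_bigr => l _; rewrite mulrCA.
    by ring.
  rewrite sphereD; [|exact: ctM (@ctC _ R _) (cA t)|exact: ctM (@ctC _ R _) (cwF t)].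
  rewrite (sphereZ _ (cA t)) (sphereZ _ (cwF t)) -/(A t) -/(g t) => H.
  have {}H : sin t * A t = m%:R * g t.
    apply/eqP; rewrite -subr_eq0 -mulNr; apply/eqP; apply: H.
      by move=> i w; exact: is_derive_scaled.
    by move=> i; exact: ctM (@ctC _ R _) (ctcomp (cD _) (cP t)).
  by rewrite -[X in sin t ^+ X * _](prednK m0) exprSr -mulrA H; ring.
have E t : sin t ^+ m * sphere_int (fun w => DF (lift ord0 j') (P t w)
      - P t w 0 (lift ord0 j') * (\sum_(l < m.+2) P t w 0 l * DF l (P t w))
      - m.+1%:R * (P t w 0 (lift ord0 j') * F (P t w)))
  = (m%:R * sin t ^+ m.-1 * cos t * cos t + sin t ^+ m * - sin t) * g t + sin t ^+ m * cos t * g' t.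
  rewrite (@sphere_eq _ _ _ (fun w => (DF (lift ord0 j') (P t w) - w 0 j' * Sg t w)
     + cos t * (w 0 j' * B t w) + - (m.+1%:R * sin t) * (w 0 j' * F (P t w)))); last first.
    move=> w; rewrite SgE {2 3}/P consvS mxE /B.
    have H := cs2 t; move: (DF ord0 (P t w)) (DF (lift ord0 j') (P t w)) (Sg t w) (F (P t w)) (w 0 j') => d e s f wj.
    rewrite (_ : cos t * (wj * (- sin t * d + cos t * s)) = - cos t * wj * sin t * d + cos t ^+ 2 * (wj * s)); last by ring.
    by rewrite H; ring.
  rewrite sphereD; last exact: ctM (@ctC _ R _) (cwF t).
    rewrite sphereD; [|exact: cA|exact: ctM (@ctC _ R _) (cwB t)].
    rewrite (sphereZ _ (cwB t)) (sphereZ _ (cwF t)) -/(A t) -/(g t) -/(g' t).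
    rewrite !mulrDr HA.
    rewrite (_ : m%:R * sin t ^+ m.-1 * cos t * cos t = m%:R * sin t ^+ m.-1 * cos t ^+ 2); last by ring.
    rewrite cs2; move: (g t) (g' t) => gg gg'.
    case: (m) => [|l]; first by rewrite expr0; ring.
    by rewrite -[l.+1.-1]/l !exprS -!natr1; ring.
  by apply: ctD; [exact: cA|exact: ctM (@ctC _ R _) (cwB t)].
have DK' (t : R) : is_derive t (1 : R) (fun t => sin t ^+ m * cos t * g t)
   (sin t ^+ m * sphere_int (fun w => DF (lift ord0 j') (P t w)
    - P t w 0 (lift ord0 j') * (\sum_(l < m.+2) P t w 0 l * DF l (P t w))
    - m.+1%:R * (P t w 0 (lift ord0 j') * F (P t w)))).
  by rewrite E; exact: (dmul (dmul (dpow m (is_derive_sin t)) (is_derive_cos t)) (Dg t)).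
(* For m = 0 the power of the sine is 1; at a pole the contributions of the two points of S^0 to g
   cancel instead. *)
have B0 t : sin t = 0 -> sin t ^+ m * cos t * g t = 0.
  move=> s0; have [m0|m0] := posnP m; last by rewrite s0 expr0n gtn_eqF // !mul0r.
  subst m; rewrite /g /sphere_int /P s0 !scale0r !mxE; ring.
rewrite (FTC (pi_ge0 R) _ DK'); first by rewrite !B0 ?subrr ?sin0 ?sinpi.
have cint := sphere_integrand_cont (f := fun y => DF (lift ord0 j') y - y 0 (lift ord0 j') * (\sum_(l < m.+2) y 0 l * DF l y) - m.+1%:R * (y 0 (lift ord0 j') * F y)).
apply: cint; apply: ctD; last first.
  by apply: ctN; apply: ctM; [exact: ctC|apply: ctM => //; apply: ct_coord; exact: ctI].
apply: ctD => //; apply: ctN; apply: ctM; first by apply: ct_coord; exact: ctI.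
by apply: ctsum => l; apply: ctM => //; apply: ct_coord; exact: ctI.
Qed.

End Tangential.

(** * The Euler-Poisson-Darboux equation *)

Section Smooth.
Context {R : realType}.

Definition smooth (V : normedModType R) (A : set V) (f : V -> R) := forall k, Ck A k f.

Lemma smooth_cont (V : normedModType R) (A : set V) f : smooth A f -> continuous f.
Proof. by move=> /(_ 0%N); exact: Ck_continuous. Qed.

Lemma smooth_is_derive (V : normedModType R) (A : set V) f v x :
  smooth A f -> A v -> is_derive x v f ('D_v f x).
Proof. by move=> /(_ 1%N) Cf Av; exact: Ck_is_derive Cf Av. Qed.

Lemma smooth_derive (V : normedModType R) (A : set V) f v :
  smooth A f -> A v -> smooth A ('D_v f).
Proof. by move=> Sf Av k; exact: Ck_derive (Sf k.+1) Av. Qed.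

Lemma smooth_affine {V W : normedModType R} (A : set V) (B : set W) (F : V -> R) (L : W -> V) :
  continuous L ->
  (forall b, B b -> exists2 v, A v & forall z (h : R), L (z + h *: b) = L z + h *: v) ->
  smooth A F -> smooth B (fun z => F (L z)).
Proof. by move=> cL HL SF k; exact: Ck_affine cL HL (SF k). Qed.

Lemma derive_affine {V W : normedModType R} (A : set V) (F : V -> R) (L : W -> V) v b z :
  smooth A F -> A v -> (forall z (h : R), L (z + h *: b) = L z + h *: v) ->
  'D_b (fun z => F (L z)) z = 'D_v F (L z).
Proof.
move=> SF Av HL; apply: derive_at; apply: dlineP; under eq_fun do rewrite HL.
by apply: dline; rewrite scale0r addr0; exact: smooth_is_derive SF Av.
Qed.

End Smooth.

Section EPD.
Context {R : realType} {n : nat}.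
Local Notation axes := (@spacetime_axes R n).
Local Notation dt := (time_dir n : 'rV[R]_n * R).
Implicit Types (w : 'rV[R]_n * R -> R).

(** The Euler-Poisson-Darboux equation w_rr + (m/r) w_r = Delta w, multiplied by r so that it makes
    sense at r = 0. *)
Definition EPD (m : nat) w := forall p, p.2 * 'D_dt ('D_dt w) p + m%:R * 'D_dt w p = p.2 * laplacian_x w p.

(** This is r^(1-c) d/dr (r^c w), free of negative powers of r. *)
Definition euler_op (c : R) w : 'rV[R]_n * R -> R := fun p => c * w p + p.2 * 'D_dt w p.

Lemma smooth_time_coord : smooth axes (fun p : 'rV[R]_n * R => p.2).
Proof.
move=> k; apply: (@Ck_linear _ _ _ _ _ (fun p : 'rV[R]_n * R => p.2)) => //.
by apply: ctsnd; exact: ctI.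
Qed.

Lemma smooth_euler c w : smooth axes w -> smooth axes (euler_op c w).
Proof.
move=> Sw k; apply: CkD; first exact: CkZ.
by apply: CkM; [exact: smooth_time_coord|exact: smooth_derive Sw (time_axis) k].
Qed.

Lemma smooth_laplacian w : smooth axes w -> smooth axes (laplacian_x w).
Proof.
move=> Sw k; apply: Ck_sum => i.
exact: smooth_derive (smooth_derive Sw (space_axis i)) (space_axis i) k.
Qed.

Lemma laplacian_is_derive w v p : smooth axes w -> axes v ->
  is_derive p v (laplacian_x w) (\sum_(i < n) 'D_v ('D_(space_dir i) ('D_(space_dir i) w)) p).
Proof.
move=> Sw Av; apply: dsum => i; apply: smooth_is_derive Av.
exact: smooth_derive (smooth_derive Sw (space_axis i)) (space_axis i).
Qed.

Lemma is_derive_time_coord p : is_derive p dt (fun p => p.2) 1.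
Proof.
apply: dlineP => /=; have H := dadd (dcst p.2 (0 : R) (1 : R)) (is_derive_id (0 : R) (1 : R)).
by rewrite add0r in H; under eq_fun do rewrite scaleR1.
Qed.

Lemma is_derive_space_coord p i : is_derive p (space_dir i) (fun p : 'rV[R]_n * R => p.2) 0.
Proof. by apply: dlineP => /=; under eq_fun do rewrite scaler0 addr0; exact: dcst. Qed.

Local Opaque time_dir space_dir basis_vec.

Lemma laplacian_time w p : smooth axes w -> laplacian_x ('D_dt w) p = 'D_dt (laplacian_x w) p.
Proof.
move=> Sw; rewrite (derive_at (laplacian_is_derive p Sw time_axis)).
apply: eq_bigr => i _.
have E1 := schwarz (space_axis i) time_axis (Sw 2%N).
have E2 := schwarz (space_axis i) time_axis (smooth_derive Sw (space_axis i) 2).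
refine (eq_trans (congr1 (fun f => 'D_(space_dir i) f p) E1) _).
exact (congr1 (fun f => f p) E2).
Qed.

Lemma derive_space_euler c w i : smooth axes w ->
  'D_(space_dir i) (euler_op c w) = euler_op c ('D_(space_dir i) w).
Proof.
move=> Sw; apply/funext => p; apply: derive_at.
have D1 := smooth_is_derive p Sw (space_axis i).
have D2 := smooth_is_derive p (smooth_derive Sw time_axis) (space_axis i).
apply: (is_derive_eq (dadd (dcmul c D1) (dmul (is_derive_space_coord p i) D2))).
have H (a b r x y : R) : x = y -> a + (0 * b + r * x) = a + r * y by move=> ->; rewrite mul0r add0r.
exact (H _ _ _ _ _ (congr1 (fun f => f p) (schwarz (space_axis i) time_axis (Sw 2%N)))).
Qed.

Lemma laplacian_euler c w p : smooth axes w ->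
  laplacian_x (euler_op c w) p = c * laplacian_x w p + p.2 * laplacian_x ('D_dt w) p.
Proof.
move=> Sw; rewrite /laplacian_x !mulr_sumr -big_split /=; apply: eq_bigr => i _.
have Si := smooth_derive Sw (space_axis i).
have E0 := eq_trans (congr1 (fun f => 'D_(space_dir i) f) (derive_space_euler c i Sw))
  (derive_space_euler c i Si).
have E1 := schwarz (space_axis i) time_axis (Sw 2%N).
have E2 := schwarz (space_axis i) time_axis (Si 2%N).
have E3 := eq_trans (congr1 (fun f => 'D_(space_dir i) f p) E1) (congr1 (fun f => f p) E2).
refine (eq_trans (congr1 (fun f => f p) E0) _).
exact (congr1 (fun z => c * 'D_(space_dir i) ('D_(space_dir i) w) p + p.2 * z) (esym E3)).
Qed.

Lemma euler_time m w p : smooth axes w -> EPD m.+2 w ->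
  is_derive p dt (euler_op m.+1%:R w) (p.2 * laplacian_x w p).
Proof.
move=> Sw Ew.
have D1 := smooth_is_derive p Sw time_axis.
have D2 := smooth_is_derive p (smooth_derive Sw time_axis) time_axis.
apply: (is_derive_eq (dadd (dcmul m.+1%:R D1) (dmul (is_derive_time_coord p) D2))).
rewrite -Ew -[m.+2]addn1 natrD; ring.
Qed.

(** By [euler_time] the image E satisfies E_r = r Delta w, so r E_rr + m E_r = r ((m + 1) Delta w +
    r Delta w_r) = r Delta E. *)
Lemma EPD_euler m w : smooth axes w -> EPD m.+2 w -> EPD m (euler_op m.+1%:R w).
Proof.
move=> Sw Ew p.
have E1 : 'D_dt (euler_op m.+1%:R w) = (fun p => p.2 * laplacian_x w p).
  by apply/funext => q; exact: derive_at (euler_time q Sw Ew).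
have D2 := dmul (is_derive_time_coord p) (laplacian_is_derive p Sw time_axis).
rewrite E1 (derive_at D2) (laplacian_euler _ _ Sw) (laplacian_time _ Sw).
rewrite (derive_at (laplacian_is_derive p Sw time_axis)) (derive_at (euler_time p Sw Ew)) -natr1; ring.
Qed.

(* [d/dr ((1/r) d/dr)^j] applied to [r^(2j+1) w], rewritten without division by [r]. *)
Fixpoint vop j w := if j is j'.+1 then vop j' (euler_op (2 * j' + 3)%:R w) else euler_op 1 w.

Lemma smooth_vop j w : smooth axes w -> smooth axes (vop j w).
Proof. by elim: j w => [|j IHj] w Sw; [exact: smooth_euler|apply: IHj; exact: smooth_euler]. Qed.

(** Each of the j + 1 Euler operators lowers the index by two. For the last one, [euler_time] shows
    that the r-derivative is r times a Laplacian, hence 0 at r = 0. *)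
Lemma vop_wave j w : smooth axes w -> EPD (2 * j + 2) w ->
  EPD 0 (vop j w) /\ forall x, 'D_dt (vop j w) (x, 0) = 0.
Proof.
elim: j w => [|j IHj] w Sw Ew.
  split; first exact: (EPD_euler Sw Ew).
  by move=> x; rewrite (derive_at (euler_time (x, 0) Sw Ew)) mul0r.
have e : (2 * j.+1 + 2 = (2 * j + 2).+2)%N by lia.
rewrite e in Ew; apply: IHj; first exact: smooth_euler.
have := EPD_euler Sw Ew; by have -> : (2 * j + 2).+1 = (2 * j + 3)%N by lia.
Qed.

(** At r = 0 an Euler operator multiplies by its constant; the product of these constants is the
    normalisation [c0]. *)
Lemma vop0 j w x : vop j w (x, 0) = (\prod_(i < j.+1) (2 * i + 1)%:R) * w (x, 0).
Proof.
elim: j w => [|j IHj] w; first by rewrite big_ord1 /= /euler_op mul0r addr0.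
rewrite -[vop j.+1 w]/(vop j (euler_op (2 * j + 3)%:R w)) IHj [in RHS]big_ord_recr /= /euler_op mul0r addr0 mulrA.
by have -> : (2 * j + 3 = 2 * j.+1 + 1)%N by lia.
Qed.

(** Division by r gives the equation for r != 0, and continuity in r extends it to r = 0. *)
Lemma EPD0_wave w p : smooth axes w -> EPD 0 w -> 'D_dt ('D_dt w) p = laplacian_x w p.
Proof.
move=> Sw Ew; case: p => x r.
have [->|r0] := eqVneq r 0; last first.
  by have := Ew (x, r); rewrite mul0r addr0 => /(mulfI r0).
pose h s := 'D_dt ('D_dt w) (x, s) - laplacian_x w (x, s).
have ch : continuous h.
  apply: ctD; last (apply: ctN).
    exact: cont_pair (smooth_cont (smooth_derive (smooth_derive Sw time_axis) time_axis)).
  exact: cont_pair (smooth_cont (smooth_laplacian Sw)).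
have h0 s : s != 0 -> h s = 0.
  move=> s0; rewrite /h; apply/eqP; rewrite subr_eq0; apply/eqP.
  by have := Ew (x, s); rewrite mul0r addr0 => /(mulfI s0).
suff : h 0 = 0 by move=> /eqP; rewrite subr_eq0 => /eqP.
clearbody h.
have c1 : h s @[s --> 0^'] --> h 0 by apply: cvg_within_filter; exact: ch.
have c2 : h s @[s --> 0^'] --> (0 : R).
  apply: (@cvg_trans _ (cst (0 : R) @ 0^')); last exact: cvg_cst.
  by apply: near_eq_cvg; near=> s; rewrite h0 //; near: s; exact: nbhs_dnbhs_neq.
exact: (cvg_unique _ c1 c2).
Unshelve. all: by end_near. Qed.

(** From (1/r) d/dr (r^(e+2) w) = r^e ((e + 2) w + r w_r) with e = 2j + 1, each factor (1/r) d/dr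
    costs two powers of r and applies one Euler operator. *)
Lemma radial_vop j w x r : smooth axes w ->
  radial_op j (fun r => r ^+ (2 * j + 1) * w (x, r)) r = vop j w (x, r).
Proof.
have D u s q : smooth axes u -> is_derive s (1 : R) (fun s => s ^+ q * u (x, s))
    (q%:R * s ^+ q.-1 * 1 * u (x, s) + s ^+ q * 'D_dt u (x, s)).
  move=> Su; apply: dmul; first exact: (dpow q (is_derive_id s (1 : R))).
  exact: is_derive_time (smooth_is_derive (x, s) Su time_axis).
elim: j w => [|j IHj] w Sw.
  rewrite /radial_op /= derive1E (derive_at (D w r 1%N Sw)) /euler_op /= expr0 expr1; ring.
have E : (fun s => s^-1 * derive1 (fun r => r ^+ (2 * j.+1 + 1) * w (x, r)) s) =
    (fun s => s ^+ (2 * j + 1) * euler_op (2 * j + 3)%:R w (x, s)).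
  have -> : (2 * j.+1 + 1 = (2 * j + 1).+2)%N by lia.
  have -> : (2 * j + 3 = (2 * j + 1).+2)%N by lia.
  have e0 : (0 < 2 * j + 1)%N by rewrite addn1.
  move: (2 * j + 1)%N e0 => e e0; apply/funext => s.
  rewrite derive1E (derive_at (D w s _ Sw)) succnK.
  (* At s = 0 the left side is 0 because 0^-1 = 0, the right side because the exponent e is
     positive. *)
  have [->|s0] := eqVneq s 0; first by rewrite invr0 mul0r expr0n gtn_eqF // mul0r.
  by rewrite /euler_op /= !exprS; field.
rewrite -[vop j.+1 w]/(vop j (euler_op (2 * j + 3)%:R w)) -IHj; last exact: smooth_euler.
by rewrite -E /radial_op iterSr.
Qed.

End EPD.

(** * Spherical means *)

Section Means.
Context {R : realType}.

Lemma dlin (V : normedModType R) (f : V -> R) (x v : V) (c : R) :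
  (forall h : R, f (x + h *: v) = f x + h * c) -> is_derive x v f c.
Proof.
move=> H; apply: dlineP; under eq_fun do rewrite H.
have D : is_derive (0 : R) (1 : R) (fun h : R => f x + h * c) (0 + (1 * c + 0 * 0)).
  exact: (dadd (dcst _ _ _) (dmul (is_derive_id _ _) (dcst _ _ _))).
by move: D; rewrite mul0r addr0 mul1r add0r.
Qed.

Section Mean.
Variable k : nat.
Local Notation E := 'rV[R]_k.+1.
Local Notation axes := (@spacetime_axes R k.+1).
Local Notation dt := (time_dir k.+1 : E * R).
Local Notation bas := (range (@basis_vec R k.+1)).

(** The weight p is 1 for the mean itself; coordinates y_l appear as weights in its r-derivative. *)
Definition sph_mean (p g : E -> R) (z : E * R) : R := sphere_int (fun y => p y * g (z.1 + z.2 *: y)).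

Let pt (q : (E * R) * E) : E := q.1.1 + q.1.2 *: q.2.

Let ct_pt : continuous pt.
Proof.
apply: ctD; first by apply: ctfst; apply: ctfst; exact: ctI.
by apply: ctZ; [apply: ctsnd; apply: ctfst|apply: ctsnd]; exact: ctI.
Qed.

Lemma smooth_sph_mean (p g : E -> R) : continuous p -> smooth bas g -> smooth axes (sph_mean p g).
Proof.
move=> cp Sg l; apply: (@Ck_sphere _ _ _ _ _ (fun q : (E * R) * E => p q.2 * g (pt q))).
have inv b : paxes E axes b -> b.2 = 0 by move=> [v _ <-].
apply: CkM.
  apply: (@Ck_linear _ _ _ _ (fun q : (E * R) * E => p q.2) (fun=> 0)).
    by apply: ctcomp cp _; apply: ctsnd; exact: ctI.
  by move=> v /inv v0 q h /=; rewrite v0 scaler0 addr0 mulr0 addr0.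
apply: Ck_compN => // i.
have -> : (fun q => pt q 0 i) = (fun q : (E * R) * E => q.1.1 0 i + q.1.2 * q.2 0 i).
  by apply/funext => q; rewrite !mxE.
apply: CkD.
  apply: (@Ck_linear _ _ _ _ (fun q : (E * R) * E => q.1.1 0 i) (fun q => q.1.1 0 i)).
    by apply: ct_coord; apply: ctfst; apply: ctfst; exact: ctI.
  by move=> v _ q h /=; rewrite !mxE.
apply: CkM.
  apply: (@Ck_linear _ _ _ _ (fun q : (E * R) * E => q.1.2) (fun q => q.1.2)) => //.
  by apply: ctsnd; apply: ctfst; exact: ctI.
apply: (@Ck_linear _ _ _ _ (fun q : (E * R) * E => q.2 0 i) (fun q => q.2 0 i)).
  by apply: ct_coord; apply: ctsnd; exact: ctI.
by move=> v _ q h /=; rewrite !mxE.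
Qed.

Let basE i : bas (basis_vec i). Proof. by exists i. Qed.

Let smooth_D g i : smooth bas g -> smooth bas ('D_(basis_vec i) g).
Proof. by move=> Sg; exact: smooth_derive Sg (basE i). Qed.

Let ct_gpt g : smooth bas g -> continuous (fun q => g (pt q)).
Proof. by move=> Sg; exact: ctcomp (smooth_cont Sg) ct_pt. Qed.

Let ct_p2 (p : E -> R) : continuous p -> continuous (fun q : (E * R) * E => p q.2).
Proof. by move=> cp; apply: ctcomp cp _; apply: ctsnd; exact: ctI. Qed.

Let dpt (g : E -> R) v (q : (E * R) * E) : smooth bas g ->
  is_derive q v (fun q => g (pt q))
    (\sum_(l < k.+1) (v.1.1 0 l + (v.1.2 * q.2 0 l + q.1.2 * v.2 0 l)) * 'D_(basis_vec l) g (pt q)).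
Proof.
move=> Sg; apply: (dchain (DF := fun i => 'D_(basis_vec i) g)).
- by move=> i z; exact: smooth_is_derive Sg (basE i).
- by move=> i; exact: smooth_cont (smooth_D i Sg).
move=> i.
have -> : (fun q => pt q 0 i) = (fun q : (E * R) * E => q.1.1 0 i + q.1.2 * q.2 0 i).
  by apply/funext => z; rewrite !mxE.
apply: dadd; first by apply: dlin => h /=; rewrite !mxE.
by apply: dmul; apply: dlin => h /=; rewrite ?mxE.
Qed.

Lemma sph_mean_time (p g : E -> R) z : continuous p -> smooth bas g ->
  is_derive z dt (sph_mean p g)
    (sphere_int (fun y => p y * \sum_(l < k.+1) y 0 l * 'D_(basis_vec l) g (z.1 + z.2 *: y))).
Proof.
move=> cp Sg.
apply: (@sphere_derive _ _ _ (fun q : (E * R) * E => p q.2 * g (pt q))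
  (fun q : (E * R) * E => p q.2 * \sum_(l < k.+1) q.2 0 l * 'D_(basis_vec l) g (pt q))).
- exact: ctM (ct_p2 cp) (ct_gpt Sg).
- apply: ctM; first exact: ct_p2.
  apply: ctsum => l; apply: ctM; last exact: ct_gpt (smooth_D l Sg).
  by apply: ct_coord; apply: ctsnd; exact: ctI.
move=> q y.
have D1 : is_derive (q, y) (dt, 0 : E) (fun q : (E * R) * E => p q.2) 0.
  by apply: dlin => h /=; rewrite scaler0 addr0 mulr0 addr0.
apply: (is_derive_eq (dmul D1 (dpt _ _ Sg))); rewrite mul0r add0r; congr (_ * _).
by apply: eq_bigr => l _; rewrite /= !mxE mulr0 addr0 add0r mul1r.
Qed.

Lemma sph_mean_space (p g : E -> R) z i : continuous p -> smooth bas g ->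
  is_derive z (space_dir i) (sph_mean p g) (sph_mean p ('D_(basis_vec i) g) z).
Proof.
move=> cp Sg.
apply: (@sphere_derive _ _ _ (fun q : (E * R) * E => p q.2 * g (pt q))
  (fun q : (E * R) * E => p q.2 * 'D_(basis_vec i) g (pt q))).
- exact: ctM (ct_p2 cp) (ct_gpt Sg).
- exact: ctM (ct_p2 cp) (ct_gpt (smooth_D i Sg)).
move=> q y.
have D1 : is_derive (q, y) (space_dir i : E * R, 0 : E) (fun q : (E * R) * E => p q.2) 0.
  by apply: dlin => h /=; rewrite scaler0 addr0 mulr0 addr0.
apply: (is_derive_eq (dmul D1 (dpt _ _ Sg))); rewrite mul0r add0r; congr (_ * _).
rewrite (bigD1 i) //= big1 => [|l li].
  by rewrite basis_vecE eqxx mul0r add0r !mxE mulr0 !addr0 mul1r.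
by rewrite basis_vecE (negbTE li) mul0r add0r !mxE mulr0 addr0 mul0r.
Qed.

(** Apply [tangential] to y -> D_j f (x + r y), whose partial derivatives are r D_l D_j f (x + r y),
    and sum over j: the three terms are r Delta w, r w_rr and k w_r. *)
Lemma sph_mean_EPD (f : E -> R) : smooth bas f -> EPD k (sph_mean (fun=> 1) f).
Proof.
move=> Sf z.
have c1 : continuous (fun _ : E => 1 : R) by exact: ctC.
have cy l : continuous (fun y : E => y 0 l) by apply: ct_coord; exact: ctI.
have cD (g : E -> R) : smooth bas g -> continuous (fun y => g (z.1 + z.2 *: y)).
  move=> Sg; apply: ctcomp (smooth_cont Sg) _.
  by apply: ctD; [exact: ctC|apply: ctZ; [exact: ctC|exact: ctI]].
have Et : 'D_dt (sph_mean (fun=> 1) f) =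
    (fun z => \sum_(l < k.+1) sph_mean (fun y => y 0 l) ('D_(basis_vec l) f) z).
  apply/funext => q; rewrite (derive_at (sph_mean_time q c1 Sf)) /sph_mean -sphere_sum.
    by apply: sphere_eq => y; rewrite mul1r.
  move=> l; apply: ctM => //; apply: ctcomp (smooth_cont (smooth_D l Sf)) _.
  by apply: ctD; [exact: ctC|apply: ctZ; [exact: ctC|exact: ctI]].
have Dtt := dsum (fun l => sph_mean_time z (cy l) (smooth_D l Sf)).
have Et1 := congr1 (fun g => g z) Et; rewrite /= in Et1.
rewrite Et1 Et (derive_at Dtt).
have -> : laplacian_x (sph_mean (fun=> 1) f) z =
    \sum_(l < k.+1) sph_mean (fun=> 1) ('D_(basis_vec l) ('D_(basis_vec l) f)) z.
  apply: eq_bigr => l _.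
  have -> : 'D_(space_dir l) (sph_mean (fun=> 1) f) = sph_mean (fun=> 1) ('D_(basis_vec l) f).
    by apply/funext => q; exact: derive_at (sph_mean_space q l c1 Sf).
  exact: derive_at (sph_mean_space z l c1 (smooth_D l Sf)).
rewrite !mulr_sumr -big_split /=; apply: eq_bigr => j _.
have Sj := smooth_D j Sf.
have := @tangential _ k (fun y => 'D_(basis_vec j) f (z.1 + z.2 *: y))
  (fun l y => z.2 * 'D_(basis_vec l) ('D_(basis_vec j) f) (z.1 + z.2 *: y)) j (cD _ Sj) _ _.
have cS : continuous (fun y : E => \sum_(l < k.+1) y 0 l * 'D_(basis_vec l) ('D_(basis_vec j) f) (z.1 + z.2 *: y)).
  by apply: ctsum => l; exact: ctM (cy l) (cD _ (smooth_D l Sj)).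
have cA : continuous (fun y => 1 * 'D_(basis_vec j) ('D_(basis_vec j) f) (z.1 + z.2 *: y)).
  exact: ctM c1 (cD _ (smooth_D j Sj)).
have cB := ctM (cy j) cS.
have cC := ctM (cy j) (cD _ Sj).
rewrite (@sphere_eq _ _ _ (fun y => z.2 * (1 * 'D_(basis_vec j) ('D_(basis_vec j) f) (z.1 + z.2 *: y))
   + - z.2 * (y 0 j * \sum_(l < k.+1) y 0 l * 'D_(basis_vec l) ('D_(basis_vec j) f) (z.1 + z.2 *: y))
   + - k%:R * (y 0 j * 'D_(basis_vec j) f (z.1 + z.2 *: y)))); last first.
  move=> y; rewrite (_ : \sum_(l < k.+1) y 0 l * (z.2 * 'D_(basis_vec l) ('D_(basis_vec j) f) (z.1 + z.2 *: y)) =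
    z.2 * \sum_(l < k.+1) y 0 l * 'D_(basis_vec l) ('D_(basis_vec j) f) (z.1 + z.2 *: y)); last first.
    by rewrite mulr_sumr; apply: eq_bigr => l _; rewrite mulrCA.
  by rewrite mul1r mulNr mulNr mulrCA.
have cs (c : R) (g : E -> R) : continuous g -> continuous (fun y : E => c * g y) by move=> cg; exact: ctM (@ctC _ R c) cg.
rewrite (sphereD (ctD (cs _ _ cA) (cs _ _ cB)) (cs _ _ cC)) (sphereD (cs _ _ cA) (cs _ _ cB)).
rewrite (sphereZ _ cA) (sphereZ _ cB) (sphereZ _ cC) => H.
have {}H := H _ _.
have H1 : forall (i : 'I_k.+1) (y : E), is_derive y (basis_vec i)
    (fun y => 'D_(basis_vec j) f (z.1 + z.2 *: y))
    (z.2 * 'D_(basis_vec i) ('D_(basis_vec j) f) (z.1 + z.2 *: y)).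
  move=> i y; apply: dlineP.
  have Eh (h : R) : z.1 + z.2 *: (y + h *: basis_vec i) = (z.1 + z.2 *: y) + (z.2 * h) *: basis_vec i.
    by rewrite scalerDr scalerA addrA.
  under eq_fun do rewrite Eh.
  have D1 : is_derive (z.2 * 0) (1 : R)
      (fun u : R => 'D_(basis_vec j) f ((z.1 + z.2 *: y) + u *: basis_vec i))
      ('D_(basis_vec i) ('D_(basis_vec j) f) (z.1 + z.2 *: y)).
    apply: (@dline _ _ ('D_(basis_vec j) f)); rewrite mulr0 scale0r addr0.
    exact: smooth_is_derive Sj (basE i).
  have := dcomp1 D1 (dcmul z.2 (is_derive_id (0 : R) (1 : R))).
  by rewrite mulr1 mulrC.
have H2 : forall i, continuous (fun y => z.2 * 'D_(basis_vec i) ('D_(basis_vec j) f) (z.1 + z.2 *: y)).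
  by move=> i; apply: cs; exact: cD (smooth_D i Sj).
have {H H1 H2} := H H1 H2.
rewrite /sph_mean; move: (sphere_int _) (sphere_int _) (sphere_int _) => a b c H.
apply/eqP; rewrite -subr_eq0; apply/eqP.
by rewrite -[RHS]oppr0 -H; ring.
Qed.

Lemma sph_mean0 (f : E -> R) x : sph_mean (fun=> 1) f (x, 0) = sphere_area k * f x.
Proof.
rewrite /sph_mean /sphere_area /= mulrC -sphereZ; last exact: ctC.
by apply: sphere_eq => y; rewrite scale0r addr0 mul1r mulr1.
Qed.

End Mean.
End Means.

(** * Weighted ball integrals as spherical integrals *)

(* The density of the polar angle is singular at the end points of ]- sigma, sigma[: the
   substitution a = sigma cos t is made on [arc_lo i, pi - arc_lo i], then i tends to infinity. *)
Definition arc_lo (R : realType) (i : nat) : R := pi / i.+2%:R.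

Section ArcLength.
Context {R : realType}.
Local Notation mu := (@lebesgue_measure R).
Variables (sigma : R) (s0 : 0 < sigma).

Local Notation a_ := (@arc_lo R).
Local Notation b_ i := (pi - a_ i).
Let C t := sigma * cos t.

Let a_gt0 i : 0 < a_ i. Proof. by rewrite /arc_lo divr_gt0 // pi_gt0. Qed.

Let a_le i : a_ i <= pi / 2.
Proof. by rewrite /arc_lo ler_pM2l ?pi_gt0 // lef_pV2 ?posrE // ler_nat. Qed.

Let a_nincr i j : (i <= j)%N -> a_ j <= a_ i.
Proof. by move=> ij; rewrite /arc_lo ler_pM2l ?pi_gt0 // lef_pV2 ?posrE // ler_nat !ltnS. Qed.

Let a_small e : 0 < e -> exists i, a_ i < e.
Proof.
move=> e0; have := archi_boundP (ltW (divr_gt0 (pi_gt0 R) e0)).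
set k := Num.bound _ => H; exists k.
rewrite /arc_lo ltr_pdivrMr // mulrC -ltr_pdivrMr //; apply: lt_le_trans H _.
by rewrite ler_nat; apply: leqW; apply: leqnSn.
Qed.

Let cover : \bigcup_i [set` `[a_ i, b_ i]] = [set` `]0, pi[] :> set R.
Proof.
apply/seteqP; split=> t /=.
  move=> [i _] /=; rewrite !in_itv /= => /andP[h1 h2].
  by have := a_gt0 i; move=> h; apply/andP; split; lra.
rewrite in_itv /= => /andP[t0 tp].
have m0 : 0 < Num.min t (pi - t) by rewrite lt_min t0 subr_gt0.
have [i ai] := a_small m0; move: ai; rewrite lt_min => /andP[h1 h2].
by exists i => //=; rewrite in_itv /=; apply/andP; split; lra.
Qed.

Let C_decr : {in `[0, pi] &, {mono C : x y /~ y < x}}.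
Proof. by move=> x y xp yp; rewrite ltr_pM2l // ltr_cos. Qed.

Let C_decr_le : {in `[0, pi] &, {mono C : x y /~ y <= x}}.
Proof. by move=> x y xp yp; rewrite !leNgt C_decr. Qed.

Let C0 : C 0 = sigma. Proof. by rewrite /C cos0 mulr1. Qed.
Let Cpi : C pi = - sigma. Proof. by rewrite /C cospi mulrN1. Qed.

Let ab_sub i : {subset `[a_ i, b_ i] <= `[0, pi]}.
Proof.
move=> t; rewrite !in_itv /= => /andP[h1 h2]; have := a_gt0 i.
by move=> h; apply/andP; split; lra.
Qed.

Let ab_le i : a_ i <= b_ i. Proof. by have := a_le i; lra. Qed.

Let a_in i : a_ i \in `[0, pi].
Proof. by apply: (ab_sub (i := i)); rewrite in_itv /= lexx ab_le. Qed.

Let b_in i : b_ i \in `[0, pi].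
Proof. by apply: (ab_sub (i := i)); rewrite in_itv /= lexx ab_le. Qed.

Let in0 : (0 : R) \in `[0, pi]. Proof. by rewrite in_itv /= lexx pi_ge0. Qed.
Let inpi : (pi : R) \in `[0, pi]. Proof. by rewrite in_itv /= lexx pi_ge0. Qed.

Let coverC : \bigcup_i [set` `[C (b_ i), C (a_ i)]] = [set` `]- sigma, sigma[] :> set R.
Proof.
apply/seteqP; split=> x /=.
  move=> [i _] /=; rewrite !in_itv /= -Cpi -[X in _ && (_ < X)]C0 => /andP[h1 h2]; apply/andP; split.
    by apply: lt_le_trans h1; rewrite C_decr //; have := a_gt0 i; lra.
  by apply: le_lt_trans h2 _; rewrite C_decr.
rewrite in_itv /= => /andP[x1 x2].
have x11 : -1 <= x / sigma <= 1.
  by rewrite ler_pdivlMr // ler_pdivrMr // mulN1r mul1r !ltW.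
pose t := acos (x / sigma).
have tin : t \in `[0, pi] by rewrite in_itv /= acos_ge0 // acos_lepi.
have Ct : C t = x by rewrite /C acosK // mulrC divfK // gt_eqF.
have t0 : 0 < t by rewrite -C_decr // Ct C0.
have tp : t < pi by rewrite -C_decr // Ct Cpi.
have : (\bigcup_i [set` `[a_ i, b_ i]]) t by rewrite cover /= in_itv /= t0 tp.
move=> [i _ /=]; rewrite in_itv /= => /andP[h1 h2]; exists i => //=.
by rewrite in_itv /= -Ct !C_decr_le // h1 h2.
Qed.

Variables (k Q : R -> R).
Hypothesis ck : forall a, - sigma < a < sigma -> {for a, continuous k}.
Hypothesis cQ : continuous Q.
Hypothesis kQ : forall t, 0 < t < pi -> k (C t) * (sigma * sin t) = Q t.

Let DC (t : R) : is_derive t (1 : R) C (sigma * - sin t).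
Proof. by apply: dcmul; exact: is_derive_cos. Qed.

Let C' : derive1 C = (fun t => sigma * - sin t).
Proof. by apply/funext => t; rewrite derive1E (derive_at (DC t)). Qed.

Let cC : continuous C. Proof. by move=> t; apply: is_derive_continuous (DC t). Qed.

Let cC' : continuous (derive1 C).
Proof. by rewrite C'; apply: ctM; [exact: ctC|apply: ctN; apply: ct_sin; exact: ctI]. Qed.

Let within_k i : {within `[C (b_ i), C (a_ i)], continuous k}.
Proof.
apply: continuous_in_subspaceT => x; rewrite inE /= => xi; apply: ck.
have : (\bigcup_i [set` `[C (b_ i), C (a_ i)]]) x by exists i.
by rewrite coverC /= in_itv.
Qed.

Let piece i : (\int[mu]_(x in `[C (b_ i), C (a_ i)]) (k x)%:E = \int[mu]_(t in `[a_ i, b_ i]) (Q t)%:E)%E.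
Proof.
rewrite (@integration_by_substitution_decreasing _ C k (a_ i) (b_ i)) //.
- apply: eq_integral => t; rewrite inE /= => ti; congr (_%:E).
  have : (\bigcup_i [set` `[a_ i, b_ i]]) t by exists i.
  rewrite cover /= in_itv /= => tp.
  rewrite -(kQ tp) -[LHS]/(k (C t) * - derive1 C t) C'.
  by rewrite [sigma * - _]mulrN opprK.
- by move=> x y xi yi xy; rewrite C_decr //; apply: ab_sub; eassumption.
- by apply/cvg_ex; exists (derive1 C (a_ i)); apply: cvg_at_right_filter; exact: cC'.
- by apply/cvg_ex; exists (derive1 C (b_ i)); apply: cvg_at_left_filter; exact: cC'.
- split.
  + by move=> x _; exact: derivable_at (DC x).
  + by apply: cvg_at_right_filter; exact: cC.
  + by apply: cvg_at_left_filter; exact: cC.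
Qed.

(** Substitution is legitimate on each compact piece; both sides then converge by monotone
    convergence, for which the sign of k is used. *)
Lemma polar_substitution_ge0 : (forall a, - sigma < a < sigma -> 0 <= k a) ->
  (\int[mu]_(x in `](- sigma)%R, sigma%R[) (k x)%:E = \int[mu]_(t in `[0%R, pi]) (Q t)%:E)%E.
Proof.
move=> k0.
have Q0 t : 0 < t < pi -> 0 <= Q t.
  move=> /andP[t0 tp]; rewrite -kQ ?t0 // mulr_ge0 //.
    have tin : t \in `[0, pi] by rewrite in_itv /= !ltW.
    by apply: k0; apply/andP; split; [rewrite -Cpi|rewrite -[X in _ < X]C0]; rewrite C_decr.
  by rewrite mulr_ge0 ?(ltW s0) // sin_ge0_pi // !ltW.
have nnF1 : nondecreasing_seq (fun i => [set` `[C (b_ i), C (a_ i)]]).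
  apply/nondecreasing_seqP => i; apply/subsetPset => x /=; rewrite !in_itv /= => /andP[h1 h2].
  have h := a_nincr (leqnSn i); apply/andP; split.
    by apply: le_trans h1; rewrite C_decr_le // lerD2l lerN2.
  by apply: le_trans h2 _; rewrite C_decr_le.
have nnF2 : nondecreasing_seq (fun i => [set` `[a_ i, b_ i]]).
  apply/nondecreasing_seqP => i; apply/subsetPset => x /=; rewrite !in_itv /= => /andP[h1 h2].
  by have h := a_nincr (leqnSn i); apply/andP; split; lra.
have L1 := @ge0_nondecreasing_set_cvg_integral _ (measurableTypeR R) R _ (EFin \o k) mu nnF1 _ _ _.
have L2 := @ge0_nondecreasing_set_cvg_integral _ (measurableTypeR R) R _ (EFin \o Q) mu nnF2 _ _ _.
rewrite coverC in L1; rewrite cover in L2.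
rewrite -(@integral_itv_bndo_bndc _ (BLeft 0) pi (EFin \o Q)); last first.
  by apply/measurable_realfun.measurable_EFinP; apply: measurable_funTS; exact: measurable_realfun.continuous_measurable_fun.
rewrite -(@integral_itv_obnd_cbnd _ 0 (BLeft pi) (EFin \o Q)); last first.
  by apply/measurable_realfun.measurable_EFinP; apply: measurable_funTS; exact: measurable_realfun.continuous_measurable_fun.
apply: (cvg_unique _ (L1 _ _ _)) => //.
- move=> i; apply/measurable_realfun.measurable_EFinP; apply: measurable_realfun.subspace_continuous_measurable_fun => //; exact: within_k.
- move=> i x xi; rewrite lee_fin; apply: k0.
  have : (\bigcup_i [set` `[C (b_ i), C (a_ i)]]) x by exists i.
  by rewrite coverC /= in_itv.
have -> : (fun i => \int[mu]_(x in `[C (b_ i), C (a_ i)]) (EFin \o k) x)%E =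
    (fun i => \int[mu]_(t in `[a_ i, b_ i]) (EFin \o Q) t)%E by apply/funext => i; exact: piece.
apply: L2 => //.
- by move=> i; apply/measurable_realfun.measurable_EFinP; apply: measurable_funTS; exact: measurable_realfun.continuous_measurable_fun.
- move=> i x xi; rewrite lee_fin; apply: Q0.
  have : (\bigcup_i [set` `[a_ i, b_ i]]) x by exists i.
  by rewrite cover /= in_itv.
Qed.

End ArcLength.

Section ArcLengthSigned.
Context {R : realType}.
Local Notation mu := (@lebesgue_measure R).

(** Positive and negative parts are transformed separately; taking them commutes with the
    nonnegative Jacobian sigma sin t. *)
Lemma polar_substitution (sigma : R) (k Q : R -> R) : 0 < sigma ->
  (forall a, - sigma < a < sigma -> {for a, continuous k}) -> continuous Q ->
  (forall t, 0 < t < pi -> k (sigma * cos t) * (sigma * sin t) = Q t) ->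
  \int[mu]_(x in `]- sigma, sigma[) k x = \int[mu]_(t in `[0, pi]) Q t.
Proof.
move=> s0 ck cQ kQ.
have cmax (f : R -> R) a : {for a, continuous f} -> {for a, continuous (fun x => Num.max (f x) 0)}.
  have E x : Num.max (f x) 0 = (f x + `|f x|) / 2.
    by case: (leP (f x) 0) => h; [rewrite ler0_norm // subrr mul0r|rewrite gtr0_norm //; lra].
  have -> : (fun x => Num.max (f x) 0) = (fun x => (f x + `|f x|) / 2) by apply/funext.
  by move=> cf; apply: cvgM; [apply: cvgD; [exact: cf|apply: cvg_norm; exact: cf]|exact: cvg_cst].
have cN (f : R -> R) a : {for a, continuous f} -> {for a, continuous (fun x => - f x)}.
  by move=> cf; apply: cvgN; exact: cf.
have sp t : 0 < t < pi -> 0 <= sigma * sin t.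
  by move=> /andP[t0 tp]; rewrite mulr_ge0 ?(ltW s0) // sin_ge0_pi // !ltW.
have H1 := @polar_substitution_ge0 _ sigma s0 (fun x => Num.max (k x) 0) (fun x => Num.max (Q x) 0)
  (fun a ha => cmax _ _ (ck a ha)) (fun t => cmax _ t (cQ t)) _ _.
have H2 := @polar_substitution_ge0 _ sigma s0 (fun x => Num.max (- k x) 0) (fun x => Num.max (- Q x) 0)
  (fun a ha => cmax _ _ (cN _ _ (ck a ha))) (fun t => cmax _ t (cN _ _ (cQ t))) _ _.
have intQ (q : R -> R) : continuous q ->
    (\int[mu]_(t in `[0%R, pi]) (q t)%:E = (\int[mu]_(t in `[0%R, pi]) q t)%R%:E)%E.
  by move=> cq; rewrite fineK // integrable_fin_num //; exact: cont_integrable.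
have cp : continuous (fun t => Num.max (Q t) 0) by move=> t; exact: cmax (cQ t).
have cm : continuous (fun t => Num.max (- Q t) 0) by move=> t; exact: cmax (cN _ _ (cQ t)).
rewrite /Rintegral integralE.
have -> : ((fun x => (k x)%:E) ^\+)%E = (fun x => (Num.max (k x) 0)%:E) :> (R -> \bar R).
  by apply/funext => x; rewrite funeposE EFin_max.
have -> : ((fun x => (k x)%:E) ^\-)%E = (fun x => (Num.max (- k x) 0)%:E) :> (R -> \bar R).
  by apply/funext => x; rewrite funenegE EFin_max.
rewrite H1; last 2 first.
- by move=> t tp; rewrite -kQ // maxr_pMl ?mul0r // sp.
- by move=> a _; rewrite le_max lexx orbT.
rewrite H2; last 2 first.
- by move=> t tp; rewrite -kQ // -mulNr maxr_pMl ?mul0r // sp.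
- by move=> a _; rewrite le_max lexx orbT.
rewrite (intQ _ cp) (intQ _ cm) -EFinB /= -intB //.
apply: int_eq => t _; case: (leP (Q t) 0) => h.
  by rewrite sub0r max_l ?opprK // oppr_ge0.
by rewrite max_r ?subr0 // oppr_le0 ltW.
Qed.

End ArcLengthSigned.

Section VolumeSphere.
Context {R : realType}.
Local Notation mu := (@lebesgue_measure R).

(** The projection of S^n onto the unit ball of R^n. The last coordinate is the one dropped, so that
    the recursions of [sphere_int] and [volume_int], both on the first coordinate, stay in step. *)
Definition init_rv n (w : 'rV[R]_n.+1) : 'rV[R]_n := \row_i w 0 (lift ord_max i).

Lemma init_consv n a (w : 'rV[R]_n.+1) : init_rv (consv a w) = consv a (init_rv w).
Proof.
apply/rowP => j; rewrite [LHS]mxE; case: (unliftP ord0 j) => [i ->|->].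
  rewrite [RHS]consvS [RHS]mxE -(consvS a w); apply: (congr1 (fun j => consv a w 0 j)).
  by apply: val_inj; rewrite /= /bump; have := ltn_ord i; lia.
rewrite [RHS]consv0 -[RHS](consv0 a w); apply: (congr1 (fun j => consv a w 0 j)).
by apply: val_inj.
Qed.

Lemma init_scale n a (w : 'rV[R]_n.+1) : init_rv (a *: w) = a *: init_rv w.
Proof. by apply/rowP => j; rewrite !mxE. Qed.

Lemma consv_scale n c a (y : 'rV[R]_n) : c *: consv a y = consv (c * a) (c *: y).
Proof.
apply/rowP => j; case: (unliftP ord0 j) => [i ->|->].
  by rewrite mxE !consvS mxE.
by rewrite mxE !consv0.
Qed.

Lemma ct_init (T : topologicalType) n (f : T -> 'rV[R]_n.+1) :
  continuous f -> continuous (fun x => init_rv (f x)).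
Proof.
by move=> cf; apply: ct_rV => i; under eq_fun do rewrite mxE; exact: ct_coord.
Qed.

Lemma volume_int0 n : volume_int (fun _ : 'rV[R]_n => 0) = 0.
Proof.
elim: n => [//|n IHn] /=; under eq_Rintegral do rewrite IHn.
by rewrite Rintegral_cst // mul0r.
Qed.

Definition disc_weight n (s : R) (g : 'rV[R]_n -> R) (y : 'rV[R]_n) : R :=
  if sqnorm y <= s ^+ 2 then g y / Num.sqrt (s ^+ 2 - sqnorm y) else 0.

Lemma sqnorm_ge0 n (y : 'rV[R]_n) : 0 <= sqnorm y.
Proof. by apply: sumr_ge0 => i _; exact: sqr_ge0. Qed.

(** Two hemispheres of radius s lie over the ball, with surface element s dy / sqrt(s^2 - |y|^2). By
    induction: the slice at first coordinate s cos t is a ball of radius s sin t, hence the general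
    radius. *)
Lemma volume_sphere n (s : R) (g : 'rV[R]_n -> R) : 0 < s -> continuous g ->
  2 * s * volume_int (disc_weight s g) =
  s ^+ n * sphere_int (fun w : 'rV[R]_n.+1 => g (s *: init_rv w)).
Proof.
elim: n s g => [|n IHn] s g s0 cg.
  rewrite /sphere_int /= /disc_weight /sqnorm big_ord0 sqr_ge0 subr0 sqrtr_sqr gtr0_norm //.
  have E (y : 'rV[R]_0) : g y = g 0 by congr g; apply/rowP => -[].
  by rewrite !E expr0; field; rewrite gt_eqF.
pose S (p : R * R) := sphere_int (fun w : 'rV[R]_n.+1 => g (consv p.1 (p.2 *: init_rv w))).
have cS : continuous S.
  apply: (@sphere_cont _ _ _ (fun q : (R * R) * 'rV[R]_n.+1 => g (consv q.1.1 (q.1.2 *: init_rv q.2)))).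
  apply: ctcomp cg _; apply: ct_consv; first by apply: ctfst; apply: ctfst; exact: ctI.
  by apply: ctZ; [apply: ctsnd; apply: ctfst|apply: ct_init; apply: ctsnd]; exact: ctI.
pose tau a : R := Num.sqrt (s ^+ 2 - a ^+ 2).
pose k a := tau a ^+ n * S (a, tau a) / (2 * tau a).
have taup a : - s < a < s -> 0 < s ^+ 2 - a ^+ 2.
  by move=> /andP[h1 h2]; nra.
have slice a : volume_int (fun y => disc_weight s g (consv a y)) = (k \_ `]- s, s[) a.
  have Ea : (a \in [set` `]- s, s[]) = (- s < a < s) by apply/idP/idP; rewrite inE /= in_itv.
  rewrite patchE Ea; case: ifPn => ha.
    have t0 : 0 < tau a by rewrite sqrtr_gt0 taup.
    have t2 : tau a ^+ 2 = s ^+ 2 - a ^+ 2 by rewrite sqr_sqrtr // ltW // taup.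
    have -> : (fun y => disc_weight s g (consv a y)) = disc_weight (tau a) (fun y => g (consv a y)).
      apply/funext => y; rewrite /disc_weight sqnorm_consv t2 lerBrDl.
      by rewrite opprD addrA.
    have cga : continuous (fun y => g (consv a y)) by exact: ct_slice.
    have := IHn _ _ t0 cga; rewrite -/(S (a, tau a)) /k => <-.
    by rewrite mulrC mulKf // mulf_neq0 // gt_eqF.
  have ha2 : s ^+ 2 <= a ^+ 2.
    move: ha => /negP; rewrite -ltr_norml => /negP; rewrite -leNgt => ha.
    by rewrite -[a ^+ 2]real_normK ?num_real // ler_sqr ?nnegrE ?(ltW s0).
  rewrite -[RHS](volume_int0 n); congr volume_int; apply/funext => y.
  (* When |a| = s the slice still contains y = 0; there the square root is 0 and 0^-1 = 0 gives the
     value 0. *)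
  rewrite /disc_weight sqnorm_consv; case: ifP => // _.
  by rewrite ler0_sqrtr ?invr0 ?mulr0 //; have := sqnorm_ge0 y; lra.
(* The Jacobian s sin t cancels the singular factor 1 / [tau], so Q is continuous up to the end
   points. *)
pose Q t := (s * sin t) ^+ n * S (s * cos t, s * sin t) / 2.
have cs1 : continuous (fun t : R => s * sin t) by apply: ctM; [exact: ctC|apply: ct_sin; exact: ctI].
have cc1 : continuous (fun t : R => s * cos t) by apply: ctM; [exact: ctC|apply: ct_cos; exact: ctI].
have cQ0 : continuous (fun t : R => (s * sin t) ^+ n * S (s * cos t, s * sin t)).
  by apply: ctM; [exact: ctX|apply: ctcomp cS _; exact: ctpair].
have cQ : continuous Q by apply: ctM => //; exact: ctC.
have ctau : continuous tau.
  apply: (@ctcomp _ _ _ (@Num.sqrt R)); first exact: sqrt_continuous.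
  by apply: ctD; [exact: ctC|apply: ctN; apply: ctX; exact: ctI].
have -> : volume_int (disc_weight s g) = \int[mu]_(t in `[0, pi]) Q t.
  rewrite [LHS](_ : _ = \int[mu]_(a in setT) (k \_ `]- s, s[) a); last first.
    by apply: eq_Rintegral => a _; exact: slice.
  rewrite -Rintegral_mkcond; apply: polar_substitution => //.
    have c1 : continuous (fun a => tau a ^+ n * S (a, tau a)).
      apply: ctM; first exact: ctX.
      by apply: ctcomp cS _; apply: ctpair => //; exact: ctI.
    have c2 : continuous (fun a => 2 * tau a) by apply: ctM => //; exact: ctC.
    move=> a ha; apply: cvgM; first exact: c1.
    by apply: cvgV; [rewrite mulf_neq0 // gt_eqF // sqrtr_gt0 taup|exact: c2].
  move=> t /andP[t0 tp]; have st : 0 < sin t by rewrite sin_gt0_pi // t0.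
  have -> : k (s * cos t) = (s * sin t) ^+ n * S (s * cos t, s * sin t) / (2 * (s * sin t)).
    have -> : s * sin t = tau (s * cos t).
      rewrite /tau (_ : _ - _ = (s * sin t) ^+ 2); last first.
        by rewrite -[X in X - _]mulr1 -(cos2Dsin2 t); ring.
      by rewrite sqrtr_sqr gtr0_norm // mulr_gt0.
    by [].
  by rewrite /Q; field; rewrite !gt_eqF.
rewrite sphere_intS [Q](_ : _ = (fun t => 2^-1 * ((s * sin t) ^+ n * S (s * cos t, s * sin t)))); last first.
  by apply/funext => t; rewrite /Q mulrC.
rewrite intZ // (_ : forall I : R, 2 * s * (2^-1 * I) = s * I); last by move=> I; field.
have cR : continuous (fun t : R => sin t ^+ n * sphere_int (fun w : 'rV[R]_n.+1 =>
    g (s *: init_rv (consv (cos t) (sin t *: w))))).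
  apply: (@sphere_integrand_cont _ _ (fun w => g (s *: init_rv w))).
  apply: ctcomp cg _; apply: ctZ; first exact: ctC.
  by apply: (@ct_init _ _ (fun y => y)); exact: ctI.
rewrite -(intZ _ _ _ cQ0) -(intZ _ _ _ cR).
apply: int_eq => t _; rewrite exprMn exprS -!mulrA; congr (_ * _); congr (_ * _); congr (_ * _).
by apply: sphere_eq => w; rewrite init_consv init_scale consv_scale scalerA.
Qed.

End VolumeSphere.

(** * Spherical means and the wave equation *)

Section Kirchhoff.
Context {R : realType}.

Lemma EPD_scale n m K (w : 'rV[R]_n * R -> R) : smooth (@spacetime_axes R n) w ->
  EPD m w -> EPD m (fun p => K * w p).
Proof.
move=> Sw Ew p.
have DZ v (u : 'rV[R]_n * R -> R) : smooth (@spacetime_axes R n) u -> spacetime_axes v ->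
    'D_v (fun p => K * u p) = (fun p => K * 'D_v u p).
  move=> Su Av; apply/funext => q; apply: derive_at; apply: dcmul.
  exact: smooth_is_derive Su Av.
have E1 := DZ _ _ Sw (@time_axis R n).
have E2 := DZ _ _ (smooth_derive Sw time_axis) (@time_axis R n).
have E3 : 'D_(time_dir n) (fun p => K * w p) p = K * 'D_(time_dir n) w p.
  exact (congr1 (fun f => f p) E1).
have E4 : 'D_(time_dir n) ('D_(time_dir n) (fun p => K * w p)) p
    = K * 'D_(time_dir n) ('D_(time_dir n) w) p.
  by rewrite E1; exact (congr1 (fun f => f p) E2).
have E5 : laplacian_x (fun p => K * w p) p = K * laplacian_x w p.
  rewrite /laplacian_x mulr_sumr; apply: eq_bigr => i _.
  have F1 := DZ _ _ Sw (space_axis i).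
  have F2 := DZ _ _ (smooth_derive Sw (space_axis i)) (space_axis i).
  by rewrite F1; exact (congr1 (fun f => f p) F2).
have := Ew p; rewrite E3 E4 E5.
move: ('D_(time_dir n) ('D_(time_dir n) w) p) ('D_(time_dir n) w p) (laplacian_x w p) => a b c H.
by rewrite mulrCA [m%:R * _]mulrCA -mulrDr H mulrCA.
Qed.

Definition wave_flow n (f : 'rV[R]_n -> R) (V : 'rV[R]_n * R -> R) :=
  [/\ smooth (@spacetime_axes R n) V,
      forall p, 'D_(time_dir n) ('D_(time_dir n) V) p = laplacian_x V p,
      forall x, V (x, 0) = f x &
      forall x, 'D_(time_dir n) V (x, 0) = 0].

(** K undoes the two factors at r = 0: the total mass A of the mean and the product of [vop0]. *)
Lemma wave_flow_mean n j (f : 'rV[R]_n -> R) w (A : R) : A != 0 ->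
  smooth (@spacetime_axes R n) w -> EPD (2 * j + 2) w -> (forall x, w (x, 0) = A * f x) ->
  let K := (A * \prod_(i < j.+1) (2 * i + 1)%:R)^-1 in
  let V := vop j (fun p => K * w p) in
  wave_flow f V /\ forall x r, radial_op j (fun r => r ^+ (2 * j + 1) * (K * w (x, r))) r = V (x, r).
Proof.
move=> A0 Sw Ew w0 K V.
have SK : smooth (@spacetime_axes R n) (fun p => K * w p) by move=> k; exact: CkZ.
have [E0 V1] := vop_wave SK (EPD_scale K Sw Ew).
split; last by move=> x r; exact: radial_vop.
split.
- exact: smooth_vop.
- by move=> p; apply: EPD0_wave E0; exact: smooth_vop.
- move=> x; rewrite /V vop0 w0 /K invfM.
  have P0 : \prod_(i < j.+1) (2 * i + 1)%:R != 0 :> R.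
    by apply/prodf_neq0 => i _; rewrite pnatr_eq0 addn1.
  by field; rewrite P0 A0.
- exact: V1.
Qed.

Definition emb_rv n (x : 'rV[R]_n) : 'rV[R]_n.+1 :=
  \row_j (if unlift ord_max j is Some i then x 0 i else 0).

Lemma init_emb n (x : 'rV[R]_n) : init_rv (emb_rv x) = x.
Proof. by apply/rowP => i; rewrite !mxE liftK. Qed.

Lemma emb_add n (x y : 'rV[R]_n) (h : R) : emb_rv (x + h *: y) = emb_rv x + h *: emb_rv y.
Proof.
by apply/rowP => j; rewrite !mxE; case: unliftP => [i _|_]; rewrite ?mxE // mulr0 addr0.
Qed.

Lemma init_add n (x y : 'rV[R]_n.+1) (h : R) : init_rv (x + h *: y) = init_rv x + h *: init_rv y.
Proof. by apply/rowP => j; rewrite !mxE. Qed.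

Lemma emb_basis n (i : 'I_n) : emb_rv (basis_vec i) = basis_vec (lift ord_max i) :> 'rV[R]_n.+1.
Proof.
apply/rowP => j; rewrite basis_vecE mxE; case: unliftP => [l ->|->].
  by rewrite basis_vecE (inj_eq lift_inj).
by rewrite (negbTE (neq_lift _ _)).
Qed.

Lemma init_basis_max n : init_rv (basis_vec (ord_max : 'I_n.+1)) = 0 :> 'rV[R]_n.
Proof.
apply/rowP => i; rewrite mxE basis_vecE mxE eq_sym.
by rewrite (negbTE (neq_lift _ _)).
Qed.

Lemma sum_ord_max n (F : 'I_n.+1 -> R) : \sum_(i < n.+1) F i = \sum_(i < n) F (lift ord_max i) + F ord_max.
Proof.
rewrite big_ord_recr /=; congr (_ + _); apply: eq_bigr => i _; congr F.
by apply: val_inj; rewrite /= /bump; have := ltn_ord i; lia.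
Qed.

End Kirchhoff.

Section KirchhoffFormulas.
Context {R : realType}.
Local Notation bas n := (range (@basis_vec R n)).

(** The mean over S^(2j+2) has index 2j + 2, exactly what j + 1 Euler operators bring down to 0. *)
Lemma kirchhoff_odd j n (f : 'rV[R]_n -> R) : n = (2 * j + 2).+1 -> smooth (bas n) f ->
  exists V, wave_flow f V /\ forall x r, v_ f x r = V (x, r).
Proof.
move=> nE; subst n => Sf.
pose w := sph_mean (fun=> 1) f.
have Sw : smooth (@spacetime_axes R _) w by apply: smooth_sph_mean => //; exact: ctC.
have A0 : sphere_area (2 * j + 2) != 0 :> R by rewrite gt_eqF // sphere_area_gt0.
have [H1 H2] := wave_flow_mean A0 Sw (sph_mean_EPD Sf) (sph_mean0 f).
eexists; split; first exact: H1.
move=> x r; rewrite -H2 /v_ (_ : odd (2 * j + 2).+1 = true); last by lia.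
have -> : (((2 * j + 2).+1 - 3)./2 = j)%N by lia.
congr (radial_op _ _ _); apply/funext => s; rewrite /odd_mean /c0.
have -> : ((2 * j + 2).+1 - 2 = 2 * j + 1)%N by lia.
have -> : ((2 * j + 2).+1./2 = j.+1)%N by lia.
rewrite /= -mulrA; congr (_ * (_ * _)).
by apply: sphere_eq => y; rewrite mul1r.
Qed.

Lemma smooth_init n (f : 'rV[R]_n -> R) : smooth (bas n) f -> smooth (bas n.+1) (fun y => f (init_rv y)).
Proof.
move=> Sf k; apply: Ck_compN => // i.
apply: (@Ck_linear _ _ _ _ (fun y : 'rV[R]_n.+1 => init_rv y 0 i) (fun y => init_rv y 0 i)).
  by under eq_fun do rewrite mxE; apply: ct_coord; exact: ctI.
by move=> v _ x h; rewrite init_add !mxE.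
Qed.

(* Descent: f is extended to dimension n+1, constantly in the last coordinate. *)
Lemma kirchhoff_even j n (f : 'rV[R]_n -> R) : n = (2 * j + 2)%N -> smooth (bas n) f ->
  exists V, wave_flow f V /\ forall x r, v_ f x r = V (x, r).
Proof.
move=> nE Sf.
pose g := fun y => f (init_rv y).
have Sg : smooth (bas n.+1) g by exact: smooth_init.
pose S := sph_mean (fun=> 1) g.
have SS : smooth (@spacetime_axes R n.+1) S by apply: smooth_sph_mean => //; exact: ctC.
(* The mean of g lives in dimension n + 1 and has index n = 2j + 2; w is its restriction to the
   hyperplane where the last coordinate is 0. *)
pose L (p : 'rV[R]_n * R) : 'rV[R]_n.+1 * R := (emb_rv p.1, p.2).
have cL : continuous L.
  apply: ctpair; last by apply: ctsnd; exact: ctI.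
  apply: ct_rV => i.
  case: (unliftP ord_max i) => [l ->|->].
    by under eq_fun do rewrite mxE liftK; apply: ct_coord; apply: ctfst; exact: ctI.
  by under eq_fun do rewrite mxE unlift_none; exact: ctC.
have Lt z (h : R) : L (z + h *: (time_dir n : 'rV[R]_n * R)) = L z + h *: (time_dir n.+1 : 'rV[R]_n.+1 * R).
  by rewrite /L /= scaler0 addr0; congr pair; rewrite /= scaler0 addr0.
have Ls i z (h : R) : L (z + h *: (space_dir i : 'rV[R]_n * R)) = L z + h *: (space_dir (lift ord_max i) : 'rV[R]_n.+1 * R).
  by rewrite /L /= emb_add emb_basis; congr pair; rewrite /= scaler0 addr0.
pose w p := S (L p).
have Sw : smooth (@spacetime_axes R n) w.
  apply: (smooth_affine cL) SS => b [[i _ <-]|->].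
    by exists (space_dir (lift ord_max i)); [exact: space_axis|exact: Ls].
  by exists (time_dir n.+1); [exact: time_axis|exact: Lt].
have ES := sph_mean_EPD Sg.
have St := smooth_derive SS (@time_axis R n.+1).
have Et u : smooth (@spacetime_axes R n.+1) u ->
    'D_(time_dir n) (fun p => u (L p)) = (fun p => 'D_(time_dir n.+1) u (L p)).
  by move=> Su; apply/funext => p; exact: derive_affine Su (time_axis) (Lt).
have Es u i : smooth (@spacetime_axes R n.+1) u ->
    'D_(space_dir i) (fun p => u (L p)) = (fun p => 'D_(space_dir (lift ord_max i)) u (L p)).
  by move=> Su; apply/funext => p; exact: derive_affine Su (space_axis _) (Ls i).
have Ew : EPD (2 * j + 2) w.
  rewrite -nE => p.
  have E1 : 'D_(time_dir n) w p = 'D_(time_dir n.+1) S (L p).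
    exact (congr1 (fun f => f p) (Et _ SS)).
  have E2 : 'D_(time_dir n) ('D_(time_dir n) w) p = 'D_(time_dir n.+1) ('D_(time_dir n.+1) S) (L p).
    refine (eq_trans (congr1 (fun f => 'D_(time_dir n) f p) (Et _ SS)) _).
    exact (congr1 (fun f => f p) (Et _ St)).
  have E3 : laplacian_x w p = laplacian_x S (L p).
    rewrite /laplacian_x sum_ord_max.
    (* The mean inherits from g the independence of the last coordinate, so its Laplacian loses one
       term. *)
    have D0 : 'D_(space_dir ord_max) S = (fun=> 0).
      apply/funext => q; apply: derive_at; apply: dlineP.
      have E (h : R) : S (q + h *: (space_dir ord_max : 'rV[R]_n.+1 * R)) = S q.
        rewrite /S /sph_mean /g; apply: sphere_eq => y /=; rewrite scaler0 addr0 addrAC.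
                by rewrite !init_add init_basis_max scaler0 addr0.
      by under eq_fun do rewrite E; exact: dcst.
    have D1 : 'D_(space_dir ord_max) ('D_(space_dir ord_max) S) (L p) = 0.
      by rewrite D0; apply: derive_at; exact: dcst.
    rewrite [X in _ = _ + X]D1 [RHS]addr0; apply: eq_bigr => i _.
    have Si := smooth_derive SS (space_axis (lift ord_max i)).
    refine (eq_trans (congr1 (fun f => 'D_(space_dir i) f p) (Es _ i SS)) _).
    exact (congr1 (fun f => f p) (Es _ i Si)).
  by rewrite E1 E2 E3; exact: (ES (L p)).
have A0 : sphere_area n != 0 :> R by rewrite gt_eqF // sphere_area_gt0.
have w0 x : w (x, 0) = sphere_area n * f x by rewrite /w /S sph_mean0 /g init_emb.
have [H1 H2] := wave_flow_mean A0 Sw Ew w0.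
eexists; split; first exact: H1.
move=> x r; rewrite -H2 /v_ (_ : odd n = false); last by lia.
have -> : ((n - 2)./2 = j)%N by lia.
congr (radial_op _ _ _); apply/funext => s; rewrite /even_mean /c0.
have -> : (n - 1 = 2 * j + 1)%N by lia.
have -> : (n./2 = j.+1)%N by lia.
have cf : continuous (fun y : 'rV[R]_n => f (x + s *: y)).
  apply: ctcomp (smooth_cont Sf) _.
  by apply: ctD; [exact: ctC|apply: ctZ; [exact: ctC|exact: ctI]].
have HV := volume_sphere (@ltr01 R) cf.
set I := volume_int _.
have -> : I = volume_int (disc_weight 1 (fun y => f (x + s *: y))).
  congr volume_int; apply/funext => y; rewrite patchE /disc_weight expr1n.
  have -> : (y \in @unit_ball R n) = (sqnorm y <= 1) by apply/idP/idP; rewrite inE.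
  by [].
rewrite mulr1 expr1n mul1r in HV.
have -> : w (x, s) = 2 * volume_int (disc_weight 1 (fun y => f (x + s *: y))).
  rewrite HV /w /S /sph_mean; apply: sphere_eq => y.
  by rewrite mul1r /g init_add init_emb scale1r.
by move: (volume_int _) (_^-1) => J K; ring.
Qed.

Lemma kirchhoff n (f : 'rV[R]_n -> R) : (2 <= n)%N -> smooth (bas n) f ->
  exists V, wave_flow f V /\ forall x r, v_ f x r = V (x, r).
Proof.
move=> n2 Sf; have := odd_double_half n; case: (odd n) => E.
  by apply: (@kirchhoff_odd (n./2.-1)) => //; lia.
by apply: (@kirchhoff_even (n./2.-1)) => //; lia.
Qed.

End KirchhoffFormulas.

(** * The Gauss hypergeometric function *)

Section PowerSeries.
Context {R : realType}.

(** Equivalent to a radius of convergence at least 1, in a form that passes easily to sums, shifts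
    and derivatives. *)
Definition rad1 (c : nat -> R) := forall r : R, 0 < r < 1 -> exists B, forall k, `|c k| * r ^+ k <= B.

Definition psum (c : nat -> R) (x : R) : R := limn (pseries c x).

(* Coefficients of [x * c(x)]. *)
Definition cshift (T : zmodType) (c : nat -> T) k := if k is j.+1 then c j else 0.

Lemma mid1 (x : R) : `|x| < 1 -> exists r : R, [/\ 0 < r, r < 1 & `|x| < r].
Proof. by move=> x1; exists ((`|x| + 1) / 2); have := normr_ge0 x; split; lra. Qed.

Lemma rad1_cvg c x : rad1 c -> `|x| < 1 -> cvgn (pseries c x).
Proof.
move=> Hc /mid1[r [r0 r1 xr]].
have [B HB] : exists B, forall k, `|c k| * r ^+ k <= B by apply: Hc; rewrite r0.
apply: normed_cvg.
have q1 : `|(`|x| / r)| < 1.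
  by rewrite ger0_norm ?divr_ge0 ?(ltW r0) // ltr_pdivrMr // mul1r.
apply: (series_le_cvg _ _ _ (is_cvg_geometric_series (a := B) q1)) => [k|k|k] /=.
- exact: normr_ge0.
- apply: mulr_ge0; first by apply: le_trans (HB 0%N); rewrite expr0 mulr1.
  by apply: exprn_ge0; rewrite divr_ge0 // ltW.
rewrite normrM normrX expr_div_n mulrA ler_pdivlMr ?exprn_gt0 // mulrAC.
by rewrite ler_wpM2r // exprn_ge0.
Qed.

(** The bound is the fixed point of x -> q x + q, which majorises the step from k to k + 1. It
    absorbs the factor k + 1 of a differentiated series. *)
Lemma bernoulli_bound (q : R) k : 0 < q -> q < 1 -> k%:R * q ^+ k <= q / (1 - q).
Proof.
move=> q0 q1; elim: k => [|k IHk]; first by rewrite mul0r divr_ge0 // ltW // subr_gt0.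
have q10 : 0 < 1 - q by rewrite subr_gt0.
have E : k.+1%:R * q ^+ k.+1 = q * (k%:R * q ^+ k) + q * q ^+ k by rewrite -natr1 exprS; ring.
rewrite E; have h1 : q * q ^+ k <= q by rewrite ger_pMr // exprn_ile1 // ltW.
have h2 : q * (k%:R * q ^+ k) <= q * (q / (1 - q)) by rewrite ler_pM2l.
apply: le_trans (lerD h2 h1) _.
by rewrite le_eqVlt; apply/orP; left; apply/eqP; field; rewrite gt_eqF.
Qed.

Lemma rad1_diffs c : rad1 c -> rad1 (pseries_diffs c).
Proof.
move=> Hc r /andP[r0 r1].
have [s [s0 s1 rs]] : exists s : R, [/\ 0 < s, s < 1 & r < s].
  by exists ((r + 1) / 2); split; lra.
have [B HB] : exists B, forall k, `|c k| * s ^+ k <= B by apply: Hc; rewrite s0.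
pose q := r / s; have q0 : 0 < q by rewrite divr_gt0.
have q1 : q < 1 by rewrite ltr_pdivrMr // mul1r.
exists (B * (q / (1 - q)) / r) => k.
rewrite ler_pdivlMr // /pseries_diffs normrM normr_nat -mulrA -exprSr.
have -> : r ^+ k.+1 = s ^+ k.+1 * q ^+ k.+1 by rewrite -exprMn /q mulrCA mulfV ?mulr1 // gt_eqF.
rewrite (_ : _ * _ = (`|c k.+1| * s ^+ k.+1) * (k.+1%:R * q ^+ k.+1)); last by ring.
have c0 : 0 <= `|c k.+1| * s ^+ k.+1 by rewrite mulr_ge0 // exprn_ge0 // ltW.
have k0 : 0 <= k.+1%:R * q ^+ k.+1 by rewrite mulr_ge0 // exprn_ge0 // ltW.
by apply: ler_pM => //; exact: bernoulli_bound.
Qed.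

Lemma rad1D c d : rad1 c -> rad1 d -> rad1 (fun k => c k + d k).
Proof.
move=> Hc Hd r rr; have [B HB] := Hc r rr; have [D HD] := Hd r rr; exists (B + D) => k.
apply: le_trans (lerD (HB k) (HD k)); rewrite -mulrDl ler_wpM2r ?ler_normD // exprn_ge0 //.
by case/andP: rr => /ltW.
Qed.

Lemma rad1Z z c : rad1 c -> rad1 (fun k => z * c k).
Proof.
move=> Hc r rr; have [B HB] := Hc r rr; exists (`|z| * B) => k.
by rewrite normrM -mulrA ler_wpM2l.
Qed.

Lemma rad1_shift c : rad1 c -> rad1 (cshift c).
Proof.
move=> Hc r /andP[r0 r1]; have [B HB] : exists B, forall k, `|c k| * r ^+ k <= B.
  by apply: Hc; rewrite r0.
have B0 : 0 <= B by apply: le_trans (HB 0%N); rewrite expr0 mulr1.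
exists B => -[|k] /=; first by rewrite normr0 mul0r.
rewrite exprS mulrCA; apply: le_trans (HB k).
by apply: ler_piMl; [rewrite mulr_ge0 // exprn_ge0 // ltW|exact: ltW].
Qed.

Lemma psum_derive c (x : R) : rad1 c -> `|x| < 1 ->
  is_derive x (1 : R) (psum c) (psum (pseries_diffs c) x).
Proof.
move=> Hc /mid1[r [r0 r1 xr]].
have rr : `|r| < 1 by rewrite gtr0_norm.
apply: (@pseries_snd_diffs _ c r); last by rewrite (gtr0_norm r0).
- exact: rad1_cvg.
- by apply: rad1_cvg => //; exact: rad1_diffs.
- by apply: rad1_cvg => //; do 2 apply: rad1_diffs.
Qed.

Lemma psumD c d x : rad1 c -> rad1 d -> `|x| < 1 ->
  psum (fun k => c k + d k) x = psum c x + psum d x.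
Proof.
move=> Hc Hd x1; apply: cvg_lim => //.
have -> : pseries (fun k => c k + d k) x = (fun n => pseries c x n + pseries d x n).
  apply/funext => n; rewrite /pseries /series /= -big_split /=.
  by apply: eq_bigr => i _; rewrite mulrDl.
by apply: cvgD; exact: rad1_cvg.
Qed.

Lemma psumZ z c x : rad1 c -> `|x| < 1 -> psum (fun k => z * c k) x = z * psum c x.
Proof.
move=> Hc x1; apply: cvg_lim => //.
have -> : pseries (fun k => z * c k) x = (fun n => z * pseries c x n).
  apply/funext => n; rewrite /pseries /series /= mulr_sumr.
  by apply: eq_bigr => i _; rewrite mulrA.
by apply: cvgM; [exact: cvg_cst|exact: rad1_cvg].
Qed.

Lemma psum_shift c x : rad1 c -> `|x| < 1 -> psum (cshift c) x = x * psum c x.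
Proof.
move=> Hc x1; apply: cvg_lim => //; rewrite -cvg_shiftS.
have -> : (fun n => pseries (cshift c) x n.+1) = (fun n => x * pseries c x n).
  apply/funext => n; rewrite /pseries /series /= big_nat_recl //= mul0r add0r mulr_sumr.
  by apply: eq_bigr => i _; rewrite exprS mulrCA.
by apply: cvgM; [exact: cvg_cst|exact: rad1_cvg].
Qed.

(** Since (N + k) / (k + 1) tends to 1, its product with s = sqrt r is at most 1 from some index K
    on; from there u_k r^k decreases, and the sum of the first K + 1 terms is a bound. *)
Lemma rad1_ratio (u : nat -> R) (N : nat) : (forall k, 0 <= u k) ->
  (forall k, u k.+1 * k.+1%:R ^+ 2 <= (N + k)%:R ^+ 2 * u k) -> rad1 u.
Proof.
move=> u0 Hu r /andP[r0 r1]; set s := Num.sqrt r.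
have s0 : 0 < s by rewrite sqrtr_gt0.
have s2 : s ^+ 2 = r by rewrite sqr_sqrtr // ltW.
have s1 : s < 1 by rewrite -(ltr_pXn2r (n := 2)) ?nnegrE ?(ltW s0) // s2 expr1n.
have s10 : 0 < 1 - s by rewrite subr_gt0.
have N0 : 0 <= N%:R / (1 - s) by rewrite divr_ge0 // ltW.
set K := Num.bound (N%:R / (1 - s)).
have HK k : (K <= k)%N -> (N + k)%:R * s <= k.+1%:R.
  move=> Kk; have h : N%:R / (1 - s) < k%:R.
    by apply: lt_le_trans (archi_boundP N0) _; rewrite ler_nat.
  move: h; rewrite ltr_pdivrMr // natrD -natr1 => h.
  have : N%:R * s <= N%:R by apply: ler_piMr; [exact: ler0n|exact: ltW].
  by lra.
pose B := \sum_(i < K.+1) u i * r ^+ i.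
have t0 i : 0 <= u i * r ^+ i by rewrite mulr_ge0 // exprn_ge0 // ltW.
exists B => k; rewrite ger0_norm //; elim: k => [|k IHk].
  by rewrite /B big_ord_recl lerDl sumr_ge0.
have [kK|Kk] := ltnP k K.
  by rewrite /B (bigD1 (Ordinal (kK : (k.+1 < K.+1)%N))) //= lerDl sumr_ge0.
apply: le_trans IHk.
have k10 : 0 < k.+1%:R ^+ 2 :> R by rewrite exprn_gt0 // ltr0n.
rewrite -(ler_pM2r k10).
have h1 := HK k Kk.
have h2 : ((N + k)%:R * s) ^+ 2 <= k.+1%:R ^+ 2.
  by rewrite ler_sqr ?nnegrE // mulr_ge0 // ltW.
have h3 : u k.+1 * k.+1%:R ^+ 2 * r ^+ k.+1 <= (N + k)%:R ^+ 2 * u k * r ^+ k.+1.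
  by rewrite ler_wpM2r // exprn_ge0 // ltW.
have h4 : (u k * r ^+ k) * ((N + k)%:R * s) ^+ 2 <= (u k * r ^+ k) * k.+1%:R ^+ 2 by rewrite ler_wpM2l.
apply: le_trans h4; apply: le_trans (_ : _ <= (N + k)%:R ^+ 2 * u k * r ^+ k.+1) _.
  by rewrite mulrAC.
by rewrite le_eqVlt; apply/orP; left; apply/eqP; rewrite exprMn s2 [r ^+ k.+1]exprS; ring.
Qed.

Lemma rad1_le (u c : nat -> R) : (forall k, `|c k| <= u k) -> rad1 u -> rad1 c.
Proof.
move=> cu Hu r rr; have [B HB] := Hu r rr; exists B => k; apply: le_trans (HB k).
have u0 : 0 <= u k by apply: le_trans (cu k).
by rewrite (ger0_norm u0) ler_wpM2r // exprn_ge0 //; case/andP: rr => /ltW.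
Qed.

End PowerSeries.

(** * Complex power series in a real variable *)

Section ComplexSeries.
Context {R : realType}.
Local Notation Cx := R[i].
Local Notation Re := (@complex.Re R).
Local Notation Im := (@complex.Im R).

Lemma complex_eq (z w : Cx) : Re z = Re w -> Im z = Im w -> z = w.
Proof. by case: z w => a b [c d] /= -> ->. Qed.

Lemma ReM (z w : Cx) : Re (z * w) = Re z * Re w - Im z * Im w.
Proof. by case: z w => a b [c d]. Qed.

Lemma ImM (z w : Cx) : Im (z * w) = Re z * Im w + Im z * Re w.
Proof. by case: z w => a b [c d]. Qed.

Lemma ReDc (z w : Cx) : Re (z + w) = Re z + Re w.
Proof. by case: z w => a b [c d]. Qed.

Lemma ImDc (z w : Cx) : Im (z + w) = Im z + Im w.
Proof. by case: z w => a b [c d]. Qed.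

Lemma ReNc (z : Cx) : Re (- z) = - Re z. Proof. by case: z. Qed.
Lemma ImNc (z : Cx) : Im (- z) = - Im z. Proof. by case: z. Qed.

Definition rad1c (C : nat -> Cx) := rad1 (fun k => Re (C k)) /\ rad1 (fun k => Im (C k)).

Definition csum (C : nat -> Cx) (x : R) : Cx :=
  psum (fun k => Re (C k)) x +i* psum (fun k => Im (C k)) x.

Definition cdiffs (C : nat -> Cx) k : Cx := k.+1%:R * C k.+1.

Lemma natrC k : k%:R = (k%:R : R)%:C :> Cx.
Proof. by rewrite -(rmorph_nat (real_complex R)). Qed.

Lemma Re_cdiffs C : (fun k => Re (cdiffs C k)) = pseries_diffs (fun k => Re (C k)).
Proof. by apply/funext => k; rewrite /cdiffs natrC ReM /= mul0r subr0. Qed.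

Lemma Im_cdiffs C : (fun k => Im (cdiffs C k)) = pseries_diffs (fun k => Im (C k)).
Proof. by apply/funext => k; rewrite /cdiffs natrC ImM /= mul0r addr0. Qed.

Lemma rad1c_cdiffs C : rad1c C -> rad1c (cdiffs C).
Proof. by move=> [h1 h2]; split; rewrite ?Re_cdiffs ?Im_cdiffs; exact: rad1_diffs. Qed.

Lemma Re_shift C : (fun k => Re (cshift C k)) = cshift (fun k => Re (C k)).
Proof. by apply/funext => -[|k]. Qed.

Lemma Im_shift C : (fun k => Im (cshift C k)) = cshift (fun k => Im (C k)).
Proof. by apply/funext => -[|k]. Qed.

Lemma rad1c_shift C : rad1c C -> rad1c (cshift C).
Proof. by move=> [h1 h2]; split; rewrite ?Re_shift ?Im_shift; exact: rad1_shift. Qed.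

Lemma rad1cD C D : rad1c C -> rad1c D -> rad1c (fun k => C k + D k).
Proof.
move=> [h1 h2] [h3 h4]; split; [under eq_fun do rewrite ReDc|under eq_fun do rewrite ImDc];
  exact: rad1D.
Qed.

Lemma rad1cZ z C : rad1c C -> rad1c (fun k => z * C k).
Proof.
move=> [h1 h2]; split; [under eq_fun do rewrite ReM -mulNr|under eq_fun do rewrite ImM];
  by apply: rad1D; exact: rad1Z.
Qed.

Lemma csumD C D x : rad1c C -> rad1c D -> `|x| < 1 ->
  csum (fun k => C k + D k) x = csum C x + csum D x.
Proof.
move=> [h1 h2] [h3 h4] x1; apply: complex_eq; rewrite /= ?ReDc ?ImDc /=.
  by under eq_fun do rewrite ReDc; exact: psumD.
by under eq_fun do rewrite ImDc; exact: psumD.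
Qed.

Lemma csumZ z C x : rad1c C -> `|x| < 1 -> csum (fun k => z * C k) x = z * csum C x.
Proof.
move=> [h1 h2] x1; apply: complex_eq; rewrite ?ReM ?ImM /=.
  under eq_fun do rewrite ReM -mulNr.
  by rewrite psumD ?psumZ ?mulNr //; exact: rad1Z.
under eq_fun do rewrite ImM.
by rewrite psumD ?psumZ //; exact: rad1Z.
Qed.

Lemma csum_shift C x : rad1c C -> `|x| < 1 -> csum (cshift C) x = x%:C * csum C x.
Proof.
move=> [h1 h2] x1; apply: complex_eq; rewrite ?ReM ?ImM /= mul0r ?subr0 ?addr0.
  by rewrite Re_shift psum_shift.
by rewrite Im_shift psum_shift.
Qed.

Definition cder (f : R -> Cx) (x : R) (d : Cx) :=
  is_derive x (1 : R) (fun t => Re (f t)) (Re d) /\ is_derive x (1 : R) (fun t => Im (f t)) (Im d).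

Lemma csum_der C x : rad1c C -> `|x| < 1 -> cder (csum C) x (csum (cdiffs C) x).
Proof.
move=> [h1 h2] x1; split; rewrite /= ?Re_cdiffs ?Im_cdiffs.
  exact: psum_derive h1 x1.
exact: psum_derive h2 x1.
Qed.

Lemma cderD f g x d e : cder f x d -> cder g x e -> cder (fun t => f t + g t) x (d + e).
Proof.
move=> [h1 h2] [h3 h4]; split.
  by under eq_fun do rewrite ReDc; rewrite ReDc; apply: dadd.
by under eq_fun do rewrite ImDc; rewrite ImDc; apply: dadd.
Qed.

Lemma cderM f g x d e : cder f x d -> cder g x e -> cder (fun t => f t * g t) x (d * g x + f x * e).
Proof.
move=> [h1 h2] [h3 h4]; split.
  under eq_fun do rewrite ReM; apply: (is_derive_eq (dsub (dmul h1 h3) (dmul h2 h4))).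
  by rewrite ReDc !ReM; ring.
under eq_fun do rewrite ImM; apply: (is_derive_eq (dadd (dmul h1 h4) (dmul h2 h3))).
by rewrite ImDc !ImM; ring.
Qed.

Lemma cder_cst (z : Cx) x : cder (fun=> z) x 0.
Proof. by split; exact: dcst. Qed.

Lemma cderZ z f x d : cder f x d -> cder (fun t => z * f t) x (z * d).
Proof. by move=> D; have := cderM (cder_cst z x) D; rewrite mul0r add0r. Qed.

Lemma cder_comp f (g : R -> R) x d (e : R) : cder f (g x) d -> is_derive x (1 : R) g e ->
  cder (fun t => f (g t)) x (e%:C * d).
Proof.
move=> [h1 h2] Dg; split.
  apply: (is_derive_eq (dcomp1 h1 Dg)); by rewrite ReM /= mul0r subr0 mulrC.
apply: (is_derive_eq (dcomp1 h2 Dg)); by rewrite ImM /= mul0r addr0 mulrC.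
Qed.

Lemma csum_lim (C : nat -> Cx) (x : R) : rad1c C -> `|x| < 1 ->
  limn (series (fun k : nat => C k * x%:C ^+ k : R[i]^o)) = csum C x.
Proof.
move=> [h1 h2] x1; apply: cvg_lim => //.
have E n : series (fun k : nat => C k * x%:C ^+ k : R[i]^o) n =
    pseries (fun k => Re (C k)) x n +i* pseries (fun k => Im (C k)) x n.
  rewrite /pseries /series /=; elim: n => [|n IHn]; first by rewrite !big_nil.
  rewrite !big_nat_recr //= IHn -rmorphXn /=; apply: complex_eq.
    by rewrite ReDc ReM /= mulr0 subr0.
  by rewrite ImDc ImM /= mulr0 add0r.
apply/cvgrPdist_lt => e e0.
(* In the order of R[i] a positive number is real, so e stands for its real part. *)
have [Ie Re0] : Im e = 0 /\ 0 < Re e.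
  by move: e0; rewrite ltcE /= => /andP[/eqP -> ->].
have e2 : 0 < Re e / 2 by rewrite divr_gt0.
have /cvgrPdist_lt/(_ _ e2) H1 := rad1_cvg h1 x1.
have /cvgrPdist_lt/(_ _ e2) H2 := rad1_cvg h2 x1.
near=> n; rewrite E.
have N1 : `|psum (fun k => Re (C k)) x - pseries (fun k => Re (C k)) x n| < Re e / 2 by near: n.
have N2 : `|psum (fun k => Im (C k)) x - pseries (fun k => Im (C k)) x n| < Re e / 2 by near: n.
rewrite ltcE normc_def /= Ie eqxx /=.
set u := psum _ x - _ in N1 *; set v := psum _ x - _ in N2 *.
clearbody u v.
apply: (@le_lt_trans _ _ (`|u| + `|v|)).
  rewrite -[leRHS]ger0_norm ?addr_ge0 // -sqrtr_sqr ler_wsqrtr // sqrrD.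
  rewrite -[u ^+ 2]real_normK ?num_real // -[v ^+ 2]real_normK ?num_real //.
  by rewrite lerD2r lerDl mulrn_wge0 // mulr_ge0.
by rewrite (splitr (Re e)) ltrD.
Unshelve. all: by end_near. Qed.

End ComplexSeries.

(** * Hypergeometric coefficients: differential equation and contiguity *)

Section HypergeometricCoefficients.
Context {R : realType}.
Local Notation Cx := R[i].
Local Notation Re := (@complex.Re R).
Local Notation Im := (@complex.Im R).

Definition hcoef (a b : Cx) (k : nat) : Cx :=
  pochhammer a k * pochhammer b k / (pochhammer 1 k * k`!%:R).

Lemma pochhammer0 (a : Cx) : pochhammer a 0 = 1.
Proof. by rewrite /pochhammer big_ord0. Qed.

Lemma pochhammerS (a : Cx) k : pochhammer a k.+1 = pochhammer a k * (a + k%:R).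
Proof. by rewrite /pochhammer big_ord_recr. Qed.

Lemma pochhammerSl (a : Cx) k : pochhammer a k.+1 = a * pochhammer (a + 1) k.
Proof.
rewrite /pochhammer big_ord_recl addr0; congr (_ * _); apply: eq_bigr => i _.
by rewrite lift0 -addn1 natrD; ring.
Qed.

Lemma pochhammer1 k : pochhammer (1 : Cx) k = k`!%:R.
Proof.
elim: k => [|k IHk]; first by rewrite pochhammer0.
by rewrite pochhammerS IHk factS natrM mulrC -natr1 addrC.
Qed.

Lemma natC_neq0 k : (k.+1%:R : Cx) != 0.
Proof. by rewrite pnatr_eq0. Qed.

Lemma factC_neq0 k : (k`!%:R : Cx) != 0.
Proof. by rewrite pnatr_eq0 -lt0n fact_gt0. Qed.

Lemma hcoef_rec a b k :
  k.+1%:R ^+ 2 * hcoef a b k.+1 = (a + k%:R) * (b + k%:R) * hcoef a b k.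
Proof.
rewrite /hcoef !pochhammerS !pochhammer1 factS natrM -natr1.
have := natC_neq0 k; rewrite -natr1 => k1; have f0 := factC_neq0 k.
by field; rewrite k1 f0.
Qed.

Lemma Re_norm_le (z : Cx) : `|Re z| <= Re `|z|.
Proof.
rewrite normc_def /= -sqrtr_sqr ler_wsqrtr // lerDl sqr_ge0 //.
Qed.

Lemma Im_norm_le (z : Cx) : `|Im z| <= Re `|z|.
Proof. by rewrite normc_def /= -sqrtr_sqr ler_wsqrtr // lerDr sqr_ge0. Qed.

Lemma norm_real (z : Cx) : `|z| = (Re `|z|)%:C.
Proof. by rewrite normc_def. Qed.

Lemma Re_normM (z w : Cx) : Re `|z * w| = Re `|z| * Re `|w|.
Proof. by rewrite normrM ReM [`|z|]norm_real /= mul0r subr0. Qed.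

Lemma Re_norm_ge0 (z : Cx) : 0 <= Re `|z|.
Proof. exact: le_trans (normr_ge0 _) (Re_norm_le z). Qed.

Lemma Re_norm_nat k : Re `|k%:R : Cx| = k%:R.
Proof. by rewrite normr_nat natrC. Qed.

Lemma Re_norm_addn (z : Cx) (N k : nat) : Re `|z| <= N%:R -> Re `|z + k%:R| <= (N + k)%:R.
Proof.
move=> zN; have h : `|z + k%:R| <= `|z| + `|k%:R : Cx| by exact: ler_normD.
have /= := h; rewrite lecE => /andP[_]; rewrite ReDc Re_norm_nat natrD => h'.
by apply: le_trans h' _; rewrite lerD2r.
Qed.

(** With N at least |a| and |b|, the recursion of the coefficients gives the ratio bound ((N + k) /
    (k + 1))^2 of [rad1_ratio]. *)
Lemma rad1c_hcoef a b : rad1c (hcoef a b).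
Proof.
pose N := (Num.bound (Re `|a|%R) + Num.bound (Re `|b|%R))%N.
have aN : Re `|a| <= N%:R.
  by rewrite natrD; have := archi_boundP (Re_norm_ge0 a); have := ler0n R (Num.bound (Re `|b|)); lra.
have bN : Re `|b| <= N%:R.
  by rewrite natrD; have := archi_boundP (Re_norm_ge0 b); have := ler0n R (Num.bound (Re `|a|)); lra.
have Hu : rad1 (fun k => Re `|hcoef a b k|).
  apply: (@rad1_ratio _ _ N) => k; first exact: Re_norm_ge0.
  have := congr1 (fun z : Cx => Re `|z|) (hcoef_rec a b k).
  move: (hcoef a b k) (hcoef a b k.+1) => ck ck1.
  rewrite !Re_normM !Re_norm_nat -expr2 mulrC => ->.
  rewrite expr2; apply: ler_wpM2r; [exact: Re_norm_ge0|].
  by apply: ler_pM; rewrite ?Re_norm_ge0 ?Re_norm_addn.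
by split; apply: rad1_le Hu => k; [exact: Re_norm_le|exact: Im_norm_le].
Qed.

Definition hfun a b := csum (hcoef a b).

Lemma hyp2F1E a b (x : R) : `|x| < 1 -> hyp2F1 a b 1 x%:C = hfun a b x.
Proof. by move=> x1; rewrite /hyp2F1 /hfun -csum_lim //; exact: rad1c_hcoef. Qed.

Lemma csum0 (x : R) : csum (fun=> 0 : Cx) x = 0.
Proof.
have h : limn (pseries (fun=> (0 : R)) x) = 0.
  apply: cvg_lim => //; apply: cvg_near_cst; apply: nearW => k.
  by rewrite /pseries /series /= big1 // => i _; rewrite mul0r.
by rewrite /csum /psum /= h.
Qed.

Lemma csum_at0 (C : nat -> Cx) : csum C 0 = C 0%N.
Proof.
have h (c : nat -> R) : limn (pseries c 0) = c 0%N.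
  apply: cvg_lim => //; rewrite -cvg_shiftS; apply: cvg_near_cst; apply: nearW => k.
  rewrite /pseries /series /= big_nat_recl // expr0 mulr1 big1 ?addr0 // => i _.
  by rewrite expr0n mulr0.
by rewrite /csum /psum !h; case: (C 0%N).
Qed.

Lemma hcoef0 a b : hcoef a b 0 = 1.
Proof. by rewrite /hcoef !pochhammer0 fact0 !mul1r invr1. Qed.

Lemma eq0_sub (V : zmodType) (x y z : V) : x = y -> z = x - y -> z = 0.
Proof. by move=> -> ->; rewrite subrr. Qed.

Lemma csum_lin5 (C1 C2 C3 C4 C5 : nat -> Cx) z1 z2 z3 z4 z5 (x : R) : `|x| < 1 ->
  rad1c C1 -> rad1c C2 -> rad1c C3 -> rad1c C4 -> rad1c C5 ->
  csum (fun k => z1 * C1 k + (z2 * C2 k + (z3 * C3 k + (z4 * C4 k + z5 * C5 k)))) x =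
  z1 * csum C1 x + (z2 * csum C2 x + (z3 * csum C3 x + (z4 * csum C4 x + z5 * csum C5 x))).
Proof.
move=> x1 r1 r2 r3 r4 r5.
have s1 := rad1cZ z1 r1; have s2 := rad1cZ z2 r2; have s3 := rad1cZ z3 r3.
have s4 := rad1cZ z4 r4; have s5 := rad1cZ z5 r5.
have t4 := rad1cD s4 s5; have t3 := rad1cD s3 t4; have t2 := rad1cD s2 t3.
by rewrite (csumD s1 t2 x1) (csumD s2 t3 x1) (csumD s3 t4 x1) (csumD s4 s5 x1) !csumZ.
Qed.

(** [T k] is the k-th coefficient of the left side, a shift standing for a factor x; it vanishes by
    [hcoef_rec]. The cases k = 0 and k = 1 are apart because one and two shifts put zeros there. *)
Lemma hfun_ode a (x : R) : `|x| < 1 -> let C := hcoef a a in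
  x%:C * (1 - x%:C) * csum (cdiffs (cdiffs C)) x
  + (1 - (2 * a + 1) * x%:C) * csum (cdiffs C) x - a ^+ 2 * csum C x = 0.
Proof.
move=> x1 C; have rC := rad1c_hcoef a a; rewrite -/C in rC.
have r1 := rad1c_cdiffs rC; have r2 := rad1c_cdiffs r1.
have r1s := rad1c_shift r1; have r2s := rad1c_shift r2; have r2ss := rad1c_shift r2s.
pose T k := 1 * cshift (cdiffs (cdiffs C)) k + (-1 * cshift (cshift (cdiffs (cdiffs C))) k
   + (1 * cdiffs C k + (- (2 * a + 1) * cshift (cdiffs C) k + - a ^+ 2 * C k))).
have E : csum T x = 0.
  rewrite (_ : T = fun=> 0) ?csum0 //; apply/funext => k; rewrite /T.
  have H := hcoef_rec a a; rewrite -/C in H.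
  case: k => [|[|k]] /=; rewrite /cdiffs.
  - by have := H 0%N; rewrite addr0 => E0; apply: (eq0_sub E0); ring.
  - by have := H 1%N => E0; apply: (eq0_sub E0); ring.
  - by have := H k.+2; rewrite -!natr1 ?mulr0n => E0; apply: (eq0_sub E0); ring.
rewrite -[RHS]E /T.
rewrite (csum_lin5 _ _ _ _ _ x1 r2s r2ss r1 r1s rC).
rewrite (csum_shift r2s x1) (csum_shift r2 x1) (csum_shift r1 x1); ring.
Qed.

(** Again an identity of coefficients: those of F(a - 1, a; 1; x) are tied to those of F(a, a; 1; x)
    by (k + 1)^2 D_(k+1) = (a - 1)(a + k) C_k. *)
Lemma hfun_contiguous a (x : R) : `|x| < 1 ->
  x%:C * (1 - x%:C) * csum (cdiffs (hcoef a a)) x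
  = (1 - a) * hfun (a - 1) a x + (a - 1 + a * x%:C) * hfun a a x.
Proof.
move=> x1; set C := hcoef a a; rewrite /hfun -/C; set D := hcoef (a - 1) a.
have rC : rad1c C by exact: rad1c_hcoef.
have rD : rad1c D by exact: rad1c_hcoef.
have r1 := rad1c_cdiffs rC; have r1s := rad1c_shift r1; have r1ss := rad1c_shift r1s.
have rCs := rad1c_shift rC.
pose T k := 1 * cshift (cdiffs C) k + (-1 * cshift (cshift (cdiffs C)) k
   + ((a - 1) * D k + ((1 - a) * C k + - a * cshift C k))).
have E : csum T x = 0.
  rewrite (_ : T = fun=> 0) ?csum0 //; apply/funext => k; rewrite /T.
  have H i : i.+1%:R ^+ 2 * D i.+1 = (a - 1) * (a + i%:R) * C i.
    rewrite /D /C /hcoef pochhammerSl subrK !pochhammerS !pochhammer1 factS natrM -natr1.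
    have := natC_neq0 i; rewrite -natr1 => k1; have f0 := factC_neq0 i.
    by field; rewrite k1 f0.
  have HC := hcoef_rec a a; rewrite -/C in HC.
  have key j : (j%:R + 1) * C j.+1 - j%:R * C j + (a - 1) * D j.+1 + (1 - a) * C j.+1 - a * C j = 0 :> Cx.
    have n0 := natC_neq0 j.
    apply: (mulfI (_ : j.+1%:R ^+ 2 != 0)); first by rewrite expf_neq0.
    have := H j; have := HC j; rewrite -natr1 => E1 E2; rewrite mulr0.
    (* The multiplier j + 2 - a is the total coefficient (j + 1) + (1 - a) of C_(j+1) in [key]; both
       recursions then express everything by C_j. *)
    apply: (@eq0_sub _ ((j%:R + 1 - a + 1) * ((j%:R + 1) ^+ 2 * C j.+1) + (a - 1) * ((j%:R + 1) ^+ 2 * D j.+1))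
      ((j%:R + 1 - a + 1) * ((a + j%:R) * (a + j%:R) * C j) + (a - 1) * ((a - 1) * (a + j%:R) * C j))).
      by rewrite E1 E2.
    by ring.
  case: k => [|[|k]] /=; rewrite /cdiffs.
  - by rewrite /D /C !hcoef0; ring.
  - by have := key 0%N => E0; apply: (eq0_sub E0); ring.
  - by have := key k.+1; rewrite -!natr1 ?mulr0n => E0; apply: (eq0_sub E0); ring.
apply/eqP; rewrite -subr_eq0; apply/eqP; rewrite -[RHS]E /T.
rewrite (csum_lin5 _ _ _ _ _ x1 r1s r1ss rD rC rCs).
rewrite (csum_shift r1s x1) (csum_shift r1 x1) (csum_shift rC x1); ring.
Qed.

End HypergeometricCoefficients.

(** * The kernels *)

Section ComplexPower.
Context {R : realType}.
Local Notation Cx := R[i].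
Local Notation Re := (@complex.Re R).
Local Notation Im := (@complex.Im R).

Lemma cpowD (x : R) (v w : Cx) : 0 < x -> cpow x (v + w) = cpow x v * cpow x w.
Proof.
move=> x0; rewrite /cpow ReDc ImDc powRD; last by rewrite (gt_eqF x0) implybT.
rewrite mulrDl cosD sinD; apply: complex_eq; rewrite !(ReM, ImM) /=; ring.
Qed.

Lemma cpowM (x y : R) (w : Cx) : 0 < x -> 0 < y -> cpow (x * y) w = cpow x w * cpow y w.
Proof.
move=> x0 y0; rewrite /cpow powRM ?(ltW x0) ?(ltW y0) // lnM ?posrE // mulrDr cosD sinD.
apply: complex_eq; rewrite !(ReM, ImM) /=; ring.
Qed.

Lemma cpow_real (x r : R) : cpow x r%:C = (x `^ r)%:C.
Proof. by rewrite /cpow /= mul0r cos0 sin0; apply: complex_eq; rewrite !(ReM, ImM) /=; ring. Qed.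

Lemma cpow0 (x : R) : cpow x 0 = 1.
Proof. by rewrite -[0]/(0%:C) cpow_real powRr0. Qed.

Lemma cpowN1 (x : R) w : 0 < x -> cpow x (w - 1) = cpow x w / x%:C.
Proof.
move=> x0; rewrite cpowD // -[- 1 : Cx](rmorphN1 (real_complex R)) cpow_real powR_inv1 ?ltW //.
by rewrite fmorphV.
Qed.

Lemma cpow_der (w : Cx) (x : R) : 0 < x -> cder (fun t => cpow t w) x (w * cpow x (w - 1)).
Proof.
move=> x0; rewrite cpowN1 //.
have Dp : is_derive x 1 (fun t => t `^ Re w) (Re w * (x `^ Re w / x)).
  apply: (is_derive_eq (is_derive1_powR (Re w) x0)).
  by rewrite powRD ?powR_inv1 ?ltW // (gt_eqF x0) implybT.
have Da : is_derive x 1 (fun t => Im w * ln t) (Im w * x^-1) by exact: dcmul (is_derive1_ln x0).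
have Dc := dcomp1 (f := fun t : R => Im w * ln t) (is_derive_cos (Im w * ln x)) Da.
have Ds := dcomp1 (f := fun t : R => Im w * ln t) (is_derive_sin (Im w * ln x)) Da.
have V : (x%:C)^-1 = (x^-1)%:C :> Cx by rewrite fmorphV.
split; rewrite /cpow V.
- under eq_fun do rewrite ReM /= mul0r subr0.
  by apply: (is_derive_eq (dmul Dp Dc)); rewrite !(ReM, ImM) /=; ring.
- under eq_fun do rewrite ImM /= mul0r addr0.
  by apply: (is_derive_eq (dmul Dp Ds)); rewrite !(ReM, ImM) /=; ring.
Qed.

End ComplexPower.

Section RadialProfile.
Context {R : realType}.
Local Notation Cx := R[i].
Local Notation Re := (@complex.Re R).
Local Notation Im := (@complex.Im R).

(* [x > -1/2] is the condition [|x / (1 + x)| < 1]. *)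
Definition profile_dom : set R := [set x | - 2^-1 < x].

Lemma profile_dom_gt0 x : profile_dom x -> 0 < 1 + x.
Proof. by rewrite /profile_dom /= => h; lra. Qed.

Lemma profile_dom_lt1 x : profile_dom x -> `|x / (1 + x)| < 1.
Proof.
move=> Ix; have u0 := profile_dom_gt0 Ix; move: Ix; rewrite /profile_dom /= => h.
by rewrite ltr_norml ltr_pdivlMr // ltr_pdivrMr //; apply/andP; split; lra.
Qed.

Lemma moebius_der (x : R) : profile_dom x -> is_derive x (1 : R) (fun t => t / (1 + t)) ((1 + x) ^- 2).
Proof.
move=> /profile_dom_gt0 u0; have un : 1 + x != 0 by rewrite gt_eqF.
have D1 : is_derive x (1 : R) (fun t : R => 1 + t) 1.
  by apply: (is_derive_eq (dadd (dcst 1 x 1) (is_derive_id x (1 : R)))); rewrite add0r.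
have DV : is_derive x (1 : R) (fun t : R => (1 + t)^-1) (- (1 + x) ^- 2).
  apply: DeriveDef; first exact: derivableV (derivable_at D1).
  by rewrite (deriveV un (derivable_at D1)) (derive_at D1) /GRing.scale /= mulr1.
apply: (is_derive_eq (dmul (is_derive_id x (1 : R)) DV)).
by field.
Qed.

(** The functions (1 + x)^w F^(l)(x / (1 + x)) are closed under differentiation up to linear
    combinations, which gives all derivatives of the kernel at once. *)
Definition profile (C : nat -> Cx) (w : Cx) (l : nat) (x : R) : Cx :=
  cpow (1 + x) w * csum (iter l cdiffs C) (x / (1 + x)).

Lemma rad1c_iter (C : nat -> Cx) l : rad1c C -> rad1c (iter l cdiffs C).
Proof. by move=> rC; elim: l => //= l; exact: rad1c_cdiffs. Qed.

Lemma profile_der C w l x : rad1c C -> profile_dom x ->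
  cder (profile C w l) x (w * profile C (w - 1) l x + profile C (w - 1 - 1) l.+1 x).
Proof.
move=> rC Ix; have u0 := profile_dom_gt0 Ix.
have D1 : is_derive x (1 : R) (fun t : R => 1 + t) 1.
  by apply: (is_derive_eq (dadd (dcst 1 x 1) (is_derive_id x (1 : R)))); rewrite add0r.
have Dp := cder_comp (g := fun t : R => 1 + t) (cpow_der w u0) D1.
have Df := cder_comp (g := fun t : R => t / (1 + t)) (csum_der (rad1c_iter l rC) (profile_dom_lt1 Ix)) (moebius_der Ix).
have := cderM Dp Df; rewrite /profile /= mul1r !cpowN1 //.
have uC : (1 + x)%:C != 0 :> Cx by rewrite eq_complex /= gt_eqF.
rewrite (_ : ((1 + x) ^- 2)%:C = ((1 + x)%:C)^-1 * ((1 + x)%:C)^-1); last first.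
  by rewrite -exprVn rmorphXn fmorphV expr2.
rewrite (_ : _ + _ = w * (cpow (1 + x) w / (1 + x)%:C * csum (iter l cdiffs C) (x / (1 + x))) +
   cpow (1 + x) w / (1 + x)%:C / (1 + x)%:C * csum (cdiffs (iter l cdiffs C)) (x / (1 + x))) //.
by ring.
Qed.

Definition Crc (I : set R) k (f : R -> Cx) := Cr I k (fun x => Re (f x)) /\ Cr I k (fun x => Im (f x)).

Lemma CrcD I k f g : Crc I k f -> Crc I k g -> Crc I k (fun x => f x + g x).
Proof.
move=> [h1 h2] [h3 h4]; split; first by under eq_fun do rewrite ReDc; exact: CrD.
by under eq_fun do rewrite ImDc; exact: CrD.
Qed.

Lemma CrZ I k (c : R) f : Cr I k f -> Cr I k (fun x => c * f x).
Proof.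
elim: k f => [|k IHk] f Cf.
  by split=> // x Ix; apply: cvgM; [exact: cvg_cst|exact: Cr_continuous Cf _ Ix].
split; first by move=> x Ix; apply: cvgM; [exact: cvg_cst|exact: Cr_continuous Cf _ Ix].
case: Cf => _ [f' Df Cf']; exists (fun x => c * f' x); last exact: IHk.
by move=> x Ix; apply: dcmul; exact: Df.
Qed.

Lemma CrcZ I k z f : Crc I k f -> Crc I k (fun x => z * f x).
Proof.
move=> [h1 h2]; split.
  by under eq_fun do rewrite ReM -mulNr; apply: CrD; exact: CrZ.
by under eq_fun do rewrite ImM; apply: CrD; exact: CrZ.
Qed.

Lemma Crc_profile C w l k : rad1c C -> Crc profile_dom k (profile C w l).
Proof.
move=> rC; have H w' l' x Ix := profile_der w' l' rC (x := x) Ix.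
elim: k w l => [|k IHk] w l.
  by split; split=> // x Ix; [have [h _] := H w l x Ix|have [_ h] := H w l x Ix];
     exact: is_derive_continuous h.
pose g x := w * profile C (w - 1) l x + profile C (w - 1 - 1) l.+1 x.
have [C1 C2] : Crc profile_dom k g by apply: CrcD; first apply: CrcZ; exact: IHk.
split; split.
- by move=> x Ix; have [h _] := H w l x Ix; exact: is_derive_continuous h.
- by exists (fun x => Re (g x)) => // x Ix; have [] := H w l x Ix.
- by move=> x Ix; have [_ h] := H w l x Ix; exact: is_derive_continuous h.
- by exists (fun x => Im (g x)) => // x Ix; have [] := H w l x Ix.
Qed.

End RadialProfile.

Section KernelProfile.
Context {R : realType}.
Variable M : R.
Local Notation Cx := R[i].
Let a : Cx := 2^-1 + (0 +i* M).
Let C := hcoef a a.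
Let rC : rad1c C := rad1c_hcoef a a.

(* In terms of eta, zeta = eta / (1 + eta) and (1 + e^(-t))^2 - z^2 = 4 e^(-t) (1 + eta). *)
Definition kprofile (x : R) : Cx := profile C (- a) 0 x.

Definition kprofile1 (x : R) : Cx := - a * profile C (- a - 1) 0 x + profile C (- a - 1 - 1) 1 x.

Definition kprofile2 (x : R) : Cx :=
  - a * ((- a - 1) * profile C (- a - 1 - 1) 0 x + profile C (- a - 1 - 1 - 1) 1 x)
  + ((- a - 1 - 1) * profile C (- a - 1 - 1 - 1) 1 x + profile C (- a - 1 - 1 - 1 - 1) 2 x).

Lemma kprofile_der x : profile_dom x -> cder kprofile x (kprofile1 x).
Proof. exact: profile_der. Qed.

Lemma kprofile1_der x : profile_dom x -> cder kprofile1 x (kprofile2 x).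
Proof.
by move=> Ix; apply: cderD; [apply: cderZ|]; exact: profile_der.
Qed.

Lemma kprofile0 : kprofile 0 = 1.
Proof.
rewrite /kprofile /profile addr0 mul0r csum_at0 (hcoef0 a a : iter 0 cdiffs C 0 = 1) mulr1.
have L : ln (1 : R) = 0 by exact: ln1.
by rewrite /cpow L mulr0 cos0 sin0 powR1 mulr1.
Qed.

Lemma one_addC (x : R) : (1 + x)%:C = 1 + x%:C :> Cx.
Proof. by rewrite rmorphD. Qed.

Lemma neq0C (x : R) : x != 0 -> x%:C != 0 :> Cx.
Proof. by rewrite (fmorph_eq0 (real_complex R)). Qed.

Lemma divC (x y : R) : (x / y)%:C = x%:C / y%:C :> Cx.
Proof. by rewrite rmorphM fmorphV. Qed.

Lemma sqr_M : (M ^+ 2)%:C = - (a - 2^-1) ^+ 2 :> Cx.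
Proof.
have -> : a - 2^-1 = 0 +i* M by rewrite /a addrAC subrr add0r.
apply: complex_eq; rewrite ![in RHS]expr2 ?ReNc ?ImNc !(ReM, ImM) /=; ring.
Qed.

Lemma kprofile_ode x : profile_dom x ->
  x%:C * (1 + x%:C) * kprofile2 x + (1 + 2 * x%:C) * kprofile1 x
  + (4^-1 + (M ^+ 2)%:C) * kprofile x = 0.
Proof.
move=> Ix; have u0 := profile_dom_gt0 Ix.
have uC : 1 + x%:C != 0 :> Cx by rewrite -one_addC neq0C // gt_eqF.
have := hfun_ode a (profile_dom_lt1 Ix); rewrite /= -/C => ode.
rewrite sqr_M /kprofile2 /kprofile1 /kprofile /profile !cpowN1 //= one_addC.
move: ode; rewrite divC one_addC.
move: (csum C _) (csum (cdiffs C) _) (csum (cdiffs (cdiffs C)) _) => F F1 F2 ode.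
(* The left side is (1 + x)^(-a-1) times the hypergeometric equation at x / (1 + x). *)
set p := cpow _ _; apply: (@eq_trans _ _ (p / (1 + x%:C) * 0)); last by rewrite mulr0.
rewrite -{}ode.
by field.
Qed.

Definition eta (z t : R) : R := ((1 - expR (- t)) ^+ 2 - z ^+ 2) / (4 * expR (- t)).

Lemma etaE z t : (1 + expR (- t)) ^+ 2 - z ^+ 2 = 4 * expR (- t) * (1 + eta z t).
Proof. by rewrite /eta; field; rewrite gt_eqF // expR_gt0. Qed.

Lemma eta_mul z t : (1 - expR (- t)) ^+ 2 - z ^+ 2 = 4 * expR (- t) * eta z t.
Proof. by rewrite /eta; field; rewrite gt_eqF // expR_gt0. Qed.

Lemma zetaE z t : profile_dom (eta z t) -> zeta z t = eta z t / (1 + eta z t).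
Proof.
move=> /profile_dom_gt0 u0; have q0 := expR_gt0 (- t).
rewrite /zeta etaE eta_mul; move: (eta z t) (expR _) u0 q0 => e q u0 q0.
by field; rewrite !gt_eqF.
Qed.

Lemma half_expR t : (4 * expR (- t)) `^ (- 2^-1) = expR (t / 2) / 2 :> R.
Proof.
have q0 := expR_gt0 (- t).
rewrite powRN powR12_sqrt ?mulr_ge0 ?ltW //.
have -> : 4 * expR (- t) = (2 * expR (- (t / 2))) ^+ 2.
  by rewrite exprMn -expRM_natl; congr (_ * expR _); [rewrite -natrX|rewrite mulr_natl; field].
have e0 := expR_gt0 (- (t / 2)).
by rewrite sqrtr_sqr gtr0_norm ?mulr_gt0 // invfM expRN invrK mulrC.
Qed.

(** The exponents iM and - 1/2 - iM of 4 e^(-t) add up to - 1/2, whence the factor e^(t/2) / 2. *)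
Lemma K1E z t : profile_dom (eta z t) ->
  K1 M z t = (expR (t / 2) / 2)%:C * kprofile (eta z t).
Proof.
move=> Ie; have u0 := profile_dom_gt0 Ie; have q0 : 0 < 4 * expR (- t) by rewrite mulr_gt0 ?expR_gt0.
rewrite /K1 etaE (zetaE Ie) hyp2F1E; last exact: profile_dom_lt1.
rewrite /kprofile /profile /hfun -/a -/C /=.
have -> : - a = - 2^-1 - (0 +i* M) by rewrite /a opprD.
rewrite (cpowM _ q0 u0) [cpow _ _ * (_ * _)]mulrA -(cpowD _ _ q0) [RHS]mulrA; congr (_ * _ * _).
rewrite addrCA subrr addr0 -half_expR -cpow_real; congr cpow.
by rewrite rmorphN fmorphV (rmorph_nat (real_complex R)).
Qed.

(** Contiguity trades F(-1/2 + iM, 1/2 + iM) for F and F', and the factor eta in the denominator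
    cancels: the right side is regular at eta = 0, that is, at z = phi(t). *)
Lemma K0E z t : 0 < eta z t ->
  K0_formula M z t = (expR (t / 2) / 2)%:C *
    (((1 + z ^+ 2 - expR (- t) ^+ 2) / (4 * expR (- t)))%:C * kprofile1 (eta z t)
     - 2^-1 * kprofile (eta z t)).
Proof.
move=> e0; have Ie : profile_dom (eta z t) by rewrite /profile_dom /=; lra.
have u0 := profile_dom_gt0 Ie; have q0 := expR_gt0 (- t).
have q40 : 0 < 4 * expR (- t) by rewrite mulr_gt0.
rewrite /K0_formula [expR (- t) + 1]addrC etaE eta_mul (zetaE Ie) !hyp2F1E; try exact: profile_dom_lt1.
have Ea : - 2^-1 + (0 +i* M) = a - 1 :> Cx.
  by rewrite /a; apply: (can_inj (addrK (- (0 +i* M)))); rewrite addrK; field.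
have Ea' : 2^-1 - (0 +i* M) = 1 - a :> Cx.
  by rewrite /a; apply: (can_inj (addrK (0 +i* M))); rewrite subrK; field.
rewrite Ea Ea' -/a.
have contig := hfun_contiguous a (profile_dom_lt1 Ie).
rewrite -[_ * (1 - a) * _]mulrA (_ : (1 - a) * _ = (eta z t / (1 + eta z t))%:C * (1 - (eta z t / (1 + eta z t))%:C) *
      csum (cdiffs C) (eta z t / (1 + eta z t)) - (a - 1 + a * (eta z t / (1 + eta z t))%:C) * hfun a a (eta z t / (1 + eta z t))); last first.
  by rewrite contig addrK.
have pre : cpow (4 * expR (- t)) (0 +i* M) * cpow (4 * expR (- t) * (1 + eta z t)) (- (0 +i* M)) /
    (4 * expR (- t) * eta z t * Num.sqrt (4 * expR (- t) * (1 + eta z t)))%:C =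
    (expR (t / 2) / 2)%:C * cpow (1 + eta z t) (- a) / (4 * expR (- t) * eta z t)%:C.
  rewrite (cpowM _ q40 u0) mulrA -(cpowD _ _ q40) subrr cpow0 mul1r.
  rewrite [(Num.sqrt _)]sqrtrM ?ltW //.
  have -> : - a = - (0 +i* M) + (- 2^-1)%:C.
    by rewrite /a opprD addrC; congr (_ + _); rewrite rmorphN fmorphV (rmorph_nat (real_complex R)).
  rewrite (cpowD _ _ u0) cpow_real -half_expR !powRN !powR12_sqrt ?ltW //.
  move: (Num.sqrt _) (Num.sqrt _) (cpow _ _) => s4 su p.
  by rewrite !rmorphM !fmorphV !invfM /=; ring.
rewrite pre /kprofile1 /kprofile /profile !cpowN1 // /hfun -/C /= divC !one_addC.
have z2 : 1 + z ^+ 2 - expR (- t) ^+ 2 = 2 - 2 * expR (- t) - 4 * expR (- t) * eta z t.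
  by rewrite -eta_mul; ring.
have z3 : z ^+ 2 = (1 - expR (- t)) ^+ 2 - 4 * expR (- t) * eta z t by rewrite -eta_mul; ring.
rewrite z2 z3.
move: (csum C _) (csum (cdiffs C) _) (cpow _ _) (expR (t / 2) / 2)%:C => F F1 p h.
have qC : (expR (- t))%:C != 0 :> Cx by rewrite neq0C // gt_eqF.
have uC : 1 + (eta z t)%:C != 0 :> Cx by rewrite -one_addC neq0C // gt_eqF.
have eC : (eta z t)%:C != 0 :> Cx by rewrite neq0C // gt_eqF.
have EM : (0 +i* M) = a - 2^-1 by rewrite /a addrAC subrr add0r.
rewrite EM; clearbody a.
move: (eta z t) (expR (- t)) qC uC eC => e q qC uC eC.
by field; rewrite uC qC eC.
Qed.

Lemma Crc_kprofile k :
  [/\ Crc profile_dom k kprofile, Crc profile_dom k kprofile1 & Crc profile_dom k kprofile2].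
Proof.
have H w l := Crc_profile w l k rC.
split; first exact: H.
  exact: CrcD (CrcZ _ (H _ _)) (H _ _).
exact: CrcD (CrcZ _ (CrcD (CrcZ _ (H _ _)) (H _ _))) (CrcD (CrcZ _ (H _ _)) (H _ _)).
Qed.

End KernelProfile.

Section RadialKernel.
Context {R : realType}.
Local Notation Re := (@complex.Re R).
Local Notation Im := (@complex.Im R).

(** The equation has real coefficients, so the real and the imaginary part of [kprofile] satisfy it
    separately, with c = 1 and c = 0. The transform is developed once for both. *)
Definition radial_kernel (m2 c : R) (f f1 f2 : R -> R) :=
  [/\ forall k, [/\ Cr profile_dom k f, Cr profile_dom k f1 & Cr profile_dom k f2],
      forall x, profile_dom x -> is_derive x (1 : R) f (f1 x),
      forall x, profile_dom x -> is_derive x (1 : R) f1 (f2 x),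
      forall x, profile_dom x -> x * (1 + x) * f2 x + (1 + 2 * x) * f1 x + (4^-1 + m2) * f x = 0 &
      f 0 = c].

Lemma kprofile_ode_real (M x : R) : profile_dom x ->
  (x * (1 + x))%:C * kprofile2 M x + (1 + 2 * x)%:C * kprofile1 M x
  + (4^-1 + M ^+ 2)%:C * kprofile M x = 0.
Proof.
move=> Ix; apply: (eq_trans _ (@kprofile_ode _ M _ Ix)).
have h4 : (4^-1 : R)%:C = 4^-1 by rewrite fmorphV (rmorph_nat (real_complex R)).
have h2 : (2 : R)%:C = 2 by exact: (rmorph_nat (real_complex R)).
rewrite -h4 -[in RHS]h2; congr (_ * _ + _ * _ + _ * _).
- by rewrite -one_addC -rmorphM.
- by rewrite one_addC -rmorphM.
- by rewrite -rmorphD.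
Qed.

Lemma radial_kernel_Re (M : R) : radial_kernel (M ^+ 2) 1
  (fun x => Re (kprofile M x)) (fun x => Re (kprofile1 M x)) (fun x => Re (kprofile2 M x)).
Proof.
split.
- by move=> k; have [[h1 _] [h2 _] [h3 _]] := Crc_kprofile M k.
- by move=> x /(@kprofile_der _ M)[].
- by move=> x /(@kprofile1_der _ M)[].
- by move=> x /(@kprofile_ode_real M)/(congr1 Re); rewrite !(ReDc, ReM) /= !mul0r !subr0.
- by rewrite kprofile0.
Qed.

Lemma radial_kernel_Im (M : R) : radial_kernel (M ^+ 2) 0
  (fun x => Im (kprofile M x)) (fun x => Im (kprofile1 M x)) (fun x => Im (kprofile2 M x)).
Proof.
split.
- by move=> k; have [[_ h1] [_ h2] [_ h3]] := Crc_kprofile M k.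
- by move=> x /(@kprofile_der _ M)[].
- by move=> x /(@kprofile1_der _ M)[].
- by move=> x /(@kprofile_ode_real M)/(congr1 Im); rewrite !(ImDc, ImM) /= !mul0r !addr0.
- by rewrite kprofile0.
Qed.

End RadialKernel.

(** * The integral transform *)

Section TimeFunctions.
Context {R : realType}.

(** These are 2 sinh(t/2) and cosh(t/2), so [sh] has derivative [ch] and [ch] has derivative
    [sh / 4]. Moreover sh t = e^(t/2) phi(t). *)
Definition sh (t : R) : R := expR (t / 2) - expR (- (t / 2)).
Definition ch (t : R) : R := (expR (t / 2) + expR (- (t / 2))) / 2.

Lemma dhalf (t : R) : is_derive t (1 : R) (fun t : R => t / 2) 2^-1.
Proof.
by apply: (is_derive_eq (dmul (is_derive_id t (1 : R)) (dcst (2^-1 : R) t 1))); ring.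
Qed.

Lemma dexp_half t : is_derive t (1 : R) (fun t => expR (t / 2)) (expR (t / 2) / 2).
Proof. exact: (dcomp1 (f := fun t : R => t / 2) (is_derive_expR _) (dhalf t)). Qed.

Lemma dexp_Nhalf t : is_derive t (1 : R) (fun t => expR (- (t / 2))) (- (expR (- (t / 2)) / 2)).
Proof.
by apply: (is_derive_eq (dcomp1 (f := fun t : R => - (t / 2)) (is_derive_expR _) (dopp (dhalf t)))); ring.
Qed.

Lemma dsh t : is_derive t (1 : R) sh (ch t).
Proof. by apply: (is_derive_eq (dsub (dexp_half t) (dexp_Nhalf t))); rewrite /ch; field. Qed.

Lemma dch t : is_derive t (1 : R) ch (sh t / 4).
Proof.
apply: (is_derive_eq (dmul (dadd (dexp_half t) (dexp_Nhalf t)) (dcst (2^-1 : R) t 1))).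
by rewrite /sh; field.
Qed.

Lemma dexpN t : is_derive t (1 : R) (fun t => expR (- t)) (- expR (- t)).
Proof.
by apply: (is_derive_eq (dcomp1 (f := fun t : R => - t) (is_derive_expR _) (dopp (is_derive_id t (1 : R))))); ring.
Qed.

Lemma dphi t : is_derive t (1 : R) phi (expR (- t)).
Proof. by apply: (is_derive_eq (dsub (dcst (1 : R) t 1) (dexpN t))); ring. Qed.

Lemma expN_half t : expR (- t) = expR (- (t / 2)) ^+ 2 :> R.
Proof. by rewrite -expRM_natl; congr expR; rewrite mulr_natl; field. Qed.

Lemma exp_halfE t : expR (t / 2) = (expR (- (t / 2)))^-1 :> R.
Proof. by rewrite expRN invrK. Qed.

(* eta (phi t * s) t for 0 <= s <= 1; the absolute value keeps it in [profile_dom] for all s. *)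
Definition karg (t s : R) : R := sh t ^+ 2 / 4 * `|1 - s ^+ 2|.

Lemma karg_dom t s : profile_dom (karg t s).
Proof.
rewrite /profile_dom /=; apply: (@lt_le_trans _ _ 0); first by rewrite oppr_lt0 invr_gt0.
by rewrite mulr_ge0 // divr_ge0 // sqr_ge0.
Qed.

Lemma karg_eta t s : 0 <= s <= 1 -> eta (phi t * s) t = karg t s.
Proof.
move=> /andP[s0 s1]; rewrite /karg ger0_norm; last first.
  by rewrite subr_ge0 expr2 mulr_ile1.
rewrite /eta /phi /sh exp_halfE expN_half; have := expR_gt0 (- (t / 2)).
by move: (expR _) => e e0; field; rewrite gt_eqF.
Qed.

Lemma dkarg t s : is_derive t (1 : R) (karg^~ s) (sh t * ch t / 2 * `|1 - s ^+ 2|).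
Proof.
apply: (is_derive_eq (dmul (dmul (dmul (dsh t) (dsh t)) (dcst (4^-1 : R) t 1)) (dcst `|1 - s ^+ 2| t 1))).
by field.
Qed.

Lemma ct_sh : continuous sh.
Proof. by move=> t; exact: is_derive_continuous (dsh t). Qed.

Lemma ct_phi : continuous (phi : R -> R).
Proof. by move=> t; exact: is_derive_continuous (dphi t). Qed.

Lemma ct_tau (T : topologicalType) (f : T -> R) : continuous f -> continuous (fun z => `|1 - f z ^+ 2|).
Proof.
move=> cf z; apply: cvg_norm.
have C : continuous (fun z => 1 - f z ^+ 2).
  by apply: ctD; [exact: ctC|apply: ctN; exact: ctX].
exact: C.
Qed.

Lemma ct_karg (T : topologicalType) (f g : T -> R) : continuous f -> continuous g ->
  continuous (fun z => karg (f z) (g z)).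
Proof.
move=> cf cg; rewrite /karg; apply: ctM; last exact: ct_tau.
by apply: ctM; [apply: ctX; exact: ctcomp ct_sh cf|exact: ctC].
Qed.

End TimeFunctions.

Section Transform.
Context {R : realType} {n : nat}.
Local Notation mu := (@lebesgue_measure R).
Local Notation axes := (@spacetime_axes R n).
Local Notation dt := (time_dir n : 'rV[R]_n * R).
Local Notation P := (('rV[R]_n * R)%type).
Variables (m2 c : R) (f f1 f2 : R -> R).
Hypothesis HK : radial_kernel m2 c f f1 f2.
Implicit Types (g h : P -> R).

Let Df x : profile_dom x -> is_derive x (1 : R) f (f1 x).
Proof. by have [_ H _ _ _] := HK; exact: H. Qed.

Let Df1 x : profile_dom x -> is_derive x (1 : R) f1 (f2 x).
Proof. by have [_ _ H _ _] := HK; exact: H. Qed.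

Let Cf k : Cr profile_dom k f. Proof. by have [/(_ k)[]] := HK. Qed.
Let Cf1 k : Cr profile_dom k f1. Proof. by have [/(_ k)[]] := HK. Qed.

Definition slice g (z : P * R) : R := g (z.1.1, phi z.1.2 * z.2).
Definition kat (F : R -> R) (z : P * R) : R := F (karg z.1.2 z.2).

(** The constant 2, the kernel's factor e^(t/2) / 2 and the factor phi(t) are merged into [sh]. *)
Definition integrand g (z : P * R) : R := slice g z * (sh z.1.2 * kat f z).
Definition transform g (p : P) : R := \int[mu]_(s in `[0, 1]) integrand g (p, s).

Lemma ct_t : continuous (fun z : P * R => z.1.2).
Proof. by apply: ctsnd; apply: ctfst; exact: ctI. Qed.

Lemma ct_s : continuous (fun z : P * R => z.2).
Proof. by apply: ctsnd; exact: ctI. Qed.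

Lemma ct_tslice g : continuous g -> continuous (slice g).
Proof.
move=> cg; apply: ctcomp cg _; apply: ctpair; first by apply: ctfst; apply: ctfst; exact: ctI.
by apply: ctM ct_s; exact: ctcomp ct_phi ct_t.
Qed.

Lemma ct_kat F : Cr profile_dom 0 F -> continuous (kat F).
Proof.
move=> [CF _] z; apply: (continuous_comp (f := fun z : P * R => karg z.1.2 z.2)).
  exact: (ct_karg ct_t ct_s).
exact: CF (karg_dom _ _).
Qed.

Lemma Ck_t k : Ck (paxes R axes) k (fun z : P * R => z.1.2).
Proof.
apply: (@Ck_linear _ _ _ _ _ (fun z : P * R => z.1.2)); first exact: ct_t.
by move=> v _ x h.
Qed.

Lemma Ck_onlys k (F : R -> R) : continuous F -> Ck (paxes R axes) k (fun z : P * R => F z.2).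
Proof.
move=> cF; apply: (@Ck_linear _ _ _ _ _ (fun=> 0)); first exact: ctcomp cF ct_s.
by move=> v [u _ <-] x h; rewrite mulr0 addr0 /= scaler0 addr0.
Qed.

Lemma Ck_expRt k (a : R) : Ck (paxes R axes) k (fun z : P * R => expR (a * z.1.2)).
Proof.
apply: (@Ck_compr _ _ _ setT) => //; first exact: Cr_expR.
by apply: CkZ; exact: Ck_t.
Qed.

Lemma Ck_sh k : Ck (paxes R axes) k (fun z : P * R => sh z.1.2).
Proof.
have := CkB (Ck_expRt k 2^-1) (Ck_expRt k (- 2^-1)).
rewrite (_ : (fun z => _) = (fun z : P * R => sh z.1.2)) //.
by apply/funext => z; rewrite /sh mulNr mulrC.
Qed.

Lemma Ck_phi k : Ck (paxes R axes) k (fun z : P * R => phi z.1.2).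
Proof.
have := CkB (Ck_cst _ k 1) (Ck_expRt k (- 1)).
rewrite (_ : (fun z => _) = (fun z : P * R => phi z.1.2)) //.
by apply/funext => z; rewrite /phi mulN1r.
Qed.

Lemma Ck_slice g k : Ck axes k g -> Ck (paxes R axes) k (slice g).
Proof.
apply: (@Ck_reparam _ _ _ _ _ _ _ (fun z : P * R => z.1.1) (fun z : P * R => phi z.1.2 * z.2)).
- by apply: ctfst; apply: ctfst; exact: ctI.
- by apply: CkM; [exact: Ck_phi|exact: (Ck_onlys k (F := fun s => s)) ctI].
- move=> b [v [[i _ <-]|->] <-].
    left; exists (basis_vec i); first by left; exists i.
    by move=> z h /=; rewrite !scaler0 !addr0.
  right; split; first by right.
  by move=> z h /=; rewrite scaler0 addr0.
Qed.

Lemma Ck_kat F k : (forall k, Cr profile_dom k F) -> Ck (paxes R axes) k (kat F).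
Proof.
move=> CF; apply: (Ck_compr (I := profile_dom)) (CF k) _; first by move=> z; exact: karg_dom.
apply: CkM; first by apply: CkM; [apply: CkX; exact: Ck_sh|exact: Ck_cst].
by apply: (Ck_onlys k (F := fun s => `|1 - s ^+ 2|)); apply: ct_tau; exact: ctI.
Qed.

Lemma smooth_integrand g : smooth axes g -> smooth (paxes R axes) (integrand g).
Proof.
move=> Sg k; apply: CkM; first exact: Ck_slice.
by apply: CkM; [exact: Ck_sh|exact: Ck_kat].
Qed.

Lemma smooth_transform g : smooth axes g -> smooth axes (transform g).
Proof. by move=> Sg k; apply: Ck_int => //; exact: smooth_integrand. Qed.

Lemma is_derive_t (G : P * R -> R) x t s d :
  is_derive t (1 : R) (fun t => G ((x, t), s)) d -> is_derive ((x, t), s) (dt, 0) G d.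
Proof.
move=> D; apply: dlineP.
have E (h : R) : ((x, t), s) + h *: ((dt, 0) : P * R) = ((x, t + h *: (1 : R)), s).
  by congr pair; [congr pair; rewrite /= ?scaler0 ?addr0|rewrite /= scaler0 addr0].
under eq_fun do rewrite E.
by apply: (dline (f := fun t : R => G ((x, t), s))); rewrite scale0r addr0.
Qed.

Lemma dslice g x t s : smooth axes g ->
  is_derive t (1 : R) (fun t => slice g ((x, t), s)) (slice ('D_dt g) ((x, t), s) * (expR (- t) * s)).
Proof.
move=> Sg; rewrite /slice /=.
have D1 := is_derive_time (smooth_is_derive (x, phi t * s) Sg time_axis).
have D2 := dmul (dphi t) (dcst s t (1 : R)).
apply: (is_derive_eq (dcomp1 (h := fun r => g (x, r)) (f := fun t : R => phi t * s) D1 D2)).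
by rewrite mulr0 addr0.
Qed.

Lemma dkat (F F1 : R -> R) (x : 'rV[R]_n) t s : (forall y, profile_dom y -> is_derive y (1 : R) F (F1 y)) ->
  is_derive t (1 : R) (fun t => kat F ((x, t), s))
    (kat F1 ((x, t), s) * (sh t * ch t / 2 * `|1 - s ^+ 2|)).
Proof.
move=> DF; exact: (dcomp1 (f := karg^~ s) (DF _ (karg_dom t s)) (dkarg t s)).
Qed.

Definition kat_t (z : P * R) : R :=
  ch z.1.2 * kat f z + sh z.1.2 * (kat f1 z * (sh z.1.2 * ch z.1.2 / 2 * `|1 - z.2 ^+ 2|)).

Definition kat_tt (z : P * R) : R :=
  sh z.1.2 / 4 * kat f z
  + 2 * ch z.1.2 * (kat f1 z * (sh z.1.2 * ch z.1.2 / 2 * `|1 - z.2 ^+ 2|))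
  + sh z.1.2 * (kat f2 z * (sh z.1.2 * ch z.1.2 / 2 * `|1 - z.2 ^+ 2|) ^+ 2
                + kat f1 z * ((ch z.1.2 ^+ 2 + sh z.1.2 ^+ 2 / 4) / 2 * `|1 - z.2 ^+ 2|)).

Definition integrand_t g (z : P * R) : R :=
  slice ('D_dt g) z * (expR (- z.1.2) * z.2) * (sh z.1.2 * kat f z) + slice g z * kat_t z.

Definition integrand_tt g (z : P * R) : R :=
  (slice ('D_dt ('D_dt g)) z * (expR (- z.1.2) * z.2) ^+ 2 - slice ('D_dt g) z * (expR (- z.1.2) * z.2))
    * (sh z.1.2 * kat f z)
  + 2 * (slice ('D_dt g) z * (expR (- z.1.2) * z.2)) * kat_t z + slice g z * kat_tt z.

Lemma dshkat x t s : is_derive t (1 : R) (fun t => sh t * kat f ((x, t), s)) (kat_t ((x, t), s)).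
Proof. exact: (dmul (dsh t) (dkat x t s Df)). Qed.

Lemma dkat_t x t s : is_derive t (1 : R) (fun t => kat_t ((x, t), s)) (kat_tt ((x, t), s)).
Proof.
have D1 := dmul (dch t) (dkat x t s Df).
have D2 := dmul (dsh t) (dmul (dkat x t s Df1)
  (dmul (dmul (dmul (dsh t) (dch t)) (dcst (2^-1 : R) t 1)) (dcst `|1 - s ^+ 2| t 1))).
apply: (is_derive_eq (dadd D1 D2)); by rewrite /kat_tt /=; field.
Qed.

Lemma integrand_dt g x t s : smooth axes g ->
  is_derive ((x, t), s) (dt, 0) (integrand g) (integrand_t g ((x, t), s)).
Proof.
by move=> Sg; apply: is_derive_t; exact: (dmul (dslice x t s Sg) (dshkat x t s)).
Qed.

Lemma integrand_dtt g x t s : smooth axes g ->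
  is_derive ((x, t), s) (dt, 0) (integrand_t g) (integrand_tt g ((x, t), s)).
Proof.
move=> Sg; apply: is_derive_t.
have D1 := dslice x t s (smooth_derive Sg time_axis).
have D2 := dmul (dexpN t) (dcst s t (1 : R)).
have D3 := dmul (dslice x t s Sg) (dkat_t x t s).
apply: (is_derive_eq (dadd (dmul (dmul D1 D2) (dshkat x t s)) D3)).
by rewrite /integrand_tt /=; ring.
Qed.

Lemma ct_integrand_t g : smooth axes g -> continuous (integrand_t g).
Proof.
move=> Sg; have C := smooth_cont (smooth_derive (smooth_integrand Sg) (_ : paxes R axes (dt, 0))).
have E : 'D_(dt, 0) (integrand g) = integrand_t g.
  by apply/funext => -[[x t] s]; exact: derive_at (integrand_dt x t s Sg).
by rewrite -E; apply: C; exists dt => //; exact: time_axis.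
Qed.

Lemma ct_integrand_tt g : smooth axes g -> continuous (integrand_tt g).
Proof.
move=> Sg; have A : paxes R axes (dt, 0) by exists dt => //; exact: time_axis.
have E : 'D_(dt, 0) (integrand g) = integrand_t g.
  by apply/funext => -[[x t] s]; exact: derive_at (integrand_dt x t s Sg).
have S1 : smooth (paxes R axes) (integrand_t g).
  by rewrite -E; exact: smooth_derive (smooth_integrand Sg) A.
have E2 : 'D_(dt, 0) (integrand_t g) = integrand_tt g.
  by apply/funext => -[[x t] s]; exact: derive_at (integrand_dtt x t s Sg).
by rewrite -E2; exact: smooth_cont (smooth_derive S1 A).
Qed.

Lemma transform_dt g p : smooth axes g ->
  'D_dt (transform g) p = \int[mu]_(s in `[0, 1]) integrand_t g (p, s).
Proof.
move=> Sg; apply: derive_at; apply: (@int_derive _ _ (integrand g) (integrand_t g)) => //.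
- exact: smooth_cont (smooth_integrand Sg).
- exact: ct_integrand_t.
- by move=> [x t] s; exact: integrand_dt.
Qed.

Lemma transform_dtt g p : smooth axes g ->
  'D_dt ('D_dt (transform g)) p = \int[mu]_(s in `[0, 1]) integrand_tt g (p, s).
Proof.
move=> Sg.
have E : 'D_dt (transform g) = (fun p => \int[mu]_(s in `[0, 1]) integrand_t g (p, s)).
  by apply/funext => q; exact: transform_dt.
rewrite E; apply: derive_at; apply: (@int_derive _ _ (integrand_t g) (integrand_tt g)) => //.
- exact: ct_integrand_t.
- exact: ct_integrand_tt.
- by move=> [x t] s; exact: integrand_dtt.
Qed.

Lemma integrand_space g i x t s : smooth axes g ->
  is_derive ((x, t), s) (space_dir i, 0) (integrand g) (integrand ('D_(space_dir i) g) ((x, t), s)).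
Proof.
move=> Sg; apply: dlineP.
have E (h : R) : ((x, t), s) + h *: ((space_dir i, 0) : P * R) = ((x + h *: basis_vec i, t), s).
  by congr pair; [congr pair; rewrite /= ?scaler0 ?addr0|rewrite /= scaler0 addr0].
under eq_fun do rewrite E.
have D1 := smooth_is_derive (x + 0 *: basis_vec i, phi t * s) Sg (space_axis i).
have D2 := dline (f := fun y => g (y, phi t * s)) (is_derive_space D1).
apply: (is_derive_eq (dmul D2 (dcst (sh t * kat f ((x, t), s)) (0 : R) (1 : R)))).
by rewrite mulr0 addr0 scale0r addr0.
Qed.

Lemma transform_space g i : smooth axes g ->
  'D_(space_dir i) (transform g) = transform ('D_(space_dir i) g).
Proof.
move=> Sg; apply/funext => p; apply: derive_at.
apply: (@int_derive _ _ (integrand g) (integrand ('D_(space_dir i) g))) => //.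
- exact: smooth_cont (smooth_integrand Sg).
- exact: smooth_cont (smooth_integrand (smooth_derive Sg (space_axis i))).
- by move=> [x t] s; exact: integrand_space.
Qed.

Lemma ct_integrand_s g p : smooth axes g -> continuous (fun s => integrand g (p, s)).
Proof. by move=> Sg; apply: cont_pair; exact: smooth_cont (smooth_integrand Sg). Qed.

Lemma transformD g h p : smooth axes g -> smooth axes h ->
  transform (fun q => g q + h q) p = transform g p + transform h p.
Proof.
move=> Sg Sh; rewrite -intD; [|exact: ct_integrand_s..].
by apply: int_eq => s _; rewrite /integrand /slice mulrDl.
Qed.

Lemma transformZ (a : R) g p : smooth axes g ->
  transform (fun q => a * g q) p = a * transform g p.
Proof.
move=> Sg; rewrite -intZ; last exact: ct_integrand_s.
by apply: int_eq => s _; rewrite /integrand /slice [RHS]mulrA.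
Qed.

Lemma transform_sum (I : Type) (r : seq I) (g : I -> P -> R) p : (forall i, smooth axes (g i)) ->
  transform (fun q => \sum_(i <- r) g i q) p = \sum_(i <- r) transform (g i) p.
Proof.
move=> Sg; elim: r => [|i r IHr].
  rewrite big_nil; have Z : smooth axes (fun=> 0) by move=> k; exact: Ck_cst.
  rewrite -[RHS](mul0r (transform (fun=> 0) p)) -(transformZ 0 p Z).
  by apply: int_eq => s _; rewrite /integrand /slice big_nil mulr0.
rewrite big_cons -IHr -transformD //; last by move=> k; apply: Ck_sum => j; exact: Sg.
by apply: int_eq => s _; rewrite /integrand /slice big_cons.
Qed.

Lemma transform_laplacian g p : smooth axes g ->
  laplacian_x (transform g) p = transform (laplacian_x g) p.
Proof.
move=> Sg; rewrite {2}/laplacian_x transform_sum; last first.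
  by move=> i; exact: smooth_derive (smooth_derive Sg (space_axis i)) (space_axis i).
apply: eq_bigr => i _.
have E1 := transform_space i Sg.
have E2 := transform_space i (smooth_derive Sg (space_axis i)).
exact (congr1 (fun F => F p) (eq_trans (congr1 (fun F => 'D_(space_dir i) F) E1) E2)).
Qed.

Lemma dslice_s g x t s : smooth axes g ->
  is_derive s (1 : R) (fun s => slice g ((x, t), s)) (slice ('D_dt g) ((x, t), s) * phi t).
Proof.
move=> Sg; rewrite /slice /=.
have D1 := is_derive_time (smooth_is_derive (x, phi t * s) Sg time_axis).
have D2 := dcmul (phi t) (is_derive_id s (1 : R)).
apply: (is_derive_eq (dcomp1 (h := fun r => g (x, r)) (f := fun s : R => phi t * s) D1 D2)).
by rewrite mulr1.
Qed.

Lemma kargE (t s : R) : 0 <= s <= 1 -> karg t s = sh t ^+ 2 / 4 * (1 - s ^+ 2) :> R.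
Proof.
move=> /andP[s0 s1]; rewrite /karg ger0_norm // subr_ge0 expr2; exact: mulr_ile1.
Qed.

Lemma dkarg_s (t s : R) : is_derive s (1 : R) (fun s => sh t ^+ 2 / 4 * (1 - s ^+ 2)) (sh t ^+ 2 / 4 * (- (2 * s))).
Proof.
apply: (is_derive_eq (dcmul _ (dsub (dcst (1 : R) s 1) (dmul (is_derive_id s (1 : R)) (is_derive_id s (1 : R)))))).
by congr (_ * _); ring.
Qed.

(** The absolute value in [karg] has a corner at s = 1; the polynomial agrees with it on [0, 1] and
    is differentiable there. A two-sided derivative at s = 1 requires F to be differentiable at 0,
    an interior point of [profile_dom]. *)
Lemma dkat_s (F F1 : R -> R) (x : 'rV[R]_n) (t s : R) : (forall y, profile_dom y -> is_derive y (1 : R) F (F1 y)) ->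
  0 <= s <= 1 ->
  is_derive s (1 : R) (fun s => F (sh t ^+ 2 / 4 * (1 - s ^+ 2)))
    (kat F1 ((x, t), s) * (sh t ^+ 2 / 4 * (- (2 * s)))).
Proof.
move=> DF s01; have := DF _ (karg_dom t s); rewrite /kat /= (kargE t s01) => D.
exact: (dcomp1 (f := fun s : R => sh t ^+ 2 / 4 * (1 - s ^+ 2)) D (dkarg_s t s)).
Qed.

Lemma kat_ode (x : 'rV[R]_n) (t s : R) : 0 <= s <= 1 -> let X := sh t ^+ 2 / 4 * (1 - s ^+ 2) in let z : P * R := ((x, t), s) in
  X * (1 + X) * kat f2 z + (1 + 2 * X) * kat f1 z + (4^-1 + m2) * kat f z = 0.
Proof.
move=> s01 X z; have [_ _ _ H _] := HK.
by rewrite /X -(kargE t s01); exact: H (karg_dom t s).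
Qed.

(* The antiderivative in s that makes the transform intertwine the two equations. *)
Definition flux g x t (s : R) : R := (1 - s ^+ 2) *
  (sh t / 2 * (s * slice g ((x, t), s) * f1 (sh t ^+ 2 / 4 * (1 - s ^+ 2)))
   - expR (- (t / 2)) ^+ 3 * (slice ('D_dt g) ((x, t), s) * f (sh t ^+ 2 / 4 * (1 - s ^+ 2)))).

Lemma dflux g x (t s : R) : smooth axes g -> 0 <= s <= 1 ->
  is_derive s (1 : R) (flux g x t)
    (integrand_tt g ((x, t), s) - expR (- (2 * t)) * integrand ('D_dt ('D_dt g)) ((x, t), s)
     + m2 * integrand g ((x, t), s)).
Proof.
move=> Sg s01.
have D0 := dsub (dcst (1 : R) s 1) (dmul (is_derive_id s (1 : R)) (is_derive_id s (1 : R))).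
have D1 := dmul (dmul (is_derive_id s (1 : R)) (dslice_s x t s Sg)) (dkat_s x t Df1 s01).
have D2 := dmul (dslice_s x t s (smooth_derive Sg time_axis)) (dkat_s x t Df s01).
have D := dmul D0 (dsub (dcmul (sh t / 2) D1) (dcmul (expR (- (t / 2)) ^+ 3) D2)).
apply: (is_derive_eq D); clear D D0 D1 D2.
have /= ode := kat_ode x t s01.
rewrite -(kargE t s01) -[f (karg t s)]/(kat f ((x, t), s)) -[f1 (karg t s)]/(kat f1 ((x, t), s)).
rewrite /integrand_tt /integrand /kat_t /kat_tt /=.
have -> : `|1 - s ^+ 2| = 1 - s ^+ 2.
  by case/andP: s01 => s0 s1; rewrite ger0_norm // subr_ge0 expr2; exact: mulr_ile1.
move: (kat f _) (kat f1 _) (kat f2 _) ode => F F1 F2 ode.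
move: (slice ('D_dt ('D_dt g)) _) (slice ('D_dt g) _) (slice g _) => y2 y1 y.
apply/eqP; rewrite -subr_eq0; apply/eqP.
(* The two sides differ by - sh(t) g times the equation of the profile; everything else is rational
   in e^(-t/2). *)
apply: (eq_trans _ (mulr0 (- sh t * y))); rewrite -[X in _ = _ * X]ode; clear ode.
have -> : expR (- (2 * t)) = expR (- (t / 2)) ^+ 4 :> R.
  by rewrite -expRM_natl; congr expR; rewrite mulr_natl; field.
rewrite /sh /ch /phi (expN_half t) (exp_halfE t).
have := expR_gt0 (- (t / 2)); move: (expR _) => e e0; have {}e0 : e != 0 by rewrite gt_eqF.
by field.
Qed.

Lemma transform_pde g h x t : smooth axes g -> smooth axes h ->
  (forall p, 'D_dt ('D_dt g) p = laplacian_x g p + h p) -> (forall x, 'D_dt g (x, 0) = 0) ->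
  'D_dt ('D_dt (transform g)) (x, t) - expR (- (2 * t)) * laplacian_x (transform g) (x, t)
  + m2 * transform g (x, t) = expR (- (2 * t)) * transform h (x, t).
Proof.
move=> Sg Sh Eg g0.
have Sgg := smooth_derive (smooth_derive Sg time_axis) time_axis.
have Sl := smooth_laplacian Sg.
have ctt : continuous (fun s => integrand_tt g ((x, t), s)) by apply: cont_pair; exact: ct_integrand_tt.
have cgg := ct_integrand_s (p := (x, t)) Sgg; have cg := ct_integrand_s (p := (x, t)) Sg.
have I0 : 'D_dt ('D_dt (transform g)) (x, t) - expR (- (2 * t)) * transform ('D_dt ('D_dt g)) (x, t)
    + m2 * transform g (x, t) = 0.
  (* At s = 1 the factor 1 - s^2 vanishes; at s = 0 one term has a factor s, the other contains
     g_r(x, 0). *)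
  have F0 : flux g x t 1 - flux g x t 0 = 0.
    by rewrite /flux /slice /= !mulr0 g0 expr1n; ring.
  have ctK (k : R) (F : R -> R) : continuous F -> continuous (fun s => k * F s).
    by move=> cF; apply: ctM cF; exact: ctC.
  have c1 := ctK (expR (- (2 * t))) _ cgg; have c2 := ctK m2 _ cg.
  have c3 := ctD ctt (ctN c1); have c4 := ctD c3 c2.
  have E1 := intB 0 1 ctt c1; have E2 := intD 0 1 c3 c2.
  have Z1 := intZ (expR (- (2 * t))) 0 1 cgg; have Z2 := intZ m2 0 1 cg.
  have FT := FTC_itv ler01 c4 (fun s s01 => dflux x t Sg s01).
  rewrite -F0 -FT; refine (eq_trans _ (esym E2)).
  by rewrite E1 Z1 Z2 (transform_dtt _ Sg).
have E : transform ('D_dt ('D_dt g)) (x, t) = transform (laplacian_x g) (x, t) + transform h (x, t).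
  by rewrite -transformD //; apply: int_eq => s _; rewrite /integrand /slice Eg.
move: I0; rewrite E (transform_laplacian _ Sg).
move: ('D_dt _ _) (transform _ _) (transform _ _) (transform _ _) => a b d e I0.
by apply/eqP; rewrite -subr_eq0; apply/eqP; rewrite -[RHS]I0; ring.
Qed.

Lemma sh0 : sh 0 = 0 :> R.
Proof. by rewrite /sh mul0r oppr0 subrr. Qed.

Lemma ch0 : ch 0 = 1 :> R.
Proof. by rewrite /ch mul0r oppr0 expR0; field. Qed.

Lemma phi0 : phi 0 = 0 :> R.
Proof. by rewrite /phi oppr0 expR0 subrr. Qed.

Lemma transform0 g x : transform g (x, 0) = 0.
Proof.
rewrite -[RHS](mul0r (1 - 0)) -int_cst //; apply: int_eq => s _.
by rewrite /integrand /= sh0 mul0r mulr0.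
Qed.

(** At t = 0 both [sh] and [phi] vanish and [ch] is 1, so the integrand reduces to the constant f(0)
    g(x, 0). *)
Lemma transform_dt0 g x : smooth axes g -> 'D_dt (transform g) (x, 0) = c * g (x, 0).
Proof.
move=> Sg; rewrite (transform_dt _ Sg) -[RHS]mulr1 -[X in _ * X](subr0 1) -int_cst //.
apply: int_eq => s _; have [_ _ _ _ f0] := HK.
rewrite /integrand_t /kat_t /slice /kat /karg /= sh0 ch0 phi0 expr2 !mul0r f0; ring.
Qed.

End Transform.

(** * The representation formula *)

Section TransformSolution.
Context {R : realType} {n : nat}.
Local Notation mu := (@lebesgue_measure R).
Local Notation axes := (@spacetime_axes R n).
Local Notation dt := (time_dir n : 'rV[R]_n * R).
Local Notation P := (('rV[R]_n * R)%type).

Lemma smoothD (a b : P -> R) : smooth axes a -> smooth axes b -> smooth axes (fun p => a p + b p).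
Proof. by move=> Sa Sb k; exact: CkD. Qed.

Lemma derive_smoothD (a b : P -> R) v : axes v -> smooth axes a -> smooth axes b ->
  'D_v (fun p => a p + b p) = (fun p => 'D_v a p + 'D_v b p).
Proof.
move=> Av Sa Sb; apply/funext => p; apply: derive_at.
exact: (dadd (smooth_is_derive p Sa Av) (smooth_is_derive p Sb Av)).
Qed.

Lemma derive2_smoothD (a b : P -> R) v p : axes v -> smooth axes a -> smooth axes b ->
  'D_v ('D_v (fun p => a p + b p)) p = 'D_v ('D_v a) p + 'D_v ('D_v b) p.
Proof.
move=> Av Sa Sb.
refine (eq_trans (congr1 (fun F => 'D_v F p) (derive_smoothD Av Sa Sb)) _).
exact (congr1 (fun F => F p) (derive_smoothD Av (smooth_derive Sa Av) (smooth_derive Sb Av))).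
Qed.

Lemma laplacianD (a b : P -> R) p : smooth axes a -> smooth axes b ->
  laplacian_x (fun p => a p + b p) p = laplacian_x a p + laplacian_x b p.
Proof.
move=> Sa Sb; rewrite /laplacian_x -big_split /=; apply: eq_bigr => i _.
exact: derive2_smoothD (space_axis i) Sa Sb.
Qed.

Variables (m2 c : R) (f f1 f2 : R -> R).
Hypothesis HK : radial_kernel m2 c f f1 f2.
Variables (g0 g1 : 'rV[R]_n -> R) (V0 V1 : P -> R).
Hypotheses (W0 : wave_flow g0 V0) (W1 : wave_flow g1 V1).

Local Notation transf := (@transform R n f).
Let q2 (t : R) : R := expR (- (2 * t)).

Let S0 : smooth axes V0. Proof. by case: W0. Qed.
Let S1 : smooth axes V1. Proof. by case: W1. Qed.

Lemma transform_zero p : transf (fun=> 0 : R) p = 0.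
Proof.
rewrite -[RHS](mul0r (1 - 0)) -int_cst //; apply: int_eq => s _.
by rewrite /integrand /slice mul0r.
Qed.

Lemma transform_wave_pde g V x t : wave_flow g V ->
  'D_dt ('D_dt (transf V)) (x, t) = q2 t * laplacian_x (transf V) (x, t) - m2 * transf V (x, t).
Proof.
move=> [SV EV _ DV]; have Sz : smooth axes (fun=> 0 : R) by move=> k; exact: Ck_cst.
have H := transform_pde HK x t SV Sz (fun p => eq_trans (EV p) (esym (addr0 _))) DV.
move: H; rewrite transform_zero mulr0.
move: ('D_dt _ _) (laplacian_x _ _) (transf _ _) => a b d.
rewrite /q2 => H; apply/eqP; rewrite -subr_eq0; apply/eqP; rewrite -[RHS]H; ring.
Qed.

Let w0 := transf V0.
Let Sw0 : smooth axes w0. Proof. exact: (smooth_transform HK). Qed.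
(** The function r v_r for v = V0. *)
Let euler0 := euler_op 0 V0.
Let Se : smooth axes euler0. Proof. exact: smooth_euler. Qed.

Lemma dq2 (p : P) : is_derive p dt (fun p : P => q2 p.2) (- 2 * q2 p.2).
Proof.
have D1 := dopp (dcmul 2 (is_derive_time_coord p)).
by apply: (is_derive_eq (dcomp1 (is_derive_expR _) D1)); rewrite /q2; ring.
Qed.

(** The additional Laplacian comes from the time derivative of the coefficient e^(-2t). *)
Lemma transform_dt_pde p :
  'D_dt ('D_dt ('D_dt w0)) p = q2 p.2 * laplacian_x ('D_dt w0) p - 2 * q2 p.2 * laplacian_x w0 p
  - m2 * 'D_dt w0 p.
Proof.
have E : 'D_dt ('D_dt w0) = (fun p => q2 p.2 * laplacian_x w0 p - m2 * w0 p).
  by apply/funext => -[x t]; exact: transform_wave_pde W0.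
refine (eq_trans (congr1 (fun F => 'D_dt F p) E) _); apply: derive_at.
have D1 := smooth_is_derive p (smooth_laplacian Sw0) time_axis.
have D2 := smooth_is_derive p Sw0 time_axis.
have D := dsub (dmul (dq2 p) D1) (dcmul m2 D2).
apply: (is_derive_eq D); clear D; rewrite (laplacian_time p Sw0).
move: ('D_dt _ _) ('D_dt _ _) (laplacian_x _ _) => a b d; ring.
Qed.

Lemma euler0_dt : 'D_dt euler0 = (fun p => 'D_dt V0 p + p.2 * laplacian_x V0 p).
Proof.
have [_ EV _ _] := W0; apply/funext => p; apply: derive_at.
have D1 := smooth_is_derive p S0 time_axis.
have D2 := smooth_is_derive p (smooth_derive S0 time_axis) time_axis.
have D := dadd (dcmul 0 D1) (dmul (is_derive_time_coord p) D2).
by apply: (is_derive_eq D); rewrite mul0r add0r mul1r EV.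
Qed.

(** The commutator of d_rr with r d_r is 2 d_rr, and V0 satisfies the wave equation. *)
Lemma euler0_dtt p : 'D_dt ('D_dt euler0) p = laplacian_x euler0 p + 2 * laplacian_x V0 p.
Proof.
have [_ EV _ _] := W0.
refine (eq_trans (congr1 (fun F => 'D_dt F p) euler0_dt) _); apply: derive_at.
have D1 := smooth_is_derive p (smooth_derive S0 time_axis) time_axis.
have D2 := smooth_is_derive p (smooth_laplacian S0) time_axis.
have D := dadd D1 (dmul (is_derive_time_coord p) D2).
apply: (is_derive_eq D); clear D; rewrite EV -(laplacian_time p S0) (laplacian_euler 0 p S0).
move: (laplacian_x _ _) (laplacian_x _ _) => a b; ring.
Qed.

Let we := transf euler0.
Let Swe : smooth axes we. Proof. exact: (smooth_transform HK). Qed.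

Lemma transform_euler_pde x t :
  'D_dt ('D_dt we) (x, t) = q2 t * laplacian_x we (x, t) - m2 * we (x, t) + 2 * q2 t * laplacian_x w0 (x, t).
Proof.
have Sl := smooth_laplacian S0.
have Sh : smooth axes (fun p => 2 * laplacian_x V0 p) by move=> k; exact: CkZ.
have D0 y : 'D_dt euler0 (y, 0) = 0.
  have [_ _ _ DV] := W0.
  refine (eq_trans (congr1 (fun F => F (y, 0)) euler0_dt) _) => /=.
  by rewrite mul0r addr0; exact: DV.
have H := transform_pde HK x t Se Sh euler0_dtt D0.
move: H; rewrite (transformZ HK) // -(transform_laplacian HK) // -/we -/w0.
move: ('D_dt _ _) (laplacian_x _ _) (laplacian_x _ _) (we _) => a b d e.
rewrite /q2 => H; apply/eqP; rewrite -subr_eq0; apply/eqP.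
apply: (eq0_sub H); ring.
Qed.

Definition representation (p : P) : R := transf V1 p + ('D_dt w0 p + we p).

Let Sw1 : smooth axes (transf V1). Proof. exact: (smooth_transform HK). Qed.
Let Sdw0 : smooth axes ('D_dt w0). Proof. exact: smooth_derive Sw0 time_axis. Qed.
Let Sdw : smooth axes (fun p => 'D_dt w0 p + we p). Proof. exact: smoothD. Qed.

Lemma smooth_representation : smooth axes representation.
Proof. exact: (smoothD Sw1 Sdw). Qed.

Lemma representation_pde x t :
  'D_dt ('D_dt representation) (x, t) - q2 t * laplacian_x representation (x, t)
  + m2 * representation (x, t) = 0.
Proof.
have E1 := eq_trans (derive2_smoothD (x, t) time_axis Sw1 Sdw)
  (congr1 (fun z => _ + z) (derive2_smoothD (x, t) time_axis Sdw0 Swe)).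
have E2 := eq_trans (laplacianD (x, t) Sw1 Sdw)
  (congr1 (fun z => _ + z) (laplacianD (x, t) Sdw0 Swe)).
rewrite /representation E1 E2.
rewrite (transform_wave_pde x t W1) transform_dt_pde transform_euler_pde /=.
move: (laplacian_x _ _) (laplacian_x _ _) (laplacian_x _ _) (laplacian_x _ _) => a b d e.
ring.
Qed.

Lemma representation_init x : representation (x, 0) = c * g0 x.
Proof.
have [_ _ I0 _] := W0.
by rewrite /representation /we /w0 !transform0 add0r addr0 (transform_dt0 HK) // I0.
Qed.

Lemma representation_init_t x : 'D_dt representation (x, 0) = c * g1 x.
Proof.
have [_ _ I1 _] := W1; have [_ _ _ DV] := W0.
have E1 := eq_trans (congr1 (fun F => F (x, 0)) (derive_smoothD time_axis Sw1 Sdw))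
  (congr1 (fun z => _ + z) (congr1 (fun F => F (x, 0)) (derive_smoothD time_axis Sdw0 Swe))).
refine (eq_trans E1 _) => {E1}.
rewrite /we (transform_dt0 HK _ S1) (transform_dt0 HK _ Se) I1.
(* The second time derivative of w0 is eliminated by the equation, whose other terms are transforms
   and vanish at t = 0. *)
rewrite (transform_wave_pde x 0 W0) transform0 (transform_laplacian HK _ S0) transform0.
by rewrite /euler0 /euler_op /= !mul0r addr0 !mulr0 subr0 addr0 addr0.
Qed.

(** One real component of 2 K0 in the form given by [K0E], continuous up to s = 1. *)
Definition kernel0 t (s : R) : R :=
  expR (t / 2) * ((1 + (phi t * s) ^+ 2 - expR (- t) ^+ 2) / (4 * expR (- t)) * f1 (karg t s)
                  - 2^-1 * f (karg t s)).

Definition kernel1 t (s : R) : R := expR (t / 2) * f (karg t s).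

Let ct_karg_s (F : R -> R) t : Cr profile_dom 0 F -> continuous (fun s => F (karg t s)).
Proof. by move=> CF; exact: (cont_pair (p := (0 : 'rV[R]_n, t)) (ct_kat CF)). Qed.

Let ct_slice_s (V : P -> R) x t : continuous V -> continuous (fun s => V (x, phi t * s)).
Proof. by move=> cV; exact: (cont_pair (p := (x, t)) (ct_tslice cV)). Qed.

Lemma ct_kernel0 (V : P -> R) x t : continuous V ->
  continuous (fun s => V (x, phi t * s) * kernel0 t s * phi t).
Proof.
move=> cV; have [/(_ 0%N)[Cf Cf1 _] _ _ _ _] := HK.
apply: ctM; last exact: ctC.
apply: ctM; first exact: ct_slice_s.
apply: ctM; first exact: ctC.
apply: ctD; last by apply: ctN; apply: ctM; [exact: ctC|exact: ct_karg_s].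
apply: ctM; last exact: ct_karg_s.
apply: ctM; last exact: ctC.
apply: ctD; last exact: ctC.
by apply: ctD; [exact: ctC|apply: ctX; apply: ctM; [exact: ctC|exact: ctI]].
Qed.

Lemma ct_kernel1 (V : P -> R) x t : continuous V ->
  continuous (fun s => V (x, phi t * s) * kernel1 t s * phi t).
Proof.
move=> cV; have [/(_ 0%N)[Cf _ _] _ _ _ _] := HK.
apply: ctM; last exact: ctC.
apply: ctM; first exact: ct_slice_s.
by apply: ctM; [exact: ctC|exact: ct_karg_s].
Qed.

(** Integrating e^(t/2) d/ds (s v f) over [0, 1] leaves e^(t/2) v(x, phi(t)) f(0), the term outside
    the integrals in the formula; what is not of this form is the integrand with K0. *)
Let dprim x t (s : R) : 0 <= s <= 1 ->
  is_derive s (1 : R)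
    (fun s => expR (t / 2) * (s * (slice V0 ((x, t), s) * f (sh t ^+ 2 / 4 * (1 - s ^+ 2)))))
    (integrand_t f f1 V0 ((x, t), s) + integrand f euler0 ((x, t), s)
     - V0 (x, phi t * s) * kernel0 t s * phi t).
Proof.
move=> s01; have [_ Df _ _ _] := HK.
have D1 := dmul (dslice_s x t s S0) (dkat_s x t Df s01).
have D := dcmul (expR (t / 2)) (dmul (is_derive_id s (1 : R)) D1).
apply: (is_derive_eq D); clear D D1.
rewrite -(kargE t s01) /integrand_t /integrand /kat_t /kernel0 /= /slice /= /euler0 /euler_op /=.
rewrite /kat /=; have -> : `|1 - s ^+ 2| = 1 - s ^+ 2.
  by case/andP: s01 => s0 s1; rewrite ger0_norm // subr_ge0 expr2; exact: mulr_ile1.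
move: (f _) (f1 _) (V0 _) ('D_dt V0 _) => F F1 y y1.
rewrite /sh /ch /phi (expN_half t) (exp_halfE t).
have := expR_gt0 (- (t / 2)); move: (expR _) => e e0; have {}e0 : e != 0 by rewrite gt_eqF.
by field.
Qed.

Lemma representation_formula x t :
  representation (x, t) = c * (expR (t / 2) * V0 (x, phi t))
    + \int[mu]_(s in `[0, 1]) (V0 (x, phi t * s) * kernel0 t s * phi t)
    + \int[mu]_(s in `[0, 1]) (V1 (x, phi t * s) * kernel1 t s * phi t).
Proof.
have [_ Df _ _ fc] := HK.
have ck := ct_kernel0 (smooth_cont S0) (x := x) (t := t).
have ct := cont_pair (p := (x, t)) (ct_integrand_t HK S0).
have ce := cont_pair (p := (x, t)) (smooth_cont (smooth_integrand HK Se)).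
have c1 := ctD ct ce; have c2 := ctD c1 (ctN ck).
have FT := FTC_itv ler01 c2 (fun s s01 => dprim x t s01).
have E1 := intD 0 1 ct ce; have E2 := intB 0 1 c1 ck.
have E0 : representation (x, t) = transf V1 (x, t) +
  (\int[mu]_(s in `[0, 1]) integrand_t f f1 V0 ((x, t), s) + \int[mu]_(s in `[0, 1]) integrand f euler0 ((x, t), s)).
  by rewrite /representation (transform_dt HK _ S0).
have E3 : transf V1 (x, t) = \int[mu]_(s in `[0, 1]) (V1 (x, phi t * s) * kernel1 t s * phi t).
  apply: int_eq => s _; rewrite /integrand /kernel1 /slice /kat /=.
  rewrite /sh /phi (expN_half t) (exp_halfE t); move: (f _) (V1 _) => F y.
  by have := expR_gt0 (- (t / 2)); move: (expR _) => e e0; field; rewrite gt_eqF.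
have FT' := eq_trans (esym E2) FT; have E1' := esym E1.
rewrite E0 E3 E1'; move: FT'; rewrite /slice /= mul0r mulr0 subr0 !mulr1 expr1n subrr mulr0 fc mul1r.
move: (Rintegral _ _ _) (Rintegral _ _ _) (Rintegral _ _ _) => a b d H.
rewrite [LHS]addrC; congr (_ + _).
by apply/eqP; rewrite -subr_eq H; apply/eqP; ring.
Qed.

End TransformSolution.

(** * Uniqueness for the Klein-Gordon and wave problems *)

Section CauchyProblems.
Context {R : realType} {n : nat}.
Local Notation axes := (@spacetime_axes R n).
Local Notation dt := (time_dir n : 'rV[R]_n * R).
Local Notation P := (('rV[R]_n * R)%type).

Lemma derive2_CkB (a b : P -> R) v p : axes v -> Ck axes 2 a -> Ck axes 2 b ->
  'D_v (fun p => a p - b p) = (fun p => 'D_v a p - 'D_v b p) /\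
  'D_v ('D_v (fun p => a p - b p)) p = 'D_v ('D_v a) p - 'D_v ('D_v b) p.
Proof.
move=> Av Ca Cb.
have E : 'D_v (fun p => a p - b p) = (fun p => 'D_v a p - 'D_v b p).
  apply/funext => q; apply: derive_at.
  exact: (dsub (Ck_is_derive q Ca Av) (Ck_is_derive q Cb Av)).
split=> //; refine (eq_trans (congr1 (fun F => 'D_v F p) E) _); apply: derive_at.
exact: (dsub (Ck_is_derive p (Ck_derive Ca Av) Av) (Ck_is_derive p (Ck_derive Cb Av) Av)).
Qed.

Lemma cauchy_unique (c2 c2' : R -> R) (m2 : R) (U V : P -> R) :
  (forall t, is_derive t (1 : R) c2 (c2' t)) -> continuous c2' ->
  (forall t, 0 <= t -> c2' t <= 0) -> (forall t, 0 <= t -> 0 <= c2 t <= 1) ->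
  Ck axes 2 U -> Ck axes 2 V ->
  (forall x t, 0 <= t -> 'D_dt ('D_dt U) (x, t) - c2 t * laplacian_x U (x, t) + m2 * U (x, t) = 0) ->
  (forall x t, 0 <= t -> 'D_dt ('D_dt V) (x, t) - c2 t * laplacian_x V (x, t) + m2 * V (x, t) = 0) ->
  (forall x, U (x, 0) = V (x, 0)) -> (forall x, 'D_dt U (x, 0) = 'D_dt V (x, 0)) ->
  forall x t, 0 <= t -> U (x, t) = V (x, t).
Proof.
move=> Dc cc' c'0 c01 CU CV EU EV U0 U1 x t t0.
apply/eqP; rewrite -subr_eq0; apply/eqP.
apply: (hyperbolic_uniqueness (U := fun p => U p - V p) (m2 := m2) (CkB CU CV) Dc cc' c'0 c01) => //.
- move=> y s s0; have [_ E1] := derive2_CkB (y, s) time_axis CU CV.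
  have E2 : laplacian_x (fun p => U p - V p) (y, s) = laplacian_x U (y, s) - laplacian_x V (y, s).
    rewrite /laplacian_x -sumrB; apply: eq_bigr => i _.
    by have [] := derive2_CkB (y, s) (space_axis i) CU CV.
  rewrite E1 E2; move: (EU y s s0) (EV y s s0).
  move: ('D_dt _ _) ('D_dt _ _) (laplacian_x _ _) (laplacian_x _ _) (U _) (V _) => a b d e g h H1 H2.
  by apply: (@eq0_sub _ (b - c2 s * e + m2 * g) (a - c2 s * d + m2 * h)); [rewrite H1 H2|ring].
- by move=> y; rewrite U0 subrr.
- move=> y; have [E _] := derive2_CkB (y, 0) time_axis CU CV.
  refine (eq_trans (congr1 (fun F => F (y, 0)) E) _) => /=.
  by apply/eqP; rewrite subr_eq0; apply/eqP; exact: U1.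
Qed.

Lemma dq2R (t : R) : is_derive t (1 : R) (fun t : R => expR (- (2 * t))) (- (2 * expR (- (2 * t)))).
Proof.
have D1 := dopp (dcmul 2 (is_derive_id t (1 : R))).
by apply: (is_derive_eq (dcomp1 (f := fun t : R => - (2 * t)) (is_derive_expR _) D1)); ring.
Qed.

Lemma klein_gordon_unique (m2 : R) (U V : P -> R) : Ck axes 2 U -> Ck axes 2 V ->
  (forall x t, 0 <= t -> 'D_dt ('D_dt U) (x, t) - expR (- (2 * t)) * laplacian_x U (x, t) + m2 * U (x, t) = 0) ->
  (forall x t, 0 <= t -> 'D_dt ('D_dt V) (x, t) - expR (- (2 * t)) * laplacian_x V (x, t) + m2 * V (x, t) = 0) ->
  (forall x, U (x, 0) = V (x, 0)) -> (forall x, 'D_dt U (x, 0) = 'D_dt V (x, 0)) ->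
  forall x t, 0 <= t -> U (x, t) = V (x, t).
Proof.
apply: (cauchy_unique (c2 := fun t => expR (- (2 * t))) dq2R).
- move=> t; apply: is_derive_continuous (dopp (dcmul 2 (dq2R t))).
- by move=> t _; rewrite oppr_le0 mulr_ge0 // ltW // expR_gt0.
- by move=> t t0; rewrite expR_ge0 /= -expR0 ler_expR oppr_le0 mulr_ge0.
Qed.

Lemma wave_unique (U V : P -> R) : Ck axes 2 U -> Ck axes 2 V ->
  (forall x t, 0 <= t -> 'D_dt ('D_dt U) (x, t) - 1 * laplacian_x U (x, t) + 0 * U (x, t) = 0) ->
  (forall x t, 0 <= t -> 'D_dt ('D_dt V) (x, t) - 1 * laplacian_x V (x, t) + 0 * V (x, t) = 0) ->
  (forall x, U (x, 0) = V (x, 0)) -> (forall x, 'D_dt U (x, 0) = 'D_dt V (x, 0)) ->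
  forall x t, 0 <= t -> U (x, t) = V (x, t).
Proof.
apply: (cauchy_unique (c2 := fun=> 1) (c2' := fun=> 0)).
- exact: ctC.
- by [].
- by move=> t _; rewrite ler01 lexx.
Qed.

Lemma wave_flow_solution g V : wave_flow g V ->
  Ck axes 2 V /\ forall x t, 'D_dt ('D_dt V) (x, t) - 1 * laplacian_x V (x, t) + 0 * V (x, t) = 0.
Proof.
move=> [SV EV _ _]; split; first exact: SV.
by move=> x t; rewrite EV mul1r subrr mul0r addr0.
Qed.

Lemma wave_representation (f : 'rV[R]_n -> R) : (2 <= n)%N -> test_function f ->
  (exists v, wave_solution f v) /\
  forall v, wave_solution f v -> forall x t s, 0 < t -> 0 <= s <= 1 ->
    v_ f x (phi t * s) = v x (phi t * s).
Proof.
move=> n2 [Sf _]; have [V [WV EV]] := kirchhoff n2 Sf.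
have [CV PV] := wave_flow_solution WV; have [_ _ V0 V1] := WV.
split; first by exists (fun x t => V (x, t)); exists V; split=> // x t _; exact: PV.
move=> v [U [CU vU PU U0 U1]] x t s t0 /andP[s0 s1].
have r0 : 0 <= phi t * s by rewrite mulr_ge0 // subr_ge0 -expR0 ler_expR oppr_le0 ltW.
rewrite EV vU //; apply: (wave_unique CV CU) r0 => //.
- by move=> y; rewrite V0 U0.
- by move=> y; rewrite V1 U1.
Qed.

End CauchyProblems.

(** * From the complex kernels to real integrals *)

Section KernelIntegrals.
Context {R : realType}.
Local Notation mu := (@lebesgue_measure R).

(** A single point has measure zero. The form with s < b is made for [K0], which [K0_kernel0]
    identifies only for s < 1. *)
Lemma int_itv_open (g h : R -> R) (a b : R) : continuous h ->
  (forall s, a <= s < b -> g s = h s) ->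
  \int[mu]_(s in `[a, b]) g s = \int[mu]_(s in `[a, b]) h s.
Proof.
move=> ch gh.
have ih : mu.-integrable [set` Interval (BLeft a) (BLeft b)] (EFin \o h).
  apply: integrableS (cont_integrable a b ch) => //.
  by apply: subset_itvl; rewrite bnd_simp.
have ig : mu.-integrable [set` Interval (BLeft a) (BLeft b)] (EFin \o g).
  apply: (@eq_integrable _ _ _ mu _ _ (EFin \o h)) ih => // s.
  by rewrite inE /= in_itv /= => /gh ->.
rewrite -(Rintegral_itv_bndo_bndc ih) -(Rintegral_itv_bndo_bndc ig).
apply: eq_Rintegral => s; rewrite inE /= in_itv /=; exact: gh.
Qed.

Local Notation Cx := R[i].
Local Notation Re := (@complex.Re R).
Local Notation Im := (@complex.Im R).

Lemma Re_realM (x : R) (z : Cx) : Re (x%:C * z) = x * Re z.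
Proof. by rewrite ReM /= mul0r subr0. Qed.

Lemma Im_realM (x : R) (z : Cx) : Im (x%:C * z) = x * Im z.
Proof. by rewrite ImM /= mul0r addr0. Qed.

Lemma two_realC : (2 : Cx) = (2 : R)%:C.
Proof. exact: esym (rmorph_nat (real_complex R) 2). Qed.

Lemma half_realC : (2^-1 : Cx) = (2^-1 : R)%:C.
Proof. by rewrite two_realC -fmorphV. Qed.

Variable M : R.
Local Notation Pr := (fun x => Re (kprofile M x)).
Local Notation Pi := (fun x => Im (kprofile M x)).
Local Notation Pr1 := (fun x => Re (kprofile1 M x)).
Local Notation Pi1 := (fun x => Im (kprofile1 M x)).

Lemma K1_kernel1 (t s : R) : 0 <= s <= 1 ->
  K1 M (phi t * s) t = (2^-1)%:C * (kernel1 Pr t s +i* kernel1 Pi t s).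
Proof.
move=> s01; rewrite K1E karg_eta //; last exact: karg_dom.
by apply: complex_eq; rewrite ?Re_realM ?Im_realM /kernel1 /=; field.
Qed.

Lemma phi_gt0 (t : R) : 0 < t -> 0 < phi t.
Proof. by move=> t0; rewrite subr_gt0 -expR0 ltr_expR oppr_lt0. Qed.

Lemma K0_kernel0 (t s : R) : 0 < t -> 0 <= s < 1 ->
  K0 M (phi t * s) t = (2^-1)%:C * (kernel0 Pr Pr1 t s +i* kernel0 Pi Pi1 t s).
Proof.
move=> t0 /andP[s0 s1]; have p0 := phi_gt0 t0.
have s01 : 0 <= s <= 1 by rewrite s0 ltW.
have sn : phi t * s != phi t by rewrite lt_eqF // gtr_pMr.
have e0 : 0 < eta (phi t * s) t.
  rewrite karg_eta // kargE // mulr_gt0 //; last by rewrite subr_gt0 expr_lt1.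
  by rewrite divr_gt0 // exprn_gt0 // subr_gt0 ltr_expR; lra.
rewrite /K0 (negbTE sn) (K0E _ e0) half_realC karg_eta //.
apply: complex_eq.
  by rewrite !Re_realM ReDc ReNc !Re_realM /kernel0 /=; field; rewrite gt_eqF ?expR_gt0.
by rewrite !Im_realM ImDc ImNc !Im_realM /kernel0 /=; field; rewrite gt_eqF ?expR_gt0.
Qed.

Lemma cint_half (g : R -> Cx) (h1 h2 : R -> R) : continuous h1 -> continuous h2 ->
  (forall s, 0 <= s < 1 -> g s = (2^-1)%:C * (h1 s +i* h2 s)) ->
  2 * cint `[0, 1] g = (\int[mu]_(s in `[0, 1]) h1 s) +i* (\int[mu]_(s in `[0, 1]) h2 s).
Proof.
move=> c1 c2 Hg.
have ctK (F : R -> R) : continuous F -> continuous (fun s => 2^-1 * F s).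
  by move=> cF; apply: ctM cF; exact: ctC.
have Z1 := intZ 2^-1 0 1 c1; have Z2 := intZ 2^-1 0 1 c2.
have E1 : \int[mu]_(s in `[0, 1]) Re (g s) = 2^-1 * \int[mu]_(s in `[0, 1]) h1 s.
  rewrite -Z1; apply: int_itv_open (ctK _ c1) _ => s s01.
  by rewrite Hg // Re_realM.
have E2 : \int[mu]_(s in `[0, 1]) Im (g s) = 2^-1 * \int[mu]_(s in `[0, 1]) h2 s.
  rewrite -Z2; apply: int_itv_open (ctK _ c2) _ => s s01.
  by rewrite Hg // Im_realM.
by rewrite /cint E1 E2 two_realC; apply: complex_eq; rewrite ?Re_realM ?Im_realM /=; field.
Qed.

End KernelIntegrals.

Theorem theorem0p6 (R : realType) (n : nat) (hn : (2 <= n)%N) (M : R) (hM : 0 <= M)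
    (phi0 phi1 : 'rV[R]_n -> R)
    (hphi0 : test_function phi0) (hphi1 : test_function phi1) :
  [/\ exists u : 'rV[R]_n -> R -> R, klein_gordon_solution M phi0 phi1 u,
      forall u : 'rV[R]_n -> R -> R, klein_gordon_solution M phi0 phi1 u ->
        forall (x : 'rV[R]_n) (t : R), 0 < t ->
          (u x t)%:C =
            (expR (t / 2) * v_ phi0 x (phi t))%:C
            + 2 * cint `[0, 1] (fun s =>
                (v_ phi0 x (phi t * s))%:C * K0 M (phi t * s) t * (phi t)%:C)
            + 2 * cint `[0, 1] (fun s =>
                (v_ phi1 x (phi t * s))%:C * K1 M (phi t * s) t * (phi t)%:C) &
      forall f : 'rV[R]_n -> R, test_function f ->
        (exists v : 'rV[R]_n -> R -> R, wave_solution f v) /\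
        forall v : 'rV[R]_n -> R -> R, wave_solution f v ->
          forall (x : 'rV[R]_n) (t s : R), 0 < t -> 0 <= s <= 1 ->
            v_ f x (phi t * s) = v x (phi t * s)].
Proof.
have [V0 [W0 E0]] := kirchhoff hn hphi0.1; have [V1 [W1 E1]] := kirchhoff hn hphi1.1.
have HRe := radial_kernel_Re M; have HIm := radial_kernel_Im M.
set fr := (fun x => complex.Re (kprofile M x)) in HRe.
set fr1 := (fun x => complex.Re (kprofile1 M x)) in HRe.
set fi := (fun x => complex.Im (kprofile M x)) in HIm.
set fi1 := (fun x => complex.Im (kprofile1 M x)) in HIm.
have Sr := smooth_representation HRe W0 W1; have Si := smooth_representation HIm W0 W1.
have Pr := representation_pde HRe W0 W1; have Pi := representation_pde HIm W0 W1.
have Ir := representation_init HRe V1 W0; have Ii := representation_init HIm V1 W0.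
have Jr := representation_init_t HRe W0 W1; have Ji := representation_init_t HIm W0 W1.
split.
- exists (fun x t => representation fr V0 V1 (x, t)), (representation fr V0 V1); split.
  + exact: Sr.
  + by [].
  + by move=> x t _; exact: Pr.
  + by move=> x; rewrite Ir mul1r.
  + by move=> x; rewrite Jr mul1r.
- move=> u [U [CU uU PU U0 U1]] x t t0.
  have t0' := ltW t0.
  have EU : U (x, t) = representation fr V0 V1 (x, t).
    apply: (klein_gordon_unique CU (Sr 2%N) PU _ _ _ x t0').
    + by move=> y r _; exact: Pr.
    + by move=> y; rewrite U0 Ir mul1r.
    + by move=> y; rewrite U1 Jr mul1r.
  (* The imaginary profile is 0 at eta = 0, so its representation has zero Cauchy data. *)
  have Z : representation fi V0 V1 (x, t) = 0.
    apply: (hyperbolic_uniqueness (c2 := fun t => expR (- (2 * t))) (Si 2%N) (@dq2R R) _ _ _ _ _ _ x t0').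
    + by move=> s; exact: is_derive_continuous (dopp (dcmul 2 (dq2R s))).
    + by move=> s _; rewrite oppr_le0 mulr_ge0 // ltW // expR_gt0.
    + by move=> s s0; rewrite expR_ge0 /= -expR0 ler_expR oppr_le0 mulr_ge0.
    + by move=> y s _; exact: Pi.
    + by move=> y; rewrite Ii mul0r.
    + by move=> y; rewrite Ji mul0r.
  rewrite uU // EU; move: Z.
  rewrite (representation_formula HRe V1 W0) (representation_formula HIm V1 W0).
  have cV0 : continuous V0 by case: W0 => S _ _ _; exact: smooth_cont S.
  have cV1 : continuous V1 by case: W1 => S _ _ _; exact: smooth_cont S.
  have I0 := cint_half (ct_kernel0 HRe (x := x) (t := t) cV0) (ct_kernel0 HIm (x := x) (t := t) cV0).
  have I1 := cint_half (ct_kernel1 HRe (x := x) (t := t) cV1) (ct_kernel1 HIm (x := x) (t := t) cV1).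
  rewrite I0; last first.
    move=> s s01; rewrite E0 K0_kernel0 //.
    by apply: complex_eq; rewrite !(ReM, ImM) /=; ring.
  rewrite I1; last first.
    move=> s /andP[s0 s1]; rewrite E1 K1_kernel1 ?s0 ?ltW //.
    by apply: complex_eq; rewrite !(ReM, ImM) /=; ring.
  rewrite E0.
  move: (Rintegral _ _ _) (Rintegral _ _ _) (Rintegral _ _ _) (Rintegral _ _ _) => a b c d Z.
  (* The real part is the formula with c = 1; the imaginary part is [Z], the formula with c = 0. *)
  apply: complex_eq; rewrite !(ReDc, ImDc) /=; first by rewrite mul1r.
  by rewrite -[LHS]Z mul0r.
- by move=> f; exact: wave_representation.
Qed.
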